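(* Let $(\mathcal F,\mathcal T^X)\in\partial\mathrm{Rat}_{\mathbf F,X}$, let $k_0\ge1$, and let $v,v'$ be distinct internal vertices of $T^X$ such that for $0\le k\le k_0-1$ the annulus $]\!]F^k(v),F^k(v')[\![^Y$ of $T^Y$ is defined and does not contain any critical leaf. Write $v_{k_0}:=F^{k_0}(v)$ and $v'_{k_0}:=F^{k_0}(v')$; the paths $[v,v']$ and $[v_{k_0},v'_{k_0}]$ are taken in $T^Z$. - (Critical) If $\mathcal F$ has degree more than $1$ on one of the annuli $]\!]F^k(v),F^k(v')[\![^Y$, $0\le k\le k_0-1$, then we never have $[v_{k_0},v'_{k_0}]\subseteq[v,v']$. - (Non critical) If this is not the case, and if $[v_{k_0},v'_{k_0}]\subseteq[v,v']$ or $[v,v']\subseteq[v_{k_0},v'_{k_0}]$, then A) either $v_{k_0}=v$ and $v'_{k_0}=v'$; then $i_v(v')$ and $i_{v'}(v)$ are fixed by $f^{k_0}$ and the product of the associated multipliers is $1$; B) or $v_{k_0}=v'$ and $v'_{k_0}=v$; then $f^{k_0}$ exchanges $i_v(v')$ and $i_{v'}(v)$ and the multiplier of the associated cycle is $1$.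
   Context: $\mathbb S$ is the Riemann sphere; $\mathrm{Rat}_d$ is the space of rational maps of degree $d\geq 2$. $X,Y,Z$ are finite sets with at least three elements each and $X\subseteq Y\cap Z$. A portrait $\mathbf F$ of degree $d$ is a pair $(F,\deg)$ with $F:Y\to Z$ and $\deg:Y\to\mathbb N\setminus\{0\}$ such that $\sum_{a\in Y}(\deg(a)-1)=2d-2$ and $\sum_{a\in F^{-1}(b)}\deg(a)=d$ for all $b\in Z$. A tree of spheres $\mathcal T^X$ marked by $X$ consists of a finite tree $T^X$ whose leaves are the elements of $X$ and whose internal (non-leaf) vertices have valence at least $3$, and for each internal vertex $v$ an injection $i_v$ of the set $E_v$ of edges at $v$ into a projective sphere $\mathbb S_v$ (isomorphic to $\mathbb S$). $X_v:=i_v(E_v)$ (similarly $Y_v,Z_v$); for $x\neq v$ a leaf or vertex, $a_v(x)=i_v(x):=i_v(e)$ where $e\in E_v$ lies in the same component of $T-\{v\}$ as $x$. $IV^X$ is the set of internal vertices. $[v,v']$ is the path between $v$ and $v'$, endpoints included. The branch $B_v(\star)$ is the connected component of $T-\{v\}$ containing $\star$ ($T$ regarded as the set of its vertices and edges). For distinct internal vertices $v_1,v_2$ the annulus is $]\!]v_1,v_2[\![:=B_{v_1}(v_2)\cap B_{v_2}(v_1)$; a superscript $Y$ means it is taken in $T^Y$. A cover $\mathcal F:\mathcal T^Y\to\mathcal T^Z$ consists of a map $F:T^Y\to T^Z$ sending leaves to leaves, internal vertices to internal vertices, edges to edges (compatibly with incidence), and for each internal $v$ with $w=F(v)$ a holomorphic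 ramified cover $f_v:\mathbb S_v\to\mathbb S_w$ such that $f_v:\mathbb S_v-Y_v\to\mathbb S_w-Z_w$ is a covering, $f_v\circ i_v=i_w\circ F$, and for an edge $e$ between internal vertices $v,v'$ the local degrees of $f_v$ at $i_v(e)$ and of $f_{v'}$ at $i_{v'}(e)$ agree (the degree of $e$). The degree of an internal vertex is $\deg f_v$, that of a leaf is the degree of its adjacent edge; critical means degree at least $2$. The portrait of $\mathcal F$ is $F|_Y$ with the degrees of the leaves. If an annulus $A$ of $T^Y$ contains no critical leaf, then $F(A)$ is an annulus, $A$ is a connected component of $F^{-1}(F(A))$, and $\mathcal F$ has a well-defined degree on $A$: the sum of the degrees of the elements of $A$ (vertices or edges) above a given element of $F(A)$, which does not depend on that element. $\mathrm{Dyn}_{\mathbf F,X}$ is the set of pairs $(\mathcal F,\mathcal T^X)$ with $\mathcal F:\mathcal T^Y\to\mathcal T^Z$ a cover of portrait $\mathbf F$ and $\mathcal T^X$ a tree of spheres such that each internal vertex $v$ of $T^X$ is an internal vertex of $T^Y$ and $T^Z$, $\mathbb S_v^X=\mathbb S_v^Y=\mathbb S_v^Z$ and $a_v^X=a_v^Y|_X=a_v^Z|_X$. $F^k(v)$ and $f_v^k:=f_{F^{k-1}(v)}\circ\dots\circ f_v$ (also written $f^k$) are defined as long as $v,\dots,F^{k-1}(v)$ lie in $T^X$. $\mathrm{Rat}_{\mathbf F,X}$ is the set of triples $(f,y,z)$ with $f\in\mathrm{Rat}_d$, injections $y:Y\to\mathbb S$, $z:Z\to\mathbb S$, $f\circ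 y=z\circ F$ on $Y$, $\deg_{y(a)}f=\deg(a)$ for $a\in Y$, $y|_X=z|_X$. A sequence $(f_n,y_n,z_n)$ in it converges dynamically to $(\mathcal F,\mathcal T^X)$ if there are isomorphisms $\phi^Y_{n,v}:\mathbb S\to\mathbb S_v$ ($v\in IV^Y$), $\phi^Z_{n,w}:\mathbb S\to\mathbb S_w$ ($w\in IV^Z$) with $\phi^Y_{n,v}\circ y_n\to a_v^Y$, $\phi^Z_{n,w}\circ z_n\to a_w^Z$, $\phi^Z_{n,F(v)}\circ f_n\circ(\phi^Y_{n,v})^{-1}\to f_v$ locally uniformly outside $Y_v$ for all $v\in IV^Y$, and $\phi^Y_{n,v}=\phi^Z_{n,v}$ for $v\in IV^X$. $\partial\mathrm{Rat}_{\mathbf F,X}$ is the set of elements of $\mathrm{Dyn}_{\mathbf F,X}$ that are dynamical limits of sequences in $\mathrm{Rat}_{\mathbf F,X}$. *)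

(* Defs.v *)
From HB Require Import structures.
From mathcomp Require Import all_boot all_order all_algebra.
From mathcomp Require Import complex.
From mathcomp Require Import boolp classical_sets functions reals.
From mathcomp Require Import topology normedtype derive.
Set Implicit Arguments.
Unset Strict Implicit.
Unset Printing Implicit Defensive.
Import Order.TTheory GRing.Theory Num.Theory numFieldNormedType.Exports.
Local Open Scope ring_scope.

(* Naming the complex field as a [numClosedFieldType] gives access to the
   topology that MathComp-Analysis puts on every [numFieldType]. *)
Definition Cplx (R : realType) : numClosedFieldType := R[i].

(* [None] is the point at infinity. *)
Definition sphere (R : realType) : Type := option (Cplx R).

(* Stereographic projection onto the unit sphere of R^3.  The sphere carries
   the (compact, metrizable) uniform structure induced by this embedding. *)
Definition stereo (R : realType) (s : sphere R) : R * R * R :=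
  if s is Some z then
    let x := complex.Re z in let y := complex.Im z in
    let n := x ^+ 2 + y ^+ 2 in
    (2 * x / (1 + n), 2 * y / (1 + n), (n - 1) / (1 + n))
  else (0, 0, 1).

HB.instance Definition _ (R : realType) := Choice.copy (sphere R) (option (Cplx R)).
HB.instance Definition _ (R : realType) :=
  PseudoMetric.copy (sphere R) (initial_topology (@stereo R)).

(* Rational maps are exactly the holomorphic maps from the sphere to itself. *)
Record ratmap (R : realType) := RatMap {
  rnum : {poly Cplx R};
  rden : {poly Cplx R};
  rat_coprime : coprimep rnum rden }.

Definition rdeg (R : realType) (f : ratmap R) : nat :=
  (maxn (size (rnum f)) (size (rden f))).-1.

(* The value at infinity is read off the coefficients of degree [rdeg f]. *)
Definition reval (R : realType) (f : ratmap R) (s : sphere R) : sphere R :=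
  let quo (a b : Cplx R) : sphere R := if b == 0 then None else Some (a / b) in
  if s is Some z then quo (rnum f).[z] (rden f).[z]
  else quo (rnum f)`_(rdeg f) (rden f)`_(rdeg f).

Coercion reval : ratmap >-> Funclass.

(* Local degree: the order of vanishing at [s] of the homogeneous form, of
   degree [rdeg f], which cuts out the fibre of [f] through [s]. *)
Definition ldeg (R : realType) (f : ratmap R) (s : sphere R) : nat :=
  let h := if f s is Some c then rnum f - c *: rden f else rden f in
  if s is Some z then mup z h else ((rdeg f).+1 - size h)%N.

Record sphere_iso (R : realType) := SphereIso {
  iso_fwd : ratmap R;
  iso_bwd : ratmap R;
  iso_fwdK : cancel iso_fwd iso_bwd;
  iso_bwdK : cancel iso_bwd iso_fwd }.

Definition sphere_inv (R : realType) (s : sphere R) : sphere R :=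
  if s is Some z then (if z == 0 then None else Some z^-1) else Some 0.

Definition affine_part (R : realType) (s : sphere R) : Cplx R :=
  if s is Some z then z else 0.

(* Multiplier of [g] at a fixed point [s]: the complex derivative in the
   coordinate [z] if [s] is finite and in the coordinate [1/z] at infinity.
   Only meaningful when [g s = s]. *)
Definition multiplier (R : realType) (g : sphere R -> sphere R) (s : sphere R)
    : Cplx R :=
  if s is Some z then
    derive1 (fun u : Cplx R => affine_part (g (Some u))) z
  else
    derive1 (fun u : Cplx R =>
      affine_part (sphere_inv (g (sphere_inv (Some u))))) 0.

Definition homeo_on (T U : topologicalType) (A : set T) (B : set U) (g : T -> U) :=
  [/\ set_bij A B g, {within A, continuous g}%classic
    & exists h : U -> T,
        {within B, continuous h}%classic /\ (forall x, A x -> h (g x) = x)].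

(* Meant for open [A] and [B], so that open subsets of the subspaces [A] and
   [B] are open subsets of the ambient spaces. *)
Definition covering (T U : topologicalType) (A : set T) (B : set U) (g : T -> U) :=
  (forall x, A x -> B (g x)) /\
  forall b, B b -> exists W : set U, [/\ open W, W b, (W `<=` B)%classic &
    exists (I : Type) (D : I -> set T),
      [/\ forall i, open (D i), trivIset setT D,
          (A `&` g @^-1` W = \bigcup_i D i)%classic
        & forall i, homeo_on (D i) W g]].

Definition cvg_locally_uniformly_outside (R : realType) (A : set (sphere R))
    (g : nat -> sphere R -> sphere R) (h : sphere R -> sphere R) :=
  forall s, ~ A s -> exists2 W : set (sphere R), nbhs s W &
    {uniform W, g @ \oo --> h}%classic.

(* Leaves and internal vertices of all trees are taken in one finite type [V]
   (harmless, as finitely many finite trees are involved), so that a vertex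
   can belong to several trees.  An edge is
   determined by its two endpoints.  Every [S_v] is a copy of the sphere;
   [sph_emb v u] is the point [i_v(e)] for the edge [e] joining [v] to [u]. *)
Record sphere_tree (R : realType) (V : finType) (X : {set V}) := SphereTree {
  verts : {set V};
  edge : rel V;
  edge_verts : forall u w, edge u w -> u \in verts;
  edge_sym : symmetric edge;
  edge_irr : irreflexive edge;
  tree_connected : {in verts &, forall u w, connect edge u w};
  tree_acyclic : forall c, uniq c -> cycle edge c -> (size c <= 2)%N;
  leaf_verts : X \subset verts;
  leafP : {in verts, forall v, (v \in X) = (#|[set u | edge v u]| == 1)%N};
  internal_valence :
    {in verts :\: X, forall v, 3 <= #|[set u | edge v u]|}%N;
  sph_emb : V -> V -> sphere R;
  sph_emb_inj : {in verts :\: X, forall v, {in edge v &, injective (sph_emb v)}} }.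

Definition IV (R : realType) (V : finType) (X : {set V})
    (T : sphere_tree R X) : {set V} := verts T :\: X.

(* The tree regarded as the set of its vertices and edges: the vertex [v] is
   the cell [set v], the edge joining [u] and [w] is the cell [set u; w]. *)
Definition vertex_cells (R : realType) (V : finType) (X : {set V})
    (T : sphere_tree R X) : {set {set V}} := [set [set v] | v in verts T].

Definition edge_cells (R : realType) (V : finType) (X : {set V})
    (T : sphere_tree R X) : {set {set V}} :=
  [set [set p.1; p.2] | p : V * V & edge T p.1 p.2].

Definition cells (R : realType) (V : finType) (X : {set V})
    (T : sphere_tree R X) : {set {set V}} := vertex_cells T :|: edge_cells T.

(* [branch T v c]: connected component of [T - {v}] containing the cell [c]. *)
Definition branch (R : realType) (V : finType) (X : {set V})
    (T : sphere_tree R X) (v : V) (c : {set V}) : {set {set V}} :=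
  [set c' in cells T :\ [set v] |
    connect [rel c1 c2 | [&& c1 \in cells T :\ [set v], c2 \in cells T :\ [set v]
                           & (c1 \subset c2) || (c2 \subset c1)]] c c'].

Definition annulus (R : realType) (V : finType) (X : {set V})
    (T : sphere_tree R X) (v1 v2 : V) : {set {set V}} :=
  branch T v1 [set v2] :&: branch T v2 [set v1].

(* Vertices of the path [v, w] (which determine it, the graph being a tree). *)
Definition tree_path (R : realType) (V : finType) (X : {set V})
    (T : sphere_tree R X) (v w : V) : set V :=
  fun u => exists p : seq V,
    [/\ path (edge T) v p, uniq (v :: p), last v p = w & u \in v :: p].

(* [attach T v x] is the point [i_v(x) = a_v(x)] of the sphere at [v], for
   [x != v]; the default value [None] is never used in that case. *)
Definition attach (R : realType) (V : finType) (X : {set V})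
    (T : sphere_tree R X) (v x : V) : sphere R :=
  if [pick u | edge T v u && ([set v; u] \in branch T v [set x])] is Some u
  then sph_emb T v u else None.

(* [X_v = i_v(E_v)] *)
Definition marked (R : realType) (V : finType) (X : {set V})
    (T : sphere_tree R X) (v : V) : set (sphere R) :=
  fun s => exists2 u, edge T v u & s = sph_emb T v u.

(* [cov_map] and [cov_sph] are only relevant on the vertices, resp. internal
   vertices, of the source tree. *)
Record cover (R : realType) (V : finType) (Y Z : {set V})
    (TY : sphere_tree R Y) (TZ : sphere_tree R Z) := Cover {
  cov_map : V -> V;
  cov_sph : V -> ratmap R;
  cov_leaf : {in Y, forall y, cov_map y \in Z};
  cov_internal : {in IV TY, forall v, cov_map v \in IV TZ};
  cov_edge : forall u w, edge TY u w -> edge TZ (cov_map u) (cov_map w);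
  cov_nonconst : {in IV TY, forall v, 0 < rdeg (cov_sph v)}%N;
  cov_covering : {in IV TY, forall v,
    covering (~` marked TY v)%classic (~` marked TZ (cov_map v))%classic
             (cov_sph v)};
  cov_attach : {in IV TY, forall v u, edge TY v u ->
    cov_sph v (sph_emb TY v u) = sph_emb TZ (cov_map v) (cov_map u)};
  cov_edge_deg : {in IV TY &, forall v w, edge TY v w ->
    ldeg (cov_sph v) (sph_emb TY v w) = ldeg (cov_sph w) (sph_emb TY w v)} }.

Section CoverDegrees.
Variables (R : realType) (V : finType) (Y Z : {set V}).
Variables (TY : sphere_tree R Y) (TZ : sphere_tree R Z) (F : cover TY TZ).

(* The local degree at an internal endpoint; by [cov_edge_deg] the choice of
   the endpoint is irrelevant. *)
Definition edge_degree (c : {set V}) : nat :=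
  if [pick p : V * V | [&& p.1 \in IV TY, edge TY p.1 p.2 & c == [set p.1; p.2]]]
    is Some p then ldeg (cov_sph F p.1) (sph_emb TY p.1 p.2) else 0%N.

Definition leaf_degree (y : V) : nat :=
  if [pick u | edge TY y u] is Some u then edge_degree [set y; u] else 0%N.

Definition vertex_degree (v : V) : nat :=
  if v \in Y then leaf_degree v else rdeg (cov_sph F v).

Definition cell_degree (c : {set V}) : nat :=
  if [pick v | c == [set v]] is Some v then vertex_degree v else edge_degree c.

Definition cell_map (c : {set V}) : {set V} := [set cov_map F v | v in c].

Definition no_critical_leaf (A : {set {set V}}) : Prop :=
  forall y, y \in Y -> [set y] \in A -> ~ (2 <= leaf_degree y)%N.

(* The degree of [F] on [A] as a relation: the fibre sum is [D] above every
   element of [F(A)]. *)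
Definition degree_on (A : {set {set V}}) (D : nat) : Prop :=
  forall b, b \in [set cell_map a | a in A] ->
    (\sum_(a in A | cell_map a == b) cell_degree a)%N = D.

(* [f_{F^{k-1}(v)} o ... o f_v] *)
Fixpoint sph_iter (k : nat) (v : V) (s : sphere R) : sphere R :=
  if k is k'.+1 then sph_iter k' (cov_map F v) (cov_sph F v s) else s.

End CoverDegrees.

(* [pmap] and [pdeg] are only relevant on [Y]. *)
Record portrait (V : finType) (Y Z : {set V}) (d : nat) := Portrait {
  pmap : V -> V;
  pdeg : V -> nat;
  pmap_in : {in Y, forall a, pmap a \in Z};
  pdeg_gt0 : {in Y, forall a, 0 < pdeg a}%N;
  portrait_RH : (\sum_(a in Y) (pdeg a - 1) = 2 * d - 2)%N;
  portrait_fib : {in Z, forall b, \sum_(a in Y | pmap a == b) pdeg a = d}%N }.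

Record Dyn (R : realType) (V : finType) (X Y Z : {set V}) (d : nat)
    (P : portrait Y Z d) := MkDyn {
  treeX : sphere_tree R X;
  treeY : sphere_tree R Y;
  treeZ : sphere_tree R Z;
  dcov : cover treeY treeZ;
  dyn_portrait : {in Y, forall a,
    cov_map dcov a = pmap P a /\ leaf_degree dcov a = pdeg P a};
  dyn_internal : {in IV treeX, forall v, v \in IV treeY /\ v \in IV treeZ};
  dyn_attach : {in IV treeX, forall v, {in X, forall x,
    attach treeX v x = attach treeY v x /\ attach treeX v x = attach treeZ v x}} }.

(* [y] and [z] are only relevant on [Y] and [Z]. *)
Definition inRat (R : realType) (V : finType) (X Y Z : {set V}) (d : nat)
    (P : portrait Y Z d) (f : ratmap R) (y z : V -> sphere R) : Prop :=
  [/\ rdeg f = d,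
      {in Y &, injective y} /\ {in Z &, injective z},
      {in Y, forall a, f (y a) = z (pmap P a)},
      {in Y, forall a, ldeg f (y a) = pdeg P a}
    & {in X, forall x, y x = z x}].

Definition cvg_dynamically (R : realType) (V : finType) (X Y Z : {set V})
    (d : nat) (P : portrait Y Z d) (f : nat -> ratmap R)
    (y z : nat -> V -> sphere R) (G : Dyn R X P) : Prop :=
  exists phiY phiZ : nat -> V -> sphere_iso R,
  [/\ {in IV (treeY G), forall v, {in Y, forall a,
        ((fun n => iso_fwd (phiY n v) (y n a)) @ \oo --> attach (treeY G) v a)%classic}},
      {in IV (treeZ G), forall w, {in Z, forall b,
        ((fun n => iso_fwd (phiZ n w) (z n b)) @ \oo --> attach (treeZ G) w b)%classic}},
      {in IV (treeY G), forall v,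
        cvg_locally_uniformly_outside (marked (treeY G) v)
          (fun n => iso_fwd (phiZ n (cov_map (dcov G) v)) \o f n
                      \o iso_bwd (phiY n v))
          (cov_sph (dcov G) v)}
    & {in IV (treeX G), forall v n, iso_fwd (phiY n v) =1 iso_fwd (phiZ n v)}].

Definition in_boundary (R : realType) (V : finType) (X Y Z : {set V})
    (d : nat) (P : portrait Y Z d) (G : Dyn R X P) : Prop :=
  exists (f : nat -> ratmap R) (y z : nat -> V -> sphere R),
    (forall n, inRat X P (f n) (y n) (z n)) /\ cvg_dynamically f y z G.

(* Main.v *)
Require Import Defs.
From mathcomp Require Import all_boot all_order all_algebra.
From mathcomp Require Import complex ring lra zify.
From mathcomp Require Import boolp classical_sets functions reals.
From mathcomp Require Import topology normedtype derive.
Set Implicit Arguments.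
Unset Strict Implicit.
Unset Printing Implicit Defensive.
Import Order.TTheory GRing.Theory Num.Theory numFieldNormedType.Exports.
Local Open Scope ring_scope.

(** The theorem is a statement about sizes of annuli.  Take two leaves [s], [q]
beyond [v] and two leaves [t], [r] beyond [v'], in distinct branches at [v] and
at [v'].  When the maps [f_n] degenerate, the cross-ratio of the four marked
points [s], [q], [t], [r] tends to zero; it measures the size of the annulus
between [v] and [v'], much as the ratio of the two radii measures a round
annulus.  Dividing it by a factor read at each of the two limit spheres gives a
number [qsize] that does not depend, in the limit, on the four leaves
([qsize_change]).

The heart of the proof is the effect of one step ([size_step]).  Let [w] and
[w'] be the images of [v] and [v'].  Write the cross-ratio of two moving points
near the two ends against a leaf [bi] beyond [w] and a leaf [b0] beyond [w'].
Since the portrait prescribes the complete fibres of [f_n] over [bi] and [b0],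
the form that cuts out such a fibre is known up to a constant ([fibre_family]),
and the cross-ratio of the images is exactly a product of cross-ratios of points
of the source.  The hypothesis on the annulus enters here: without critical leaf
the cover does not fold it ([annulus_path]), a leaf inside it is mapped inside
the annulus between [w] and [w'] ([annulus_leaf_con]), and so every point of the
two fibres lies beyond [v] or beyond [v'].  Hence each factor has a limit that
involves only one of the two moving points; letting them vary shows that
   (size of the image) / (size of the annulus)^m  tends to  c c',
where [m] is the local degree of [f_v] at the point towards [v'] (it is also the
degree of the cover on the annulus, [degree_on_annulus]) and [c], [c'] are the
leading coefficients of [f_v] and [f_(v')] at the two ends.

On leaves of [X] the points [y_n] and [z_n] coincide, so that the sizes in the
source tree and in the target tree can be identified and the steps composed
([chain]): with [N] the product of the degrees,
   (size of the last annulus) / (size of the first annulus)^N  tends to  C,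
with [C] nonzero; when [N = 1], the constant [C] is the product of the derivatives
of [f^k0] at the two ends.

Finally, if the path between [w] and [w'] lies in the path between [v] and [v'],
then the quotient of the first size by the last one has a limit, which vanishes
unless the end points are the same ([nested_size]).  As the first size tends to
zero, this is incompatible with [N > 1].  If [N = 1], a nonzero limit of the
quotients in one direction or in the other forces the end points to agree up to
exchange; then the two sizes are equal, [C = 1], and [C] is the announced product
of multipliers ([multiplier_germ]). *)

(** * Binary forms and the local degrees of rational maps *)
Section Wedge.
Variable K : fieldType.
Implicit Types S T : K * K.

Definition wedge S T : K := S.1 * T.2 - S.2 * T.1.

Implicit Types h g : {poly K}.

(** The homogenisation of [h] as a binary form of degree [D]. *)
Definition hpoly (D : nat) h S : K :=
  \sum_(i < D.+1) h`_i * S.1 ^+ i * S.2 ^+ (D - i).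

Definition vscale (a : K) S : K * K := (a * S.1, a * S.2).

Lemma wedgeC S T : wedge S T = - wedge T S.
Proof. rewrite /wedge; ring. Qed.

Lemma wedgeZl a S T : wedge (vscale a S) T = a * wedge S T.
Proof. rewrite /wedge /=; ring. Qed.

Lemma wedgeZr a S T : wedge S (vscale a T) = a * wedge S T.
Proof. rewrite /wedge /=; ring. Qed.

Lemma hpolyB D h g S : hpoly D (h - g) S = hpoly D h S - hpoly D g S.
Proof.
rewrite /hpoly -sumrB; apply: eq_bigr => i _; rewrite coefB; ring.
Qed.

Lemma hpolyZ D c h S : hpoly D (c *: h) S = c * hpoly D h S.
Proof.
rewrite /hpoly mulr_sumr; apply: eq_bigr => i _; rewrite coefZ; ring.
Qed.

Lemma hpoly_finite D h (x : K) : (size h <= D.+1)%N -> hpoly D h (x, 1) = h.[x].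
Proof.
move=> hs; rewrite (horner_coef_wide _ hs); apply: eq_bigr => i _ /=.
by rewrite expr1n mulr1.
Qed.

Lemma hpoly_inf D h (x : K) : hpoly D h (x, 0) = h`_D * x ^+ D.
Proof.
rewrite /hpoly big_ord_recr /= subnn expr0 mulr1 big1 ?add0r // => i _.
by rewrite expr0n subn_eq0 leqNgt ltn_ord mulr0.
Qed.

Lemma hpoly_scale D h a S : hpoly D h (vscale a S) = a ^+ D * hpoly D h S.
Proof.
rewrite /hpoly mulr_sumr; apply: eq_bigr => i _ /=.
have -> : a ^+ D = a ^+ i * a ^+ (D - i) by rewrite -exprD subnKC ?leq_ord.
rewrite !exprMn; ring.
Qed.

Lemma hpoly_shrink D h S : (size h <= D.+1)%N ->
  hpoly D.+1 h S = S.2 * hpoly D h S.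
Proof.
move=> hs; rewrite /hpoly big_ord_recr /= nth_default // !mul0r addr0 mulr_sumr.
apply: eq_bigr => i _; rewrite subSn ?leq_ord // exprS; ring.
Qed.

Lemma hpoly_mulX D h S : (size h <= D.+1)%N ->
  hpoly D.+1 (h * 'X) S = S.1 * hpoly D h S.
Proof.
move=> hs; rewrite /hpoly big_ord_recl /= coefMX eqxx !mul0r add0r mulr_sumr.
apply: eq_bigr => i _; rewrite coefMX /= subSS exprS; ring.
Qed.

Lemma hpoly_mulXsubC D h z S : (size h <= D.+1)%N ->
  hpoly D.+1 (h * ('X - z%:P)) S = hpoly D h S * (S.1 - z * S.2).
Proof.
move=> hs; rewrite mulrBr hpolyB hpoly_mulX // [h * _%:P]mulrC mul_polyC hpolyZ.
rewrite hpoly_shrink //; ring.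
Qed.

End Wedge.

Section Sphere.
Variable C : numClosedFieldType.
Implicit Types s t b : option C.

(** Homogeneous coordinates, [None] being the point at infinity.  Computations on
the sphere go through [br], which vanishes exactly on the diagonal and only
changes by a factor under a linear change of coordinates. *)
Definition vec s : C * C := if s is Some z then (z, 1) else (1, 0).
Definition pt (S : C * C) : option C := if S.2 == 0 then None else Some (S.1 / S.2).
Definition br s t := wedge (vec s) (vec t).

Lemma br_eq0 s t : (br s t == 0) = (s == t).
Proof.
rewrite /br /wedge; case: s t => [z|] [w|] /=.
- by rewrite mulr1 mul1r subr_eq0.
- by rewrite mulr0 mul1r sub0r oppr_eq0 oner_eq0.
- by rewrite mulr1 mul0r subr0 oner_eq0.
- by rewrite mulr0 mul0r subr0 !eqxx.
Qed.

Lemma br_neq0 s t : s != t -> br s t != 0.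
Proof. by rewrite br_eq0. Qed.

Lemma brC s t : br s t = - br t s. Proof. exact: wedgeC. Qed.

Lemma brxx s : br s s = 0. Proof. by apply/eqP; rewrite br_eq0. Qed.

Lemma vec_pt S : S != (0, 0) -> exists2 m : C, m != 0 & S = vscale m (vec (pt S)).
Proof.
case: S => x y; rewrite xpair_eqE /pt /=.
have [->|y0] := eqVneq y 0; rewrite /= ?andbT => x0.
  by exists x => //; rewrite /vscale /= mulr1 mulr0.
by exists y => //; rewrite /vscale /= mulr1 mulrCA divff // mulr1.
Qed.

Lemma pt_scale (a : C) s : a != 0 -> pt (vscale a (vec s)) = s.
Proof.
move=> a0; case: s => [z|]; rewrite /pt /= ?mulr0 ?eqxx // mulr1 (negbTE a0).
by rewrite mulrAC divff // mul1r.
Qed.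

Lemma vec_neq0 s : vec s != (0, 0).
Proof. by case: s => [z|]; rewrite xpair_eqE /= oner_eq0 ?andbF. Qed.

(** The multiplicity at [s] of the form [hpoly D h]; at infinity it is the drop
of the degree of [h] below [D]. *)
Definition mult_at (D : nat) (h : {poly C}) s : nat :=
  if s is Some z then mup z h else (D.+1 - size h)%N.

(** Over an algebraically closed field a binary form splits into linear factors:
each root of [h] gives one, and each missing degree gives one at infinity. *)
Lemma form_factor (D : nat) (h : {poly C}) :
  h != 0 -> (size h <= D.+1)%N ->
  exists (k : C) (rs : seq (option C)),
    [/\ k != 0, size rs = D,
        forall S, hpoly D h S = k * \prod_(r <- rs) wedge S (vec r)
      & forall s, count_mem s rs = mult_at D h s].
Proof.
elim: D h => [|D IH] h h0 hs.
  have sz1 : size h = 1%N by move: h0; rewrite -size_poly_gt0; lia.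
  have /size_poly1P[c c0 hE] : size h == 1%N by rewrite sz1.
  exists c, [::]; split=> // [S|s].
    by rewrite big_nil /hpoly big_ord1 hE coefC /= !expr0 !mulr1.
  rewrite /mult_at sz1; case: s => [z|] //=.
  by rewrite hE; apply/esym/eqP; rewrite mupNroot // rootC.
have [hs'|hs'] := leqP (size h) D.+1.
  have [k [rs [k0 srs hE cE]]] := IH h h0 hs'.
  exists (- k), (None :: rs); split=> [||S|s].
  - by rewrite oppr_eq0.
  - by rewrite /= srs.
  - rewrite big_cons hpoly_shrink // hE /wedge /=; ring.
  - by rewrite /= cE; case: s => [z|] //=; rewrite add1n -subSn.
have /closed_rootP[z] : size h != 1%N by lia.
case/factor_theorem=> g hE.
have g0 : g != 0 by apply: contraNneq h0 => g0; rewrite hE g0 mul0r.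
have gs : (size g <= D.+1)%N.
  by move: hs; rewrite hE size_Mmonic ?monicXsubC // size_XsubC addn2 /= ltnS.
have [k [rs [k0 srs gE cE]]] := IH g g0 gs.
exists k, (Some z :: rs); split=> [||S|s] //.
- by rewrite /= srs.
- rewrite big_cons hE hpoly_mulXsubC // gE /wedge /=; ring.
- rewrite /= cE hE; case: s => [w|] /=.
    by rewrite mupM ?polyXsubC_eq0 // (mup_XsubCX 1) addnC; congr (_ + _)%N.
  by rewrite size_Mmonic ?monicXsubC // size_XsubC addn2 /= subSS.
Qed.

(** The numerator of the derivative of [p / q]: it vanishes at critical points. *)
Definition wronskian (p q : {poly C}) := p^`() * q - p * q^`().

Lemma wronskian_mup (h g : {poly C}) z : h != 0 -> root h z -> g.[z] != 0 ->
  wronskian h g != 0 /\ mup z (wronskian h g) = (mup z h).-1.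
Proof.
move=> h0 hz gz; have [m [k]] := multiplicity_XsubC h z.
rewrite h0 /= => rk hE.
have m0 : (0 < m)%N.
  by case: m hE hz => // ->; rewrite expr0 mulr1 (negbTE rk).
have -> : mup z h = m by rewrite hE mupMr // mup_XsubCX eqxx.
pose u := k *+ m * g + ('X - z%:P) * (k^`() * g - k * g^`()).
have WE : wronskian h g = u * ('X - z%:P) ^+ m.-1.
  rewrite /wronskian /u hE derivM deriv_exp derivXsubC mul1r.
  have -> : ('X - z%:P : {poly C}) ^+ m = ('X - z%:P) * ('X - z%:P) ^+ m.-1.
    by rewrite -exprS prednK.
  rewrite -mulr_natr -[k *+ m]mulr_natr; ring.
have ru : ~~ root u z.
  rewrite /root !hornerE hornerMn subrr mul0r addr0 mulf_neq0 //.
  by rewrite mulrn_eq0 negb_or -lt0n m0.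
have u0 : u != 0 by apply: contraNneq ru => ->; rewrite root0.
rewrite WE; split; first by rewrite mulf_neq0 // expf_neq0 // polyXsubC_eq0.
by rewrite mupMr // mup_XsubCX eqxx.
Qed.

Lemma lead_coef_deriv_lt (p : {poly C}) : (1 < size p)%N ->
  size p^`() = (size p).-1 /\ lead_coef p^`() = lead_coef p *+ (size p).-1.
Proof.
move=> sp; have e : (size p).-1.-1.+1 = (size p).-1 by lia.
have c0 : p`_(size p).-1 *+ (size p).-1 != 0.
  rewrite mulrn_eq0 negb_or -lead_coefE lead_coef_eq0 -size_poly_gt0.
  by move: sp; case: (size p) => [|[|n]].
have sd : size p^`() = (size p).-1.
  by rewrite /deriv -/(deriv p) size_poly_eq // e.
by split=> //; rewrite lead_coefE sd coef_deriv e -lead_coefE.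
Qed.

Lemma wronskian_size (h g : {poly C}) (a b : nat) :
  size h = a.+1 -> size g = b.+1 -> (a < b)%N -> size (wronskian h g) = (a + b)%N.
Proof.
move=> sh sg ab.
have h0 : h != 0 by rewrite -size_poly_gt0 sh.
have g0 : g != 0 by rewrite -size_poly_gt0 sg.
have [] := @lead_coef_deriv_lt g; first by rewrite sg ltnS (leq_ltn_trans _ ab).
rewrite sg /= => sg' lg.
have g'0 : g^`() != 0 by rewrite -size_poly_gt0 sg' (leq_ltn_trans _ ab).
have shg : size (h * g^`()) = (a + b)%N by rewrite size_mul // sg' sh.
have lhg : lead_coef (h * g^`()) = lead_coef h * lead_coef g *+ b.
  by rewrite lead_coefM lg mulrnAr.
case: a => [|a] in sh ab shg *.
  have /size_poly1P[c c0 hE] : size h == 1%N by rewrite sh.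
  by rewrite /wronskian {1}hE derivC mul0r sub0r size_polyN shg.
have [] := @lead_coef_deriv_lt h; first by rewrite sh.
rewrite sh /= => sh' lh.
have h'0 : h^`() != 0 by rewrite -size_poly_gt0 sh'.
have shg' : size (h^`() * g) = (a.+1 + b)%N by rewrite size_mul // sh' sg addnS.
have lhg' : lead_coef (h^`() * g) = lead_coef h * lead_coef g *+ a.+1.
  by rewrite lead_coefM lh mulrnAl.
apply/eqP; rewrite eqn_leq; apply/andP; split.
  by rewrite (leq_trans (size_polyD _ _)) // geq_max size_polyN shg shg' leqnn.
have : (wronskian h g)`_(a.+1 + b).-1 != 0.
  rewrite coefB -{1}shg' -lead_coefE lhg' -shg -lead_coefE lhg.
  rewrite -opprB -mulrnBr ?(ltnW ab) // oppr_eq0 mulrn_eq0 negb_or.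
  by rewrite mulf_neq0 ?lead_coef_eq0 // subn_eq0 -ltnNge ab.
by apply: contraR; rewrite -ltnNge => lt; rewrite nth_default // -ltnS.
Qed.

(** Degree, evaluation and local degree of the map given by a pair of polynomials.
On the complex numbers these are convertible to [rdeg], [reval] and [ldeg]; over
an abstract field the algebra below remains light. *)
Definition pdegree (f : {poly C} * {poly C}) : nat :=
  (maxn (size f.1) (size f.2)).-1.

Definition peval (f : {poly C} * {poly C}) s : option C :=
  let quo (a b : C) := if b == 0 then None else Some (a / b) in
  if s is Some z then quo f.1.[z] f.2.[z]
  else quo f.1`_(pdegree f) f.2`_(pdegree f).

Definition pldeg (f : {poly C} * {poly C}) s : nat :=
  let h := if peval f s is Some c then f.1 - c *: f.2 else f.2 in
  if s is Some z then mup z h else ((pdegree f).+1 - size h)%N.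

Section RationalMap.
Variable f : {poly C} * {poly C}.
Hypothesis rat_coprime : coprimep f.1 f.2.
Local Notation rnum := f.1.
Local Notation rden := f.2.
Local Notation rdeg := (pdegree f).
Local Notation ldeg := (pldeg f).

(** A lift to homogeneous coordinates, in which values become polynomial. *)
Definition hlift (S : C * C) : C * C := (hpoly rdeg rnum S, hpoly rdeg rden S).

Lemma rdeg_num : (size rnum <= rdeg.+1)%N.
Proof. rewrite /pdegree; lia. Qed.
Lemma rdeg_den : (size rden <= rdeg.+1)%N.
Proof. rewrite /pdegree; lia. Qed.

Lemma rat_neq0 : (rnum != 0) || (rden != 0).
Proof.
rewrite -negb_and; apply/negP => /andP[/eqP n0 /eqP d0].
have := rat_coprime; rewrite n0 d0 coprimep0 => /eqp_size.
by rewrite size_poly0 size_poly1.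
Qed.

Lemma rdeg_max : maxn (size (rnum)) (size (rden)) = (rdeg).+1.
Proof.
rewrite /pdegree prednK //; move: (rat_neq0); rewrite -!size_poly_gt0; lia.
Qed.

Lemma hlift_neq0 s : hlift (vec s) != (0, 0).
Proof.
apply/negP; rewrite xpair_eqE; case: s => [z|] /=.
  rewrite !hpoly_finite ?rdeg_num ?rdeg_den // => /andP[rn rd].
  by have := coprimep_root (rat_coprime) rn; rewrite rd.
rewrite !hpoly_inf !expr1n !mulr1 => /andP[/eqP rn /eqP rd].
have [e|e] : size (rnum) = (rdeg).+1 \/ size (rden) = (rdeg).+1.
- by have := rdeg_max; lia.
- have : lead_coef (rnum) = 0 by rewrite lead_coefE e.
  by move/eqP; rewrite lead_coef_eq0 -size_poly_eq0 e.
- have : lead_coef (rden) = 0 by rewrite lead_coefE e.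
  by move/eqP; rewrite lead_coef_eq0 -size_poly_eq0 e.
Qed.

Lemma pt_hlift s : pt (hlift (vec s)) = peval f s.
Proof.
rewrite /pt /hlift; case: s => [z|] /=.
  by rewrite !hpoly_finite ?rdeg_num ?rdeg_den.
by rewrite !hpoly_inf !expr1n !mulr1.
Qed.

Lemma hlift_vec s :
  exists2 m : C, m != 0 & hlift (vec s) = vscale m (vec (peval f s)).
Proof. by have := vec_pt (hlift_neq0 s); rewrite pt_hlift. Qed.

Lemma wedge_hlift0 s b :
  (wedge (hlift (vec s)) (vec b) == 0) = (peval f s == b).
Proof.
have [m m0 ->] := hlift_vec s.
by rewrite wedgeZl mulf_eq0 (negbTE m0) -br_eq0.
Qed.

(** Up to sign, [fib_poly b] is the dehomogenised form that cuts out the fibre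
over [b], see [wedge_fib]. *)
Definition fib_poly (b : option C) : {poly C} :=
  if b is Some c then rnum - c *: rden else rden.

Lemma ldegE s : ldeg s = mult_at (rdeg) (fib_poly (peval f s)) s.
Proof. by rewrite /pldeg /peval /mult_at /fib_poly; case: s => [z|]; case: (if _ == _ then _ else _). Qed.

Lemma fib_poly_size b : (size (fib_poly b) <= (rdeg).+1)%N.
Proof.
case: b => [c|] /=; last exact: rdeg_den.
rewrite (leq_trans (size_polyD _ _)) // geq_max rdeg_num size_polyN.
by rewrite (leq_trans (size_scale_leq _ _)) // rdeg_den.
Qed.

Lemma fib_poly_neq0 b : (0 < rdeg)%N -> fib_poly b != 0.
Proof.
move=> d0; apply/eqP => h0; have := rat_coprime.
have absurd_deg a : pdegree f = a.-1 -> a = 1%N -> False.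
  by move=> e a1; move: d0; rewrite e a1.
have := erefl rdeg; rewrite {1}/pdegree => rm.
case: b h0 => [c|] /= h0.
  have nE : rnum = c *: rden by apply/eqP; rewrite -subr_eq0 h0.
  have [c0|c0] := eqVneq c 0.
    rewrite nE c0 scale0r coprime0p => /eqp_size; rewrite size_poly1.
    by apply: absurd_deg; rewrite -rm nE c0 scale0r size_poly0 max0n.
  rewrite nE coprimepZl // coprimepp => /eqP.
  by apply: absurd_deg; rewrite -rm nE size_scale // maxnn.
rewrite h0 coprimep0 => /eqp_size; rewrite size_poly1.
by apply: absurd_deg; rewrite -rm h0 size_poly0 maxn0.
Qed.

Lemma wedge_fib b S : wedge (hlift S) (vec b) =
  (if b is Some _ then 1 else -1) * hpoly (rdeg) (fib_poly b) S.
Proof.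
case: b => [c|] /=; rewrite /wedge /hlift /=; last by ring.
rewrite hpolyB hpolyZ; ring.
Qed.

(** The fibre over [b], counted with local degrees, is the divisor of a form of
degree [rdeg]: all the countings of preimages below come from this. *)
Lemma fibre_factor b : (0 < rdeg)%N ->
  exists (k : C) (rs : seq (option C)), [/\ k != 0, size rs = rdeg,
    forall S, wedge (hlift S) (vec b) = k * \prod_(r <- rs) wedge S (vec r),
    forall s, (s \in rs) = (peval f s == b)
  & forall s, peval f s = b -> count_mem s rs = ldeg s].
Proof.
move=> d0; have [k [rs [k0 srs hE cE]]] :=
  form_factor (fib_poly_neq0 b d0) (fib_poly_size b).
set e : C := if b is Some _ then 1 else -1.
have e0 : e != 0 by rewrite /e; case: (b) => *; rewrite ?oppr_eq0 oner_eq0.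
have wE S : wedge (hlift S) (vec b) = e * k * \prod_(r <- rs) wedge S (vec r).
  by rewrite wedge_fib hE mulrA.
exists (e * k), rs; split=> // [|s|s fs]; first by rewrite mulf_neq0.
  rewrite -wedge_hlift0 wE !mulf_eq0 (negbTE e0) (negbTE k0) /=.
  apply/idP/idP => [srs'|].
    by rewrite (perm_big _ (perm_to_rem srs')) big_cons /= -/(br s s) brxx mul0r.
  by rewrite prodf_seq_eq0 => /hasP[r rrs] /=; rewrite -/(br s r) br_eq0 => /eqP ->.
by rewrite cE ldegE fs.
Qed.

Lemma ldeg_gt0 s : (0 < rdeg)%N -> (0 < ldeg s)%N.
Proof.
move=> /(fibre_factor (peval f s))[k [rs [_ _ _ mE cE]]].
by rewrite -(cE s) // -has_count has_pred1 mE.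
Qed.

Lemma ldeg_le s : (0 < rdeg)%N -> (ldeg s <= rdeg)%N.
Proof.
by move=> /(fibre_factor (peval f s))[k [rs [_ <- _ _ <- //]]]; apply: count_size.
Qed.

Lemma ldeg_add s t : (0 < rdeg)%N -> s != t -> peval f s = peval f t ->
  (ldeg s + ldeg t <= rdeg)%N.
Proof.
move=> /(fibre_factor (peval f s))[k [rs [_ <- _ _ cE]]] st fst.
rewrite -(cE s) // -(cE t) //= -count_predUI.
rewrite [X in (_ + X)%N](eq_count (a2 := pred0)) ?count_pred0 ?addn0 ?count_size //.
by move=> r /=; apply/negbTE; apply: contraNN st => /andP[/eqP <- /eqP <-].
Qed.

Lemma ratmap_surj b : (0 < rdeg)%N -> exists s, peval f s = b.
Proof.
move=> d0; have [k [rs [_ srs _ mE _]]] := fibre_factor b d0.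
case: rs srs mE => [|r rs] /= srs mE; first by lia.
by exists r; apply/eqP; rewrite -mE inE eqxx.
Qed.

Lemma sum_count_uniq (T : eqType) (rs ss : seq T) : uniq ss ->
  (\sum_(s <- ss) count_mem s rs = count (mem ss) rs)%N.
Proof.
move=> us; elim: rs => [|r rs IH] /=; first by rewrite big1.
rewrite big_split /= IH; congr (_ + _)%N.
rewrite -(count_uniq_mem r us) -sum1_count [RHS]big_mkcond /=.
by apply: eq_bigr => s _; rewrite /= eq_sym; case: eqP.
Qed.

Lemma prod_count (T : eqType) (rs ss : seq T) (phi : T -> C) : uniq ss ->
  {subset rs <= ss} ->
  \prod_(r <- rs) phi r = \prod_(s <- ss) phi s ^+ count_mem s rs.
Proof.
move=> us; elim: rs => [|r rs IH] sub.
  by rewrite big_nil big1 // => s _; rewrite expr0.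
rewrite big_cons IH => [|x xr]; last by rewrite sub // inE xr orbT.
have rss : r \in ss by rewrite sub // inE eqxx.
rewrite (bigD1_seq r) //= [RHS](bigD1_seq r) //= eqxx exprS mulrA; congr (_ * _).
by apply: eq_bigr => s; rewrite eq_sym => /negbTE ->.
Qed.

(** Points of a fibre whose local degrees add up to the degree exhaust the fibre,
so that the form that cuts it out is known up to a constant. *)
Lemma fibre_family (I : finType) (A : {pred I}) (y : I -> option C) b :
  (0 < rdeg)%N -> {in A &, injective y} -> (forall a, a \in A -> peval f (y a) = b) ->
  (\sum_(a in A) ldeg (y a) = rdeg)%N ->
  (forall s, peval f s = b -> exists2 a, a \in A & s = y a) /\
  exists2 k : C, k != 0 & forall S, wedge (hlift S) (vec b) =
    k * \prod_(a in A) wedge S (vec (y a)) ^+ ldeg (y a).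
Proof.
move=> d0 yinj fy sumd; have [k [rs [k0 srs wE mE cE]]] := fibre_factor b d0.
pose ss := [seq y a | a <- enum A].
have uss : uniq ss.
  rewrite map_inj_in_uniq ?enum_uniq // => a a'.
  by rewrite !mem_enum; apply: yinj.
have allss : all (mem ss) rs.
  rewrite all_count -sum_count_uniq // big_map big_enum /= srs -sumd.
  by apply/eqP/eq_bigr => a aA; rewrite cE // fy.
have sub : {subset rs <= ss} by apply/allP.
split=> [s fs|].
  have /sub/mapP[a] : s \in rs by rewrite mE fs.
  by rewrite mem_enum => aA ->; exists a.
exists k => // S; rewrite wE; congr (_ * _).
rewrite (prod_count (fun r => wedge S (vec r)) uss sub) big_map big_enum /=.
by apply: eq_bigr => a aA; rewrite cE // fy.
Qed.

Lemma fibre_sum (I : finType) (A : {pred I}) (y : I -> option C) b :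
  (0 < rdeg)%N -> {in A &, injective y} -> (forall a, a \in A -> peval f (y a) = b) ->
  (forall s, peval f s = b -> exists2 a, a \in A & s = y a) ->
  (\sum_(a in A) ldeg (y a) = rdeg)%N.
Proof.
move=> d0 yinj fy full; have [k [rs [_ <- _ mE cE]]] := fibre_factor b d0.
pose ss := [seq y a | a <- enum A].
have uss : uniq ss.
  rewrite map_inj_in_uniq ?enum_uniq // => a a'.
  by rewrite !mem_enum; apply: yinj.
have allss : all (mem ss) rs.
  apply/allP => r; rewrite mE => /eqP/full[a aA ->].
  by apply/mapP; exists a; rewrite ?mem_enum.
move: (allss); rewrite all_count => /eqP <-.
rewrite -sum_count_uniq // big_map big_enum /=.
by apply: eq_bigr => a aA; rewrite cE // fy.
Qed.

(** Together with [fib_poly b] it spans the same pencil as numerator and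
denominator, hence has the same Wronskian up to a constant. *)
Definition cofib_poly b : {poly C} := if b is Some _ then rden else rnum.

Lemma wronskian_fib b : exists2 e : C, e != 0 &
  wronskian rnum rden = e *: wronskian (fib_poly b) (cofib_poly b).
Proof.
case: b => [c|] /=; [exists 1 | exists (-1)]; rewrite ?oppr_eq0 ?oner_eq0 //.
  rewrite scale1r /wronskian derivB derivZ -!mul_polyC; ring.
rewrite scaleN1r /wronskian; ring.
Qed.

Lemma mupZ (e : C) (h : {poly C}) z : e != 0 -> mup z (e *: h) = mup z h.
Proof.
by move=> e0; rewrite -mul_polyC mupMr // rootC.
Qed.

(** The critical points, with their multiplicities, form the divisor of the
homogenised Wronskian, a form of degree [2 * rdeg - 2]; at infinity its
multiplicity is read off the degree of the Wronskian. *)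
Lemma riemann_hurwitz : (0 < rdeg)%N ->
  exists rs : seq (option C), size rs = (2 * rdeg - 2)%N /\
    forall s, count_mem s rs = (ldeg s).-1.
Proof.
move=> d0; pose W := wronskian rnum rden.
have Wfin z : W != 0 /\ mup z W = (ldeg (Some z)).-1.
  have [e e0 WE] := wronskian_fib (peval f (Some z)).
  have [W0 mW] : wronskian (fib_poly (peval f (Some z)))
      (cofib_poly (peval f (Some z))) != 0 /\
    mup z (wronskian (fib_poly (peval f (Some z)))
      (cofib_poly (peval f (Some z)))) = (ldeg (Some z)).-1.
    rewrite ldegE /mult_at; apply: wronskian_mup; first exact: fib_poly_neq0.
      have := wedge_hlift0 (Some z) (peval f (Some z)); rewrite eqxx wedge_fib.
      rewrite mulf_eq0 hpoly_finite ?fib_poly_size // => /orP[|//].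
      by case: (peval _ _) => [?|]; rewrite ?oppr_eq0 oner_eq0.
    rewrite /cofib_poly /=; have [d|d] := eqVneq rden.[z] 0; rewrite ?d ?eqxx ?(negbTE d) //.
    by apply/negP => n; have := coprimep_root rat_coprime n; rewrite d eqxx.
  by rewrite /W WE scaler_eq0 (negbTE e0) mupZ.
(* at infinity, the form of the fibre drops below degree [rdeg] but [cofib_poly]
   does not *)
have Winf : size W = (2 * rdeg - ldeg None)%N.
  have [e e0 WE] := wronskian_fib (peval f None).
  rewrite /W WE size_scale //.
  have h0 := fib_poly_neq0 (peval f None) d0.
  have hs := fib_poly_size (peval f None).
  have hl : (fib_poly (peval f None))`_rdeg = 0.
    have := wedge_hlift0 None (peval f None); rewrite eqxx wedge_fib.
    rewrite mulf_eq0 hpoly_inf expr1n mulr1 => /orP[|/eqP //].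
    by case: (peval _ _) => [?|]; rewrite ?oppr_eq0 oner_eq0.
  have gl : size (cofib_poly (peval f None)) = rdeg.+1.
    rewrite /cofib_poly /=; have [d|d] := eqVneq rden`_rdeg 0; rewrite ?d ?eqxx ?(negbTE d) //.
      have := hlift_neq0 None; rewrite xpair_eqE !hpoly_inf !expr1n !mulr1 d eqxx andbT.
      move=> n; apply/eqP; rewrite eqn_leq rdeg_num /=.
      by apply: contraNT n; rewrite -leqNgt => n; rewrite nth_default.
    apply/eqP; rewrite eqn_leq rdeg_den /=.
    by apply: contraNT d; rewrite -leqNgt => n; rewrite nth_default.
  have := h0; rewrite -size_poly_gt0 => /prednK/esym hs'.
  have lt : ((size (fib_poly (peval f None))).-1 < rdeg)%N.
    rewrite ltn_neqAle -ltnS prednK ?hs // ?size_poly_gt0 // andbT.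
    apply: contra_neqN h0 => /eqP e'; apply/eqP.
    by rewrite -lead_coef_eq0 lead_coefE e' hl.
  rewrite (wronskian_size hs' gl lt) ldegE /mult_at {2}hs' subSS.
  by rewrite mul2n -addnn subnBA ?(ltnW lt) // addnAC addnK addnC.
have [W0 _] := Wfin 0.
have m0 := @ldeg_gt0 None d0; have mD := @ldeg_le None d0.
have sW : (size W <= (2 * rdeg - 2).+1)%N by rewrite Winf; lia.
have [k [rs [_ srs _ cE]]] := form_factor W0 sW.
exists rs; split=> // s; rewrite cE; case: s => [z|]; first by case: (Wfin z).
by rewrite /mult_at Winf; lia.
Qed.

(** A point carries at most [rdeg - 1] of the [2 * rdeg - 2] critical points, so
if two points carry them all then both are totally ramified. *)
Lemma two_critical_points s t : (0 < rdeg)%N ->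
  (forall r, (1 < ldeg r)%N -> r = s \/ r = t) ->
  ldeg s = rdeg /\ (s = t -> rdeg = 1%N).
Proof.
move=> d0 crit; have [rs [srs cE]] := riemann_hurwitz d0.
have ms := ldeg_gt0 s d0; have mt := ldeg_gt0 t d0.
have ls := ldeg_le s d0; have lt := ldeg_le t d0.
have sub : {subset rs <= undup [:: s; t]}.
  move=> r; rewrite mem_undup -has_pred1 has_count cE => r0.
  by have [] := crit r; rewrite ?inE => *; subst; rewrite ?eqxx ?orbT //; lia.
have := sum_count_uniq rs (undup_uniq [:: s; t]).
have := introT allP sub; rewrite all_count => /eqP ->.
rewrite srs (eq_bigr (fun r => (ldeg r).-1)) //=.
rewrite inE; have [<-|st] := eqVneq s t; rewrite !big_cons big_nil; first lia.
by move=> e; split=> [|ts]; [lia | rewrite ts eqxx in st].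
Qed.

(** The unique preimage of a point has full local degree, so in degree at least
two every point would be critical. *)
Lemma injective_degree1 : injective (peval f) -> (0 < rdeg)%N -> rdeg = 1%N.
Proof.
move=> finj d0; have [rs [srs cE]] := riemann_hurwitz d0.
have full s : ldeg s = rdeg.
  have [k [rs' [_ srs' _ mE <- //]]] := fibre_factor (peval f s) d0.
  rewrite -srs'; apply/eqP; rewrite -all_count; apply/allP => r.
  by rewrite mE => /eqP/finj ->; rewrite /= eqxx.
apply/eqP; rewrite eqn_leq d0 andbT leqNgt; apply/negP => d1.
pose pts := [seq Some (n%:R : C) | n <- iota 0 (size rs).+1].
have upts : uniq pts.
  rewrite map_inj_uniq ?iota_uniq // => m n [] /eqP.
  by rewrite eqr_nat => /eqP.
have /(uniq_leq_size upts) : {subset pts <= rs}.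
  by move=> s _; rewrite -has_pred1 has_count cE full; lia.
by rewrite size_map size_iota ltnn.
Qed.

Lemma degree0_const s t : rdeg = 0%N -> peval f s = peval f t.
Proof.
move=> d0; rewrite -!pt_hlift /hlift /hpoly d0 !big_ord1.
by rewrite !expr0 !mulr1.
Qed.

(** In degree one [hlift] is linear, and its determinant is not zero since a fibre
has only one point. *)
Lemma degree1_wedge : rdeg = 1%N ->
  exists2 k : C, k != 0 & forall S T, wedge (hlift S) (hlift T) = k * wedge S T.
Proof.
move=> d1.
have hE h S : hpoly rdeg h S = h`_0 * S.2 + h`_1 * S.1.
  rewrite /hpoly d1 !big_ord_recl big_ord0 /= !expr0 !expr1; ring.
exists (rnum`_1 * rden`_0 - rnum`_0 * rden`_1); last first.
  by move=> S T; rewrite /wedge /hlift /= !hE; ring.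
apply/eqP => k0.
have [m m0 e1] := hlift_vec None; have [m' m'0 e2] := hlift_vec (Some 0).
have : wedge (hlift (vec None)) (hlift (vec (Some 0))) = 0.
  rewrite /wedge /hlift /= !hE /=; apply: etrans k0; ring.
rewrite e1 e2 wedgeZl wedgeZr => /eqP; rewrite !mulf_eq0 (negbTE m0) (negbTE m'0) /=.
rewrite -/(br _ _) br_eq0 => /eqP f0i.
have := @ldeg_add None (Some 0); rewrite d1 => /(_ isT isT f0i).
have := @ldeg_gt0 None; have := @ldeg_gt0 (Some 0); rewrite d1; lia.
Qed.

End RationalMap.
End Sphere.

(** * Convergence on the sphere and cross-ratios *)
Section Limits.
Variables (K : numClosedFieldType) (T : Type) (F : set_system T).
Context {FF : ProperFilter F}.
Implicit Types (u v : T -> K) (a b : K).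

Definition tends u a := (u @ F --> a)%classic.

Lemma tendsM u v a b : tends u a -> tends v b -> tends (fun x => u x * v x) (a * b).
Proof. exact: cvgM. Qed.

Lemma tendsD u v a b : tends u a -> tends v b -> tends (fun x => u x + v x) (a + b).
Proof. exact: cvgD. Qed.

Lemma tendsB u v a b : tends u a -> tends v b -> tends (fun x => u x - v x) (a - b).
Proof. exact: cvgB. Qed.

Lemma tendsV u a : a != 0 -> tends u a -> tends (fun x => (u x)^-1) a^-1.
Proof. exact: cvgV. Qed.

Lemma tends_div u v a b : b != 0 -> tends u a -> tends v b ->
  tends (fun x => u x / v x) (a / b).
Proof. by move=> b0 ua vb; apply: tendsM => //; apply: tendsV. Qed.

Lemma tends_cst a : tends (fun=> a) a. Proof. exact: cvg_cst. Qed.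

Lemma tendsX u a n : tends u a -> tends (fun x => u x ^+ n) (a ^+ n).
Proof.
move=> ua; elim: n => [|n IH]; first by rewrite expr0; apply: tends_cst.
rewrite exprS (_ : (fun x => _) = fun x => u x * u x ^+ n); first exact: tendsM.
by apply: funext => x; rewrite exprS.
Qed.

Lemma tends_prod (I : Type) (r : seq I) (P : pred I) (u : I -> T -> K) (a : I -> K) :
  (forall i, P i -> tends (u i) (a i)) ->
  tends (fun x => \prod_(i <- r | P i) u i x) (\prod_(i <- r | P i) a i).
Proof.
move=> ua; elim: r => [|i r IH].
  rewrite big_nil (_ : (fun x => _) = fun=> 1); first exact: tends_cst.
  by apply: funext => x; rewrite big_nil.
rewrite big_cons (_ : (fun x => _) = fun x => if P i then u i x *
   \prod_(i <- r | P i) u i x else \prod_(i <- r | P i) u i x); last first.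
  by apply: funext => x; rewrite big_cons.
by case: ifP => // Pi; apply: tendsM => //; apply: ua.
Qed.

Lemma tends_near u v a : (\forall x \near F, u x = v x)%classic -> tends u a -> tends v a.
Proof. by move=> uv; apply: cvg_trans; apply: near_eq_cvg; near do rewrite (near uv _) //.
Unshelve. all: by end_near. Qed.

Lemma tends_unique u a b : tends u a -> tends u b -> a = b.
Proof. by move=> ua ub; apply: (cvg_unique _ ua ub); apply: norm_hausdorff. Qed.

Lemma tends_neq0 u a : a != 0 -> tends u a -> (\forall x \near F, u x != 0)%classic.
Proof. by move=> a0 ua; apply: cvgr_neq0 ua a0. Qed.

Implicit Types (L : T -> K * K) (l : K * K).

Definition vtends L l := tends (fun x => (L x).1) l.1 /\ tends (fun x => (L x).2) l.2.

Lemma vtends_wedge L (M : T -> K * K) l (m : K * K) : vtends L l -> vtends M m ->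
  tends (fun x => wedge (L x) (M x)) (wedge l m).
Proof.
by move=> [l1 l2] [m1 m2]; apply: tendsB; apply: tendsM.
Qed.

(** Convergence of [s] to [p] after the changes of coordinates [A], expressed on
homogeneous coordinates: the scalars [m] choose representatives that converge. *)
Definition conv (A : T -> K * K -> K * K) (s : T -> option K) (p : option K) :=
  exists2 m : T -> K, forall x, m x != 0 &
    vtends (fun x => vscale (m x) (A x (vec (s x)))) (vec p).

(** Changes of coordinates act on determinants by a factor, so cross-ratios are
the same before and after them. *)
Definition chart (A : T -> K * K -> K * K) :=
  exists2 k : T -> K, forall x, k x != 0 &
    forall x S S', wedge (A x S) (A x S') = k x * wedge S S'.

Section Chart.
Variable A : T -> K * K -> K * K.
Hypothesis chA : chart A.

Definition cr (s t a b : option K) : K := br s a * br t b / (br s b * br t a).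

(** Cross-ratios may be computed in the limit, as long as the two factors of the
denominator do not degenerate. *)
Lemma cr_tends (s t a b : T -> option K) (S T' A' B : option K) :
  conv A s S -> conv A t T' -> conv A a A' -> conv A b B -> S != B -> T' != A' ->
  tends (fun x => cr (s x) (t x) (a x) (b x)) (cr S T' A' B).
Proof.
case: chA => k k0 kE [ms s0 cs] [mt t0 ct] [ma a0 ca] [mb b0 cb] SB TA.
pose W (m m' : T -> K) (s t : T -> option K) x :=
  wedge (vscale (m x) (A x (vec (s x)))) (vscale (m' x) (A x (vec (t x)))) : K.
have WE (m m' : T -> K) s' t' x : W m m' s' t' x = m x * m' x * k x * br (s' x) (t' x).
  by rewrite /W wedgeZl wedgeZr kE !mulrA.
rewrite (_ : (fun x => _) =
  fun x => W ms ma s a x * W mt mb t b x / (W ms mb s b x * W mt ma t a x)).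
  apply: tends_div; first by rewrite mulf_neq0 // br_neq0.
    by apply: tendsM; apply: vtends_wedge.
  by apply: tendsM; apply: vtends_wedge.
apply: funext => x; rewrite !WE /cr.
have [-> |e1] := eqVneq (br (s x) (b x)) 0; first by rewrite !(mulr0, mul0r) invr0 !mulr0.
have [-> |e2] := eqVneq (br (t x) (a x)) 0; first by rewrite !(mulr0, mul0r) invr0 !mulr0.
have := (s0 x, t0 x, a0 x, b0 x, k0 x); move=> [[[[h1 h2] h3] h4] h5].
by field; rewrite h1 h2 h3 h4 h5 e1 e2.
Qed.

Lemma conv_neq (s t : T -> option K) (S T' : option K) : conv A s S -> conv A t T' -> S != T' ->
  (\forall x \near F, s x != t x)%classic.
Proof.
case: chA => k k0 kE [ms s0 cs] [mt t0 ct] ST.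
have := tends_neq0 (br_neq0 ST) (vtends_wedge cs ct).
apply: filterS => x; apply: contraNN => /eqP ->.
by rewrite wedgeZl wedgeZr kE -/(br _ _) brxx !mulr0.
Qed.

(** A point away from [p], which plays the role of infinity for coordinates at
[p]. *)
Definition opp_pt (p : option K) : option K := if p is Some _ then None else Some 0.

(** With [u] the coordinate [loc p] below, this is [1 / u s - 1 / u q].  It scales
like a cotangent vector at [p], which is how derivatives will be read. *)
Definition omega (p s q : option K) : K :=
  br (opp_pt p) p * br s q / (br s p * br p q).

(** For [s], [q] at the scale of the outer circle of a round annulus and [t], [r] at
the scale of the inner one, this is of the order of the ratio of the radii. *)
Definition rho (s q t r : option K) : K := cr t s r q.

Lemma rho_sym s q t r : rho s q t r = rho t r s q.
Proof. by rewrite /rho /cr [br s q * _]mulrC [br t q]brC [br s r]brC [br t r]brC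
  [br s q]brC [br q t]brC [br r s]brC [br r t]brC [br q s]brC mulrNN; congr (_ / _); ring. Qed.

Lemma rho_tends0 (s q t r : T -> option K) S Q p :
  conv A s S -> conv A q Q -> conv A t p -> conv A r p -> S != p -> Q != p ->
  tends (fun x => rho (s x) (q x) (t x) (r x)) 0.
Proof.
move=> cs cq ct cr' Sp Qp; have := cr_tends ct cs cr' cq.
by rewrite /cr brxx !mul0r; apply => //; rewrite eq_sym.
Qed.

Lemma omega_neq0 p s q : s != p -> q != p -> s != q -> omega p s q != 0.
Proof.
move=> sp qp sq; rewrite mulf_neq0 ?invr_eq0 ?mulf_neq0 ?br_neq0 // 1?eq_sym //.
by case: (p).
Qed.

Lemma rho_neq0 s q t r : t != r -> s != q -> t != q -> s != r -> rho s q t r != 0.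
Proof. by move=> tr sq tq sr; rewrite !(mulf_neq0, invr_neq0) // br_neq0. Qed.

(** Seen from [p], the points [t] and [r] merge at [p]; the cross-ratio then
depends on [s] and [q] through [omega p s q] only, up to a common factor. *)
Lemma rho_ratio (s1 q1 s0 q0 t r : T -> option K) S1 Q1 S0 Q0 p :
  conv A s1 S1 -> conv A q1 Q1 -> conv A s0 S0 -> conv A q0 Q0 ->
  conv A t p -> conv A r p ->
  S1 != p -> Q1 != p -> S0 != p -> Q0 != p -> S0 != Q0 ->
  (forall x, t x != r x) ->
  tends (fun x => rho (s1 x) (q1 x) (t x) (r x) / rho (s0 x) (q0 x) (t x) (r x))
        (omega p S1 Q1 / omega p S0 Q0).
Proof.
case: chA => k k0 kE [ms1 ns1 cs1] [mq1 nq1 cq1] [ms0 ns0 cs0] [mq0 nq0 cq0].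
move=> [mt nt ct] [mr nr cr'] S1p Q1p S0p Q0p SQ0 tr.
pose W (m m' : T -> K) (s t : T -> option K) x :=
  wedge (vscale (m x) (A x (vec (s x)))) (vscale (m' x) (A x (vec (t x)))) : K.
have WE (m m' : T -> K) s' t' x : W m m' s' t' x = m x * m' x * k x * br (s' x) (t' x).
  by rewrite /W wedgeZl wedgeZr kE !mulrA.
have opn : br (opp_pt p) p != 0 by apply: br_neq0; case: (p).
have -> : omega p S1 Q1 / omega p S0 Q0 =
    br S1 Q1 * br p Q0 * br S0 p / (br p Q1 * br S1 p * br S0 Q0).
  rewrite /omega; have := (br_neq0 S1p, br_neq0 S0p, br_neq0 SQ0).
  have := br_neq0 Q1p; have := br_neq0 Q0p; rewrite [br Q0 p]brC [br Q1 p]brC !oppr_eq0.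
  by move=> h1 h2 [[h3 h4] h5]; field; rewrite h1 h2 h3 h4 h5 opn.
rewrite (_ : (fun x => _) = fun x =>
  W ms1 mq1 s1 q1 x * W mt mq0 t q0 x * W ms0 mr s0 r x /
  (W mt mq1 t q1 x * W ms1 mr s1 r x * W ms0 mq0 s0 q0 x)).
  apply: tends_div; first by rewrite !mulf_neq0 ?br_neq0 // eq_sym.
    by apply: tendsM; [apply: tendsM|]; apply: vtends_wedge.
  by apply: tendsM; [apply: tendsM|]; apply: vtends_wedge.
apply: funext => x; rewrite !WE /rho /cr.
have := (ns1 x, nq1 x, ns0 x, nq0 x, nt x, nr x, k0 x, br_neq0 (tr x)).
move=> [[[[[[[h1 h2] h3] h4] h5] h6] h7] h8].
rewrite !invfM !invrK.
have [-> |e1] := eqVneq (br (t x) (q1 x)) 0; first by rewrite !(mulr0, mul0r, invr0).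
have [-> |e2] := eqVneq (br (s1 x) (r x)) 0; first by rewrite !(mulr0, mul0r, invr0).
have [-> |e3] := eqVneq (br (s0 x) (q0 x)) 0; first by rewrite !(mulr0, mul0r, invr0).
by field; rewrite h1 h2 h3 h4 h5 h6 h7 h8 e1 e2 e3.
Qed.

Lemma rho_ratio1 (s1 s0 q t r : T -> option K) S1 S0 Q p :
  conv A s1 S1 -> conv A s0 S0 -> conv A q Q -> conv A r p ->
  S1 != p -> S0 != p -> Q != p -> S0 != Q ->
  (\forall x \near F, t x != r x)%classic -> (\forall x \near F, t x != q x)%classic ->
  tends (fun x => rho (s1 x) (q x) (t x) (r x) / rho (s0 x) (q x) (t x) (r x))
        (omega p S1 Q / omega p S0 Q).
Proof.
move=> cs1 cs0 cq cr' S1p S0p Qp SQ tr tq.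
have opn : br (opp_pt p) p != 0 by apply: br_neq0; case: (p).
have -> : omega p S1 Q / omega p S0 Q = cr S1 S0 Q p.
  rewrite /omega /cr; have := (br_neq0 S1p, br_neq0 S0p, br_neq0 SQ).
  have := br_neq0 Qp; rewrite [br Q p]brC !oppr_eq0.
  by move=> h1 [[h3 h4] h5]; field; rewrite h1 h3 h4 h5 opn.
apply: tends_near (cr_tends cs1 cs0 cq cr' S1p SQ); near=> x.
have h1 : br (t x) (r x) != 0 by apply: br_neq0; near: x.
have h2 : br (t x) (q x) != 0 by apply: br_neq0; near: x.
rewrite /rho /cr !invfM !invrK.
have [-> |e2] := eqVneq (br (s1 x) (r x)) 0; first by rewrite !(mulr0, mul0r, invr0).
have [-> |e3] := eqVneq (br (s0 x) (q x)) 0; first by rewrite !(mulr0, mul0r, invr0).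
by field; rewrite h1 h2 e2 e3.
Unshelve. all: by end_near.
Qed.

End Chart.

Lemma tends_sum (I : Type) (r : seq I) (u : I -> T -> K) (a : I -> K) :
  (forall i, tends (u i) (a i)) ->
  tends (fun x => \sum_(i <- r) u i x) (\sum_(i <- r) a i).
Proof.
move=> ua; elim: r => [|i r IH].
  rewrite big_nil (_ : (fun x => _) = fun=> 0); first exact: tends_cst.
  by apply: funext => x; rewrite big_nil.
rewrite big_cons (_ : (fun x => _) = fun x => u i x + \sum_(i <- r) u i x).
  by apply: tendsD.
by apply: funext => x; rewrite big_cons.
Qed.

Lemma vtends_hlift f L l : vtends L l -> vtends (fun x => hlift f (L x)) (hlift f l).
Proof.
move=> [L1 L2]; split; rewrite /hlift /hpoly /=; apply: tends_sum => i;
  apply: tendsM; try exact: tendsX.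
  by apply: tendsM; [apply: tends_cst | apply: tendsX].
by apply: tendsM; [apply: tends_cst | apply: tendsX].
Qed.

Lemma chart_id : chart (fun _ S => S).
Proof. by exists (fun=> 1) => [x|x S S']; rewrite ?oner_eq0 // mul1r. Qed.

Lemma conv_cst (b : option K) : conv (fun _ S => S) (fun=> b) b.
Proof.
exists (fun=> 1) => [x|]; first by rewrite oner_eq0.
by split; rewrite /= !mul1r; apply: tends_cst.
Qed.

Lemma conv_pt L (c : K) p : c != 0 -> (forall x, L x != (0, 0)) ->
  vtends L (vscale c (vec p)) -> conv (fun _ S => S) (fun x => pt (L x)) p.
Proof.
move=> c0 L0 [L1 L2].
have /choice[m mE] x : exists m : K, m != 0 /\ L x = vscale m (vec (pt (L x))).
  by have [m m0 e] := vec_pt (L0 x); exists m.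
exists (fun x => c^-1 * m x) => [x|].
  by rewrite mulf_neq0 ?invr_eq0 //; case: (mE x).
have sc x : vscale (c^-1 * m x) (vec (pt (L x))) = vscale c^-1 (L x).
  by have [_ e] := mE x; rewrite {2}e /vscale /= !mulrA.
have cv : vec p = vscale c^-1 (vscale c (vec p)).
  by rewrite /vscale /= !mulKf //; case: (vec p).
rewrite /vtends cv; split.
  rewrite (_ : (fun x => _) = fun x => c^-1 * (L x).1); last first.
    by apply: funext => x; rewrite sc.
  by apply: tendsM => //; apply: tends_cst.
rewrite (_ : (fun x => _) = fun x => c^-1 * (L x).2); last first.
  by apply: funext => x; rewrite sc.
by apply: tendsM => //; apply: tends_cst.
Qed.

End Limits.

Section LocalCoordinate.
Variable K : numClosedFieldType.
Implicit Types (p q s : option K) (e : K).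

Local Notation F0 := ((0 : K)^'%classic).

(** [ins p] and [loc p] are inverse to each other: the coordinate at [p] is [z - p]
at a finite point and [1 / z] at infinity; [pvec] is a polynomial lift of
[ins p]. *)
Definition pvec p e : K * K := if p is Some z then (z + e, 1) else (1, e).
Definition ins p e : option K := pt (pvec p e).

Definition loc q s : K :=
  if q is Some z then odflt 0 s - z else if s is Some w then w^-1 else 0.

Lemma locE q s : s != opp_pt q -> loc q s = - br s q / br s (opp_pt q).
Proof.
case: q s => [z|] [w|] //= h; rewrite /br /wedge /=.
- by field.
- have w0 : w != 0 by apply: contraNneq h => ->.
  by field.
- by rewrite mulr0 mul0r subrr oppr0 mul0r.
Qed.

Lemma ins_loc q s : s != opp_pt q -> ins q (loc q s) = s.
Proof.
case: q s => [z|] [w|] //= h; rewrite /ins /pvec /pt /=.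
- by rewrite oner_eq0 addrC subrK divr1.
- have w0 : w != 0 by apply: contraNneq h => ->.
  by rewrite invr_eq0 (negbTE w0) invrK mul1r.
- by rewrite eqxx.
Qed.

Lemma pvec_neq0 p e : pvec p e != (0, 0).
Proof. by case: p => [z|]; rewrite xpair_eqE /= oner_eq0 ?andbF. Qed.

Lemma tends_id : tends F0 (fun e => e) 0.
Proof. exact/cvg_within. Qed.

Lemma vtends_pvec p : vtends F0 (pvec p) (vec p).
Proof.
case: p => [z|]; split => /=; try exact: tends_cst; last exact: tends_id.
by rewrite -[X in tends _ _ X]addr0; apply: tendsD; [apply: tends_cst | apply: tends_id].
Qed.

Lemma conv_ins p : conv F0 (fun _ S => S) (ins p) p.
Proof.
apply: (@conv_pt _ _ _ _ (pvec p) 1); first by rewrite oner_eq0.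
  exact: pvec_neq0.
by rewrite (_ : vscale 1 _ = vec p); [exact: vtends_pvec|rewrite /vscale !mul1r; case: vec].
Qed.

Definition sgp p : K := if p is Some _ then 1 else -1.

Lemma wedge_pvec p e : wedge (pvec p e) (vec p) = sgp p * e.
Proof. case: p => [z|]; rewrite /wedge /=; ring. Qed.

Lemma sgp_neq0 p : sgp p != 0.
Proof. by case: p => [z|]; rewrite /= ?oppr_eq0 oner_eq0. Qed.

Lemma br_opp p : br (opp_pt p) p = sgp p.
Proof. case: p => [z|]; rewrite /br /wedge /=; ring. Qed.

Lemma near_dnbhs0 : (\forall e \near F0, e != 0)%classic.
Proof. exact: nbhs_dnbhs_neq. Qed.

(** Near [p] the function [omega p] has a simple pole in the coordinate. *)
Lemma omega_ins p a : a != p -> tends F0 (fun e => e * omega p (ins p e) a) 1.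
Proof.
move=> ap; have pa : br p a != 0 by rewrite br_neq0 // eq_sym.
have l : tends F0 (fun e => wedge (pvec p e) (vec a) / br p a) 1.
  rewrite -(divff pa); apply: tends_div => //; last exact: tends_cst.
  by apply: vtends_wedge; [exact: vtends_pvec | split; apply: tends_cst].
apply: tends_near l; near=> e.
have e0 : e != 0 by near: e; exact: near_dnbhs0.
have [m m0 E] := vec_pt (pvec_neq0 p e).
have h : m * br (ins p e) p = sgp p * e by rewrite -wedge_pvec E wedgeZl.
have hn : br (ins p e) p != 0.
  apply: contraNneq e0 => h0; move: h; rewrite h0 mulr0 => /esym/eqP.
  by rewrite mulf_eq0 (negbTE (sgp_neq0 p)).
have -> : wedge (pvec p e) (vec a) = m * br (ins p e) a by rewrite E wedgeZl.
rewrite /omega br_opp.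
have -> : m = sgp p * e / br (ins p e) p by rewrite -h mulfK.
by field; rewrite pa hn.
Unshelve. all: by end_near.
Qed.

Lemma loc_omega (T : Type) (F : set_system T) {FF : ProperFilter F} q a
    (s : T -> option K) : conv F (fun _ S => S) s q -> a != q ->
  (\forall x \near F, s x != q)%classic ->
  tends F (fun x => loc q (s x) * omega q (s x) a) 1.
Proof.
move=> cs aq sq.
have qo : q != opp_pt q by case: (q).
have qa : br q a != 0 by rewrite br_neq0 // eq_sym.
have : tends F (fun x => cr (s x) q a (opp_pt q)) (cr q q a (opp_pt q)).
  apply: (cr_tends (chart_id _ _) cs (conv_cst q) (conv_cst a) (conv_cst _)) => //.
  by rewrite eq_sym.
have qo' := br_neq0 qo.
have -> : cr q q a (opp_pt q) = 1 by rewrite /cr [X in X / _]mulrC divff ?mulf_neq0.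
apply: tends_near; near=> x.
have h1 : s x != opp_pt q.
  near: x; exact: (conv_neq (chart_id _ _) cs (conv_cst _) qo).
have h2 : br (s x) q != 0 by apply: br_neq0; near: x.
rewrite locE // /omega /cr [br (opp_pt q) q]brC.
by field; rewrite h2 qa br_neq0.
Unshelve. all: by end_near.
Qed.

Lemma prod_extract (rs : seq (option K)) p e (u : option K -> K) : e != 0 ->
  (\prod_(r <- rs) u r) / e ^+ count_mem p rs =
  \prod_(r <- rs) (if r == p then u r / e else u r).
Proof.
move=> e0; elim: rs => [|r rs IH]; first by rewrite !big_nil divr1.
rewrite !big_cons -IH /=; case: (r == p); rewrite /= ?add0n ?mulrA //.
by rewrite add1n exprS; field; rewrite e0 expf_neq0.
Qed.

Lemma tends_factors (rs : seq (option K)) p :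
  tends F0 (fun e => (\prod_(r <- rs) wedge (pvec p e) (vec r)) / e ^+ count_mem p rs)
    (\prod_(r <- rs) (if r == p then sgp p else br p r)).
Proof.
have lim : tends F0 (fun e => \prod_(r <- rs) (if r == p
     then wedge (pvec p e) (vec r) / e else wedge (pvec p e) (vec r)))
    (\prod_(r <- rs) (if r == p then sgp p else br p r)).
  apply: tends_prod => r _ /=; have [->|rp] := eqVneq r p; rewrite /=.
    apply: (@tends_near _ _ _ _ (fun=> sgp p)); last exact: tends_cst.
    near=> e; have e0 : e != 0 by near: e; exact: near_dnbhs0.
    by rewrite wedge_pvec mulfK.
  by apply: vtends_wedge; [exact: vtends_pvec | split; apply: tends_cst].
apply: tends_near lim; near=> e.
have e0 : e != 0 by near: e; exact: near_dnbhs0.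
by rewrite prod_extract.
Unshelve. all: by end_near.
Qed.

Section Rational.
Variable f : {poly K} * {poly K}.
Hypothesis cop : coprimep f.1 f.2.
Hypothesis d0 : (0 < pdegree f)%N.

Lemma hlift_pvec p e : exists2 m : K, m != 0 &
  hlift f (pvec p e) = vscale m (vec (peval f (ins p e))).
Proof.
have [m m0 E] := vec_pt (pvec_neq0 p e).
have [m' m'0 E'] := hlift_vec cop (ins p e).
exists (m ^+ pdegree f * m'); first by rewrite mulf_neq0 ?expf_neq0.
by rewrite E /hlift !hpoly_scale -/(ins p e) -![hpoly _ _ _]/((hlift f _).1)
  -![hpoly _ f.2 _]/((hlift f _).2) E' /vscale /= !mulrA.
Qed.

Lemma peval_ins p e : peval f (ins p e) = pt (hlift f (pvec p e)).
Proof. by have [m m0 ->] := hlift_pvec p e; rewrite pt_scale. Qed.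

Lemma conv_peval p : conv F0 (fun _ S => S) (fun e => peval f (ins p e)) (peval f p).
Proof.
have [m m0 E] := hlift_vec cop p.
have -> : (fun e => peval f (ins p e)) = (fun e => pt (hlift f (pvec p e))).
  by apply: funext => e; rewrite peval_ins.
apply: (@conv_pt _ _ _ _ _ m) => // [e|].
  have [m' m'0 ->] := hlift_pvec p e; apply: contraNneq (vec_neq0 (peval f (ins p e))).
  case: vec => x y [] /eqP; rewrite mulf_eq0 (negbTE m'0) /= => /eqP -> /eqP.
  by rewrite mulf_eq0 (negbTE m'0) /= => /eqP ->.
by rewrite -E; apply: vtends_hlift; apply: vtends_pvec.
Qed.

(** Near [p] the form that cuts out the fibre through [p] vanishes to the order
[pldeg f p], and its other linear factors do not vanish at [p]. *)
Lemma local_expansion p : exists2 c : K, c != 0 &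
  tends F0 (fun e => loc (peval f p) (peval f (ins p e)) / e ^+ pldeg f p) c.
Proof.
set q := peval f p.
have [k [rs [k0 srs wE mE cE]]] := fibre_factor cop q d0.
have [m m0 E] := hlift_vec cop p.
have qo : q != opp_pt q by case: (q).
exists (- (k * \prod_(r <- rs) (if r == p then sgp p else br p r)) /
   wedge (hlift f (vec p)) (vec (opp_pt q))).
  rewrite mulf_neq0 ?invr_eq0 ?oppr_eq0 ?mulf_neq0 //.
    rewrite prodf_seq_neq0; apply/allP => r _ /=; case: ifPn => [_|rp].
      exact: sgp_neq0.
    by rewrite br_neq0 // eq_sym.
  by rewrite E wedgeZl mulf_neq0 // br_neq0.
have lim : tends F0 (fun e => - (k * ((\prod_(r <- rs) wedge (pvec p e) (vec r))
     / e ^+ count_mem p rs)) / wedge (hlift f (pvec p e)) (vec (opp_pt q)))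
  (- (k * \prod_(r <- rs) (if r == p then sgp p else br p r)) /
   wedge (hlift f (vec p)) (vec (opp_pt q))).
  apply: tends_div; first by rewrite E wedgeZl mulf_neq0 // br_neq0.
    by apply: cvgN; apply: tendsM; [exact: tends_cst | exact: tends_factors].
  apply: vtends_wedge; last by split; apply: tends_cst.
  by apply: vtends_hlift; exact: vtends_pvec.
apply: tends_near lim; near=> e.
have e0 : e != 0 by near: e; exact: near_dnbhs0.
have h1 : peval f (ins p e) != opp_pt q.
  near: e; exact: (conv_neq (chart_id _ _) (conv_peval p) (conv_cst _) qo).
rewrite cE // locE //.
have [m' m'0 E'] := hlift_pvec p e.
rewrite mulrA -wE E' !wedgeZl -!/(br _ _).
have := expf_neq0 (pldeg f p) e0; have := br_neq0 h1.
move: (e ^+ _) (br _ q) (br _ (opp_pt q)) => x y z z0 x0.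
by field; rewrite m'0 x0 z0.
Unshelve. all: by end_near.
Qed.

End Rational.
End LocalCoordinate.

(** * Germs, leading coefficients and ramification *)
Section Exponents.
Variable K : numClosedFieldType.
Implicit Types (p q r s : option K) (e : K).
Local Notation F0 := ((0 : K)^'%classic).

Lemma tends_monomial (i j : nat) (c : K) : c != 0 ->
  tends F0 (fun e => e ^+ i / e ^+ j) c -> i = j /\ c = 1.
Proof.
have pow0 k : tends F0 (fun e : K => e ^+ k.+1) 0.
  rewrite -[X in tends _ _ X](expr0n K k.+1); apply: tendsX; exact: tends_id.
move=> c0 lim; have [ij|ij|ij] := ltngtP i j.
- have : tends F0 (fun e => (e ^+ i / e ^+ j) * e ^+ (j - i)) (c * 0).
    apply: tendsM => //; have -> : (j - i)%N = (j - i).-1.+1 by lia.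
    exact: pow0.
  rewrite mulr0 => lim0.
  have lim1 : tends F0 (fun e => (e ^+ i / e ^+ j) * e ^+ (j - i)) 1.
    apply: (@tends_near _ _ _ _ (fun=> 1)); last exact: tends_cst.
    near=> e; have e0 : e != 0 by near: e; exact: near_dnbhs0.
    rewrite -mulrA [_^-1 * _]mulrC mulrA -exprD subnKC ?(ltnW ij) // divff //.
    by rewrite expf_neq0.
  have /eqP : (1 : K) = 0 by apply: tends_unique lim1 lim0.
  by rewrite oner_eq0.
- have lim0 : tends F0 (fun e => e ^+ i / e ^+ j) 0.
    apply: (@tends_near _ _ _ _ (fun e => e ^+ (i - j).-1.+1)); last exact: pow0.
    near=> e; have e0 : e != 0 by near: e; exact: near_dnbhs0.
    have -> : (i - j).-1.+1 = (i - j)%N by lia.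
    by rewrite -{2}(subnK (ltnW ij)) exprD mulfK // expf_neq0.
  have c00 : c = 0 by apply: tends_unique lim lim0.
  by rewrite c00 eqxx in c0.
split=> //; rewrite -ij in lim.
apply: (tends_unique lim).
apply: (@tends_near _ _ _ _ (fun=> 1)); last exact: tends_cst.
near=> e; have e0 : e != 0 by near: e; exact: near_dnbhs0.
by rewrite divff // expf_neq0.
Unshelve. all: by end_near.
Qed.

(** Both sides of the identity are monomials in the coordinate at [p], up to
factors that tend to one: comparing the exponents gives the local degree, and
comparing the constants gives the leading coefficient. *)
Lemma leading_coefficient (f : {poly K} * {poly K}) p a b (A B : nat) (g : K)
    (kf : K -> K) :
  coprimep f.1 f.2 -> (0 < pdegree f)%N -> a != p -> b != peval f p ->
  g != 0 -> tends F0 kf 1 ->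
  (\forall e \near F0, omega p (ins p e) a ^+ A / (omega p (ins p e) a ^+ B *
     omega (peval f p) (peval f (ins p e)) b * kf e) = g)%classic ->
  A = (B + pldeg f p)%N /\
  tends F0 (fun e => loc (peval f p) (peval f (ins p e)) / e ^+ pldeg f p) g.
Proof.
move=> cop d0 ap bq g0 limk eqn.
have [c c0 limc] := local_expansion cop d0 p.
set q := peval f p; set m := pldeg f p.
have locn : (\forall e \near F0, loc q (peval f (ins p e)) != 0)%classic.
  apply: filterS (tends_neq0 c0 limc) => e; apply: contraNN => /eqP ->.
  by rewrite mul0r.
have insq : (\forall e \near F0, peval f (ins p e) != q)%classic.
  apply: filterS locn => e; apply: contraNN => /eqP ->.
  have qo : q != opp_pt q by case: (q).
  by rewrite locE // brxx oppr0 mul0r.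
have lim1 := omega_ins ap.
have lim2 : tends F0 (fun e => loc q (peval f (ins p e)) *
    omega q (peval f (ins p e)) b) 1.
  exact: (loc_omega (conv_peval cop p) bq insq).
have lim : tends F0 (fun e => (e * omega p (ins p e) a) ^+ A /
    (g * (e * omega p (ins p e) a) ^+ B * (loc q (peval f (ins p e)) *
    omega q (peval f (ins p e)) b) * kf e) * (loc q (peval f (ins p e)) / e ^+ m))
    (1 ^+ A / (g * 1 ^+ B * 1 * 1) * c).
  apply: tendsM => //; apply: tends_div.
  - by rewrite expr1n !mulr1.
  - exact: tendsX.
  - do 2![apply: tendsM => //]; apply: tendsM; [exact: tends_cst|exact: tendsX].
rewrite !expr1n !mulr1 mul1r in lim.
have {}lim : tends F0 (fun e => e ^+ A / e ^+ (B + m)) (g^-1 * c).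
  apply: tends_near lim; near=> e.
  have e0 : e != 0 by near: e; exact: near_dnbhs0.
  have l0 : loc q (peval f (ins p e)) != 0 by near: e.
  have k0 : kf e != 0 by near: e; exact: (tends_neq0 (oner_neq0 K) limk).
  have o1 : e * omega p (ins p e) a != 0.
    by near: e; exact: (tends_neq0 (oner_neq0 K) lim1).
  have o2 : loc q (peval f (ins p e)) * omega q (peval f (ins p e)) b != 0.
    by near: e; exact: (tends_neq0 (oner_neq0 K) lim2).
  have w1 : omega p (ins p e) a != 0.
    by move: o1; rewrite mulf_eq0 negb_or => /andP[].
  have w2 : omega q (peval f (ins p e)) b != 0.
    by move: o2; rewrite mulf_eq0 negb_or => /andP[].
  have E : omega p (ins p e) a ^+ A =
     g * (omega p (ins p e) a ^+ B * omega q (peval f (ins p e)) b * kf e).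
    have <- : omega p (ins p e) a ^+ A /
        (omega p (ins p e) a ^+ B * omega q (peval f (ins p e)) b * kf e) = g by near: e.
    by rewrite divfK //; exact: (mulf_neq0 (mulf_neq0 (expf_neq0 _ w1) w2) k0).
  rewrite !(exprMn _ e) E exprD.
  have := expf_neq0 B w1; have := expf_neq0 B e0; have := expf_neq0 m e0.
  move: (omega p _ _ ^+ B) (omega q _ _) w2 (loc q _) l0 (kf e) k0 (e ^+ A) (e ^+ B) (e ^+ m).
  move=> x1 x2 h2 x3 h3 x4 h4 x5 x6 x7 h7 h6 h1.
  by field; rewrite g0 h1 h2 h3 h4 h6 h7.
have cg0 : g^-1 * c != 0 by rewrite mulf_neq0 ?invr_eq0.
have [AB e1] := tends_monomial cg0 lim; split=> //.
by have -> : g = c by rewrite -[LHS]mulr1 -e1 mulVKf.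
Unshelve. all: by end_near.
Qed.

(** The map [h] sends [p] to [q] with derivative [c] in the coordinates [loc].  The
first condition keeps [h] away from the point where [loc q] is a default value. *)
Definition germ (h : option K -> option K) p q (c : K) :=
  (\forall e \near F0, h (ins p e) != opp_pt q)%classic /\
  tends F0 (fun e => loc q (h (ins p e)) / e) c.

Lemma germ_id p : germ id p p 1.
Proof.
have po : p != opp_pt p by case: (p).
have n : (\forall e \near F0, ins p e != opp_pt p)%classic.
  exact: (conv_neq (chart_id _ _) (conv_ins p) (conv_cst (opp_pt p)) po).
split=> //; apply: (@tends_near _ _ _ _ (fun=> 1)); last exact: tends_cst.
near=> e; have e0 : e != 0 by near: e; exact: near_dnbhs0.
have -> : loc p (ins p e) = e.
  rewrite /ins /loc /pvec /pt; case: (p) => [z|] /=.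
    by rewrite oner_eq0 /= divr1 addrC addKr.
  by rewrite (negbTE e0) mul1r invrK.
by rewrite divff.
Unshelve. all: by end_near.
Qed.

Lemma germ_comp h1 h2 p q r c1 c2 : c1 != 0 ->
  germ h1 p q c1 -> germ h2 q r c2 -> germ (h2 \o h1) p r (c1 * c2).
Proof.
move=> c10 [n1 l1] [n2 l2].
have l0 : tends F0 (fun e => loc q (h1 (ins p e))) 0.
  have : tends F0 (fun e => loc q (h1 (ins p e)) / e * e) (c1 * 0).
    by apply: tendsM => //; exact: tends_id.
  rewrite mulr0; apply: tends_near; near=> e.
  have e0 : e != 0 by near: e; exact: near_dnbhs0.
  by rewrite divfK.
have l0n : (\forall e \near F0, loc q (h1 (ins p e)) != 0)%classic.
  apply: filterS (tends_neq0 c10 l1) => e; apply: contraNN => /eqP ->.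
  by rewrite mul0r.
have sub : ((fun e => loc q (h1 (ins p e))) @ F0 --> F0)%classic.
  move=> D; rewrite /dnbhs /within /= => D0.
  have := l0 _ D0; apply: filterS2 l0n => e e0 /=; exact.
have back : (\forall e \near F0, ins q (loc q (h1 (ins p e))) = h1 (ins p e))%classic.
  by apply: filterS n1 => e; exact: ins_loc.
split.
  have := sub _ n2; apply: filterS2 back => e /=.
  by rewrite /nbhs /= => ->.
have lim : tends F0 (fun e => loc q (h1 (ins p e)) / e *
    (loc r (h2 (ins q (loc q (h1 (ins p e))))) / loc q (h1 (ins p e)))) (c1 * c2).
  apply: tendsM => //.
  exact: (cvg_comp _ _ sub l2).
apply: tends_near lim; near=> e.
have -> : ins q (loc q (h1 (ins p e))) = h1 (ins p e) by near: e.
have e0 : e != 0 by near: e; exact: near_dnbhs0.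
have l0' : loc q (h1 (ins p e)) != 0 by near: e.
by rewrite /=; field; rewrite e0 l0'.
Unshelve. all: by end_near.
Qed.

End Exponents.

Section Ramification.
Variable K : numClosedFieldType.
Local Notation F0 := ((0 : K)^'%classic).

Lemma tends0_norm_le (T : Type) (F : set_system T) {FF : ProperFilter F}
    (u v : T -> K) : (\forall x \near F, `|u x| <= `|v x|)%classic ->
  tends F v 0 -> tends F u 0.
Proof.
move=> uv /cvgrPdist_lt v0; apply/cvgrPdist_lt => eps /v0.
apply: filterS2 uv => x uv; rewrite !sub0r !normrN; exact: le_lt_trans.
Qed.

Lemma norm_prod_le (c : K) (rs : seq (option K)) (u v : option K -> K) :
  0 <= c -> (forall r, r \in rs -> `|u r| <= c * `|v r|) ->
  `|\prod_(r <- rs) u r| <= c ^+ size rs * `|\prod_(r <- rs) v r|.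
Proof.
move=> c0; elim: rs => [|r rs IH] h; first by rewrite !big_nil expr0 mul1r.
rewrite !big_cons !normrM /= exprS mulrACA ler_pM //.
  by apply: h; rewrite inE eqxx.
by apply: IH => r' rr; apply: h; rewrite inE rr orbT.
Qed.

(** For [t] distinct from [s], a parametrisation of the sphere deprived of [t], which
is at [s] for [e = 0]. *)
Definition line (s t : option K) (e : K) : K * K :=
  ((vec s).1 + e * (vec t).1, (vec s).2 + e * (vec t).2).

Lemma pvec_line s e : pvec s e = line s (opp_pt s) e.
Proof. by case: s => [z|]; rewrite /pvec /line /=; congr (_, _); ring. Qed.

(** Suppose that [s] is critical and let [e] be near [s]; critical points being
finite in number, [e] is not critical.  Hence the preimages of [f e] other than
[e] avoid [D] and stay away from [s], so that on them [br t] is bounded by a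
multiple of [br s]: replacing [s] by [t] in the product that cuts out the fibre
of [f e] costs only a constant and the factor that vanishes at [e].  Thus [f t]
would be as near to [f e] as [(f s - f e) / e], which tends to zero as [s] is
critical; but [f t] and [f s] are distinct. *)
Lemma injective_unramified (f : {poly K} * {poly K}) (D : set (option K)) s :
  coprimep f.1 f.2 -> (0 < pdegree f)%N ->
  (forall t, t != s -> (\forall e \near (0 : K), D (pt (line s t e)))%classic) ->
  (forall r r', D r -> D r' -> peval f r = peval f r' -> r = r') ->
  pldeg f s = 1%N.
Proof.
move=> cop d0 nD injD; apply/eqP; rewrite eqn_leq ldeg_gt0 // andbT leqNgt.
apply/negP => m2.
have [t ft] := ratmap_surj cop (opp_pt (peval f s)) d0.
have fts : peval f t != peval f s by rewrite ft; case: (peval f s).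
have st : t != s by apply: contraNneq fts => ->.
have ts0 : br t s != 0 by exact: br_neq0 st.
have := nD _ st; rewrite /= => /nbhs_ballP[dl dl0 ballD].
have {dl0} dl0 : 0 < dl by exact: dl0.
(* in the parametrisation by [line s t], [r] has parameter [- br s r / br t r] *)
have far r : ~ D r -> `|br t r| <= dl^-1 * `|br s r|.
  move=> nDr; rewrite ler_pdivlMl //.
  have [tr|tr] := eqVneq (br t r) 0; first by rewrite tr normr0 mulr0.
  rewrite -ler_pdivlMr ?normr_gt0 // -normf_div.
  rewrite real_leNgt ?realE ?(ltW dl0) ?normr_ge0 //.
  apply/negP => lt; apply: nDr.
  have := ballD (- (br s r / br t r)).
  rewrite /= /ball /= sub0r opprK => /(_ lt).
  have -> : line s t (- (br s r / br t r)) = vscale (br t s / br t r) (vec r).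
    rewrite /line /vscale /br /wedge in tr *; congr (_, _); field; exact: tr.
  by rewrite pt_scale // mulf_neq0 // invr_eq0.
have near_D : (\forall e \near F0, D (ins s e))%classic.
  have so : opp_pt s != s by case: (s).
  have nl : (\forall e \near F0, D (pt (line s (opp_pt s) e)))%classic.
    by apply: cvg_within; exact: nD.
  by apply: filterS nl => e; rewrite /ins pvec_line.
have [rc [_ cE]] := riemann_hurwitz cop d0.
have [k [rs [k0 srs wE mE cnt]]] := fibre_factor cop (peval f s) d0.
have near_s : (\forall e \near F0, ins s e != s)%classic.
  apply: filterS (near_dnbhs0 K) => e; apply: contraNneq => es.
  have [m m0 E] := vec_pt (pvec_neq0 s e).
  have := wedge_pvec s e; rewrite E wedgeZl -/(ins s e) es -/(br s s) brxx mulr0.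
  by move/esym/eqP; rewrite mulf_eq0 (negbTE (sgp_neq0 s)).
have near_crit : (\forall e \near F0, pldeg f (ins s e) = 1%N)%classic.
  have : (\forall e \near F0, forall r, r \in rc -> ins s e != r)%classic.
    elim: rc {cE} => [|r rc' IH]; first by near=> e.
    have nr : (\forall e \near F0, ins s e != r)%classic.
      have [->//|sr] := eqVneq r s; rewrite eq_sym in sr.
      exact: (conv_neq (chart_id _ _) (conv_ins s) (conv_cst r) sr).
    apply: filterS2 nr IH => e e1 e2 r'; rewrite inE => /orP[/eqP -> //|].
    exact: e2.
  move=> nrc; apply: filterS nrc => e h; apply/eqP; rewrite eqn_leq ldeg_gt0 // andbT leqNgt.
  apply/negP => l2; have : ins s e \in rc.
    by rewrite -has_pred1 has_count cE; lia.
  by move=> /h; rewrite eqxx.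
set H := hlift f; set S := vec s; set U := vec t.
(* bounds the determinant of the lifts of [f t] and [f e], see [uv] below *)
pose v e := (dl^-1 ^+ (pdegree f).-1 * (wedge (H (pvec s e)) (H S) / e)) *
  wedge U (pvec s e).
have [m m0 HS] := hlift_vec cop s; have [m' m'0 HU] := hlift_vec cop t.
have v0 : tends F0 v 0.
  have pow0 : tends F0 (fun e => e ^+ (pldeg f s).-1) 0.
    have z0 : (0 : K) ^+ (pldeg f s).-1 = 0.
      by rewrite expr0n; case: (pldeg f s) m2 => [|[]].
    rewrite -[X in tends _ _ X]z0; by apply: tendsX; exact: tends_id.
  pose w e := (\prod_(r <- rs) wedge (pvec s e) (vec r)) / e ^+ count_mem s rs.
  have lim : tends F0 (fun e => dl^-1 ^+ (pdegree f).-1 * (m * k) *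
      (w e * e ^+ (pldeg f s).-1) * wedge U (pvec s e)) (dl^-1 ^+ (pdegree f).-1 *
      (m * k) * ((\prod_(r <- rs) (if r == s then sgp s else br s r)) * 0) * wedge U S).
    apply: tendsM.
      apply: tendsM; first exact: tends_cst.
      by apply: tendsM => //; exact: tends_factors.
    apply: vtends_wedge; last exact: vtends_pvec.
    by split; apply: tends_cst.
  rewrite !mulr0 mul0r in lim; apply: tends_near lim; near=> e.
  have e0 : e != 0 by near: e; exact: near_dnbhs0.
  rewrite /v (_ : H S = vscale m (vec (peval f s))) // wedgeZr wE /w cnt //.
  have -> : e ^+ pldeg f s = e * e ^+ (pldeg f s).-1.
    by rewrite -exprS prednK // (ltnW m2).
  have := expf_neq0 (pldeg f s).-1 e0.
  move: (e ^+ _) (\prod_(r <- rs) _) (dl^-1 ^+ _) (wedge _ _) => x y z w' x0.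
  by field; rewrite x0 e0.
have u0 : tends F0 (fun e => wedge (H U) (H (pvec s e))) (wedge (H U) (H S)).
  apply: vtends_wedge; first by split; apply: tends_cst.
  by apply: vtends_hlift; exact: vtends_pvec.
have : wedge (H U) (H S) != 0.
  by rewrite /H HU HS wedgeZl wedgeZr !mulf_neq0 // br_neq0.
suff uv : (\forall e \near F0, `|wedge (H U) (H (pvec s e))| <= `|v e|)%classic.
  have -> : wedge (H U) (H S) = 0 by apply: tends_unique u0 (tends0_norm_le uv v0).
  by rewrite eqxx.
near=> e; rewrite /v.
have e0 : e != 0 by near: e; exact: near_dnbhs0.
have De : D (ins s e) by near: e.
have l1 : pldeg f (ins s e) = 1%N by near: e.
have [k' [rs' [k'0 srs' wE' mE' cE']]] := fibre_factor cop (peval f (ins s e)) d0.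
have [mu mu0 HP] := hlift_pvec cop s e.
have [nu nu0 PE] := vec_pt (pvec_neq0 s e); rewrite -/(ins s e) in PE.
have ins_rs : ins s e \in rs' by rewrite mE'.
have split_prod V : \prod_(r <- rs') wedge V (vec r) =
    wedge V (vec (ins s e)) * \prod_(r <- rem (ins s e) rs') wedge V (vec r).
  by rewrite (perm_big _ (perm_to_rem ins_rs)) big_cons.
have le : `|\prod_(r <- rem (ins s e) rs') wedge U (vec r)| <=
    dl^-1 ^+ (pdegree f).-1 * `|\prod_(r <- rem (ins s e) rs') wedge S (vec r)|.
  have -> : (pdegree f).-1 = size (rem (ins s e) rs') by rewrite size_rem // srs'.
  apply: norm_prod_le; first by rewrite invr_ge0 ltW.
  move=> r rrs; apply: far => Dr.
  have rE : r = ins s e.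
    by apply: injD => //; apply/eqP; rewrite -mE'; apply: mem_rem rrs.
  move: rrs; rewrite rE -has_pred1 has_count.
  have := cE' _ (erefl _); rewrite l1 (permP (perm_to_rem ins_rs)) /= eqxx.
  by rewrite add1n => -[] ->.
have eE : e = sgp s * (nu * br (ins s e) s).
  rewrite /br -wedgeZl -PE wedge_pvec mulrA.
  by case: (s) => [z|]; rewrite /= ?mulrNN !mul1r.
set PU := \prod_(r <- _) _ in le; set PS := \prod_(r <- _) _ in le.
have HPS : wedge (H (pvec s e)) (H S) = - (mu * k' * (br s (ins s e) * PS)).
  by rewrite wedgeC /H HP wedgeZr wE' split_prod !mulrA.
have HPU : wedge (H U) (H (pvec s e)) = mu * k' * (wedge U (vec (ins s e)) * PU).
  by rewrite /H HP wedgeZr wE' split_prod !mulrA.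
have is0 : br (ins s e) s != 0 by apply: br_neq0; near: e.
have quot : wedge (H (pvec s e)) (H S) / e = mu * k' * PS / (sgp s * nu).
  rewrite HPS [X in _ / X]eE brC; field.
  by rewrite is0 nu0 sgp_neq0.
rewrite quot HPU PE wedgeZr !normrM normfV !normrM.
have -> : `|sgp s| = 1 by case: (s) => [z|]; rewrite /= ?normrN normr1.
rewrite mul1r; have nu1 : `|nu| != 0 by rewrite normr_eq0.
have -> : `|dl^-1 ^+ (pdegree f).-1| = dl^-1 ^+ (pdegree f).-1.
  by rewrite ger0_norm // exprn_ge0 // invr_ge0 ltW.
set a := `|mu|; set b := `|k'|; set c := `|wedge _ _|.
have -> : dl^-1 ^+ (pdegree f).-1 * (a * b * `|PS| / `|nu|) * (`|nu| * c) =
   a * b * (c * (dl^-1 ^+ (pdegree f).-1 * `|PS|)).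
  move: (dl^-1 ^+ _) => y; by field.
by rewrite !ler_wpM2l // ?mulr_ge0 ?normr_ge0.
Unshelve. all: by end_near.
Qed.
End Ramification.

Lemma vtends_line (K : numClosedFieldType) (s t : option K) :
  vtends (nbhs (0 : K)) (line s t) (vscale 1 (vec s)).
Proof.
have lin (a b : K) : tends (nbhs (0 : K)) (fun e => a + e * b) (1 * a).
  rewrite -[X in tends _ _ X]addr0 mul1r -[X in _ + X](mul0r b).
  by apply: tendsD; [exact: tends_cst | apply: tendsM; [exact: cvg_id | exact: tends_cst]].
by split; exact: lin.
Qed.

Section InsForms.
Variable K : numClosedFieldType.
Implicit Types (z e : K) (s : option K).

Lemma ins_finite z e : ins (Some z) e = Some (e + z).
Proof. by rewrite /ins /pt /= oner_eq0 divr1 addrC. Qed.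

Lemma ins_infinite e : ins None e = if e == 0 then None else Some e^-1.
Proof. by rewrite /ins /pt /= mul1r. Qed.

Lemma loc_finite_div z e s : loc (Some z) s / e = e^-1 *: (odflt 0 s - z : K^o).
Proof. exact: mulrC. Qed.

Lemma loc_infinite_div e s :
  loc None s / e = e^-1 *: ((if s is Some w then w^-1 else 0) - 0 : K^o).
Proof. by rewrite subr0; exact: mulrC. Qed.

End InsForms.

(** * The topology of the Riemann sphere *)
Section SphereTopology.
Variable R : realType.
Variables (T : Type) (F : set_system T).
Context {FF : ProperFilter F}.

Lemma tendsP (u : T -> Cplx R) a : tends F u a <->
  forall eps : R, 0 < eps -> (\forall x \near F, `|a - u x| < (eps%:C)%C)%classic.
Proof.
split=> [ua eps e0|h].
  have /cvgrPdist_lt := ua; apply.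
  by rewrite ltcR.
apply/cvgrPdist_lt => -[er ei]; rewrite ltcE /= => /andP[/eqP -> er0].
exact: h.
Qed.

Lemma tends_Re (u : T -> Cplx R) a : tends F u a ->
  ((fun x => complex.Re (u x)) @ F --> complex.Re a)%classic.
Proof.
move=> /tendsP ua; apply/cvgrPdist_lt => eps /ua.
apply: filterS => x; rewrite -ltcR; apply: le_lt_trans.
have reB (z w : R[i]) : complex.Re (z - w) = complex.Re z - complex.Re w.
  by case: z w => ? ? [].
by rewrite -reB; apply: normc_ge_Re.
Qed.

Lemma tends_Im (u : T -> Cplx R) a : tends F u a ->
  ((fun x => complex.Im (u x)) @ F --> complex.Im a)%classic.
Proof.
move=> /tendsP ua; apply/cvgrPdist_lt => eps /ua.
apply: filterS => x; rewrite -ltcR; apply: le_lt_trans.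
have imB (z w : R[i]) : complex.Im (z - w) = complex.Im z - complex.Im w.
  by case: z w => ? ? [].
rewrite -imB normc_def lecR -sqrtr_sqr ler_wsqrtr //.
by rewrite lerDr sqr_ge0.
Qed.

Lemma tends_complex (u v : T -> R) a b :
  (u @ F --> a)%classic -> (v @ F --> b)%classic ->
  tends F (fun x => Complex (u x) (v x) : Cplx R) (Complex a b).
Proof.
move=> ua vb; apply/tendsP => eps e0.
have e2 : 0 < eps / 2 by rewrite divr_gt0.
have /cvgrPdist_lt/(_ _ e2) near_u := ua; have /cvgrPdist_lt/(_ _ e2) near_v := vb.
apply: filterS2 near_v near_u => x hv hu.
apply: (@le_lt_trans _ _ ((`|a - u x| + `|b - v x|)%:C)%C).
  rewrite normc_def lecR /= -[leRHS]ger0_norm ?addr_ge0 // -sqrtr_sqr ler_wsqrtr //.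
  have sq (p q : R) : p ^+ 2 + q ^+ 2 <= (`|p| + `|q|) ^+ 2.
    rewrite sqrrD !real_normK ?num_real // addrAC lerDl mulrn_wge0 //.
    by rewrite mulr_ge0.
  exact: sq.
by rewrite ltcR; lra.
Qed.

Lemma sphere_cvg (s : T -> sphere R) (p : sphere R) :
  ((fun x => stereo (s x)) @ F --> stereo p)%classic <-> (s @ F --> p)%classic.
Proof.
split=> [h|h]; last first.
  apply: (continuous_cvg _ _ h).
  exact: (@initial_continuous (sphere R) _ (@stereo R)).
move=> D [B [[O oO OB] Bp BD]].
have : nbhs (stereo p) O.
  by apply: open_nbhs_nbhs; split=> //; move: Bp; rewrite -OB.
move=> /h; rewrite /nbhs /=; apply: filterS => x /= Ox.
by apply: BD; rewrite -OB.
Qed.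

Local Notation SX p := ((stereo p).1.1).
Local Notation SY p := ((stereo p).1.2).
Local Notation SZ p := ((stereo p).2).

Lemma stereo_coords (s : T -> sphere R) p : (s @ F --> p)%classic ->
  [/\ ((fun x => SX (s x)) @ F --> SX p)%classic,
     ((fun x => SY (s x)) @ F --> SY p)%classic &
     ((fun x => SZ (s x)) @ F --> SZ p)%classic].
Proof.
move=> /sphere_cvg; case E : (stereo p) => [[x y] z] h.
have hxy : ((fun t => (stereo (s t)).1) @ F --> (x, y))%classic.
  exact: (cvg_comp _ _ h (@cvg_fst _ _ (nbhs (x, y)) (nbhs z) _)).
split.
- exact: (cvg_comp _ _ hxy (@cvg_fst _ _ (nbhs x) (nbhs y) _)).
- exact: (cvg_comp _ _ hxy (@cvg_snd _ _ (nbhs x) (nbhs y) _)).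
- exact: (cvg_comp _ _ h (@cvg_snd _ _ (nbhs (x, y)) (nbhs z) _)).
Qed.

Lemma sqr_norm_gt0 (a b : R) : 0 < 1 + (a ^+ 2 + b ^+ 2).
Proof. by rewrite ltr_pwDl // addr_ge0 // sqr_ge0. Qed.

Lemma stereo_finite (w : Cplx R) :
  w = Complex (SX (Some w : sphere R) / (1 - SZ (Some w : sphere R)))
              (SY (Some w : sphere R) / (1 - SZ (Some w : sphere R))).
Proof.
case: w => a b /=; have := lt0r_neq0 (sqr_norm_gt0 a b) => n0.
have d0 : 1 - (a ^+ 2 + b ^+ 2 - 1) / (1 + (a ^+ 2 + b ^+ 2)) =
  2 / (1 + (a ^+ 2 + b ^+ 2)) by field.
by rewrite d0; congr Complex; field.
Qed.

Lemma stereo_inverse (w : Cplx R) : w != 0 ->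
  w^-1 = Complex (SX (Some w : sphere R) / (1 + SZ (Some w : sphere R)))
              (- SY (Some w : sphere R) / (1 + SZ (Some w : sphere R))).
Proof.
case: w => a b; rewrite eq_complex /= => ab0; have := lt0r_neq0 (sqr_norm_gt0 a b) => n0.
have m0 : a ^+ 2 + b ^+ 2 != 0.
  rewrite paddr_eq0 ?sqr_ge0 // !sqrf_eq0 //.
have d0 : 1 + (a ^+ 2 + b ^+ 2 - 1) / (1 + (a ^+ 2 + b ^+ 2)) =
  2 * (a ^+ 2 + b ^+ 2) / (1 + (a ^+ 2 + b ^+ 2)) by field.
rewrite d0; transitivity (Complex (a / (a ^+ 2 + b ^+ 2)) (- (b / (a ^+ 2 + b ^+ 2)))) => //.
by congr Complex; field; rewrite m0 n0.
Qed.

(** The inverse of the stereographic projection is a quotient of coordinates, whose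
denominator vanishes at one pole only; the two choices of pole cover the sphere. *)
Lemma sphere_conv (s : T -> sphere R) (p : sphere R) :
  (s @ F --> p)%classic -> conv F (fun _ S => S) (s : T -> option (Cplx R)) p.
Proof.
move=> /stereo_coords[hX hY hZ]; case: p hX hY hZ => [z|] hX hY hZ.
  have z1 : SZ (Some z : sphere R) < 1.
    case: (z) => a b /=; rewrite ltr_pdivrMr ?sqr_norm_gt0 //; lra.
  have nz : (\forall x \near F, SZ (s x) < 1)%classic by apply: cvgr_lt hZ _ z1.
  exists (fun=> 1) => [x|]; first by rewrite oner_eq0.
  split=> /=.
    rewrite [X in tends _ _ X](stereo_finite z).
    have lim : tends F (fun x => Complex (SX (s x) / (1 - SZ (s x))) (SY (s x) / (1 - SZ (s x))) : Cplx R)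
       (Complex (SX (Some z : sphere R) / (1 - SZ (Some z : sphere R)))
              (SY (Some z : sphere R) / (1 - SZ (Some z : sphere R)))).
      have d1 : 1 - SZ (Some z : sphere R) != 0 by rewrite lt0r_neq0 // subr_gt0.
      have hD : ((fun x => 1 - SZ (s x)) @ F --> 1 - SZ (Some z : sphere R))%classic.
        by apply: cvgB => //; exact: cvg_cst.
      by apply: tends_complex; apply: cvgM => //; apply: cvgV.
    apply: tends_near lim; near=> x.
    have : SZ (s x) < 1 by near: x.
    rewrite ?mul1r; case: (s x) => [w _|]; first by rewrite -stereo_finite.
    by rewrite ltxx.
  apply: (@tends_near _ _ _ _ (fun=> 1)); last exact: tends_cst.
  near=> x; have : SZ (s x) < 1 by near: x.
  by rewrite mul1r; case: (s x) => //=; rewrite ltxx.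
have nz : (\forall x \near F, -1 < SZ (s x))%classic.
  by apply: cvgr_gt hZ _ _ => /=; lra.
exists (fun x => if s x is Some w then (if w == 0 then 1 else w^-1) else 1).
  move=> x; case: (s x) => [w|]; last by rewrite oner_eq0.
  by case: ifPn => [_|w0]; [rewrite oner_eq0 | rewrite invr_eq0].
split=> /=.
  apply: (@tends_near _ _ _ _ (fun=> 1)); last exact: tends_cst.
  near=> x; have : -1 < SZ (s x) by near: x.
  case: (s x) => [w|]; rewrite /= ?mulr1 //; have [->|w0 _] := eqVneq w 0.
    by rewrite /= expr0n /= addr0 sub0r addr0 divr1 ltxx.
  by rewrite mulVf.
have lim : tends F (fun x => Complex (SX (s x) / (1 + SZ (s x))) (- SY (s x) / (1 + SZ (s x))) : Cplx R)
       (Complex (SX (None : sphere R) / (1 + SZ (None : sphere R)))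
              (- SY (None : sphere R) / (1 + SZ (None : sphere R)))).
  have d1 : 1 + SZ (None : sphere R) != 0 by rewrite /= lt0r_neq0 // addr_gt0.
  have hD : ((fun x => 1 + SZ (s x)) @ F --> 1 + SZ (None : sphere R))%classic.
    by apply: cvgD => //; exact: cvg_cst.
  have hV : ((fun x => (1 + SZ (s x))^-1) @ F --> (1 + SZ (None : sphere R))^-1)%classic.
    exact: cvgV.
  have hN : ((fun x => - SY (s x)) @ F --> - SY (None : sphere R))%classic by exact: cvgN.
  by apply: tends_complex; apply: cvgM.
rewrite /= oppr0 !mul0r in lim.
apply: tends_near lim; near=> x.
have : -1 < SZ (s x) by near: x.
case: (s x) => [w|]; rewrite ?mulr0; last by rewrite /= oppr0 !mul0r.
have [->|w0 _] := eqVneq w 0.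
  by rewrite /= expr0n /= addr0 sub0r addr0 divr1 ltxx.
by rewrite mulr1 stereo_inverse.
Unshelve. all: by end_near.
Qed.


Lemma cvg_triple (u v w : T -> R) (a b c : R) :
  (u @ F --> a)%classic -> (v @ F --> b)%classic -> (w @ F --> c)%classic ->
  ((fun x => (u x, v x, w x)) @ F --> (a, b, c))%classic.
Proof.
move=> ua vb wc.
have uv : ((fun x => (u x, v x)) @ F --> (a, b))%classic.
  exact: (cvg_pair (G := nbhs a) (H := nbhs b) ua vb).
exact: (cvg_pair (G := nbhs (a, b)) (H := nbhs c) uv wc).
Qed.

Definition sqn (z : Cplx R) : R := complex.Re z ^+ 2 + complex.Im z ^+ 2.

Lemma sqn_eq0 z : (sqn z == 0) = (z == 0).
Proof. by case: z => a b; rewrite /sqn eq_complex /= paddr_eq0 ?sqr_ge0 // !sqrf_eq0. Qed.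

(** The stereographic projection in homogeneous coordinates: the same formula holds
at infinity, which makes its continuity obvious. *)
Definition hstereo (x y : Cplx R) : R * R * R :=
  (2 * (complex.Re x * complex.Re y + complex.Im x * complex.Im y) / (sqn x + sqn y),
   2 * (complex.Im x * complex.Re y - complex.Re x * complex.Im y) / (sqn x + sqn y),
   (sqn x - sqn y) / (sqn x + sqn y)).

Lemma sqnD_neq0 (x y : Cplx R) : (x, y) != (0, 0) -> sqn x + sqn y != 0.
Proof.
by rewrite xpair_eqE paddr_eq0 ?addr_ge0 ?sqr_ge0 // !sqn_eq0.
Qed.

Lemma stereo_pt (x y : Cplx R) : (x, y) != (0, 0) ->
  stereo (pt (x, y) : sphere R) = hstereo x y.
Proof.
move=> xy0; have := sqnD_neq0 xy0; rewrite /pt /hstereo /=.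
have [->|y0] := eqVneq y 0.
  rewrite /sqn /= expr0n /= !addr0 !mulr0 !addr0 !subr0 mulr0 !mul0r => n0.
  by rewrite divff.
have m0 : sqn y != 0 by rewrite sqn_eq0.
have -> : x / y = Complex
    ((complex.Re x * complex.Re y + complex.Im x * complex.Im y) / sqn y)
    ((complex.Im x * complex.Re y - complex.Re x * complex.Im y) / sqn y).
  case: x y {xy0 y0} m0 => [a b] [c d]; rewrite /sqn /= => m0.
  transitivity (Complex (a * (c / (c ^+ 2 + d ^+ 2)) - b * (- (d / (c ^+ 2 + d ^+ 2))))
    (a * (- (d / (c ^+ 2 + d ^+ 2))) + b * (c / (c ^+ 2 + d ^+ 2)))) => //.
  by congr Complex; field.
move=> n0; set u := _ / sqn y; set v := _ / sqn y.
have uv : u ^+ 2 + v ^+ 2 = sqn x / sqn y.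
  by rewrite /u /v; move: m0; rewrite /sqn => m0; field.
have e1 : 1 + (u ^+ 2 + v ^+ 2) = (sqn x + sqn y) / sqn y by rewrite uv; field.
rewrite /= e1 uv /u /v; move: (sqn x) (sqn y) m0 n0 => X Y m0 n0.
by congr (_, _, _); field; rewrite n0 m0.
Qed.

Lemma pt_cvg (L : T -> Cplx R * Cplx R) c (p : sphere R) :
  c != 0 -> vtends F L (vscale c (vec p)) ->
  ((fun x => pt (L x) : sphere R) @ F --> p)%classic.
Proof.
move=> c0 [L1 L2]; apply/sphere_cvg.
set l := vscale c (vec p) in L1 L2.
have lp : pt l = p by exact: pt_scale.
have l0 : (l.1, l.2) != (0, 0).
  rewrite /l; case: (p) => [z|]; rewrite xpair_eqE /= mulr1 (negbTE c0) ?andbF //.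
have -> : stereo p = hstereo l.1 l.2 by rewrite -stereo_pt // -surjective_pairing lp.
have [[a1 b1] [a2 b2]] := ((tends_Re L1, tends_Im L1), (tends_Re L2, tends_Im L2)).
have sq (u : T -> Cplx R) a : tends F u a -> ((fun x => sqn (u x)) @ F --> sqn a)%classic.
  by move=> ua; have [re im] := (tends_Re ua, tends_Im ua); rewrite /sqn;
    exact: (cvgD (cvgM re re) (cvgM im im)).
have [n1 n2] := (sq _ _ L1, sq _ _ L2).
have n : ((fun x => sqn (L x).1 + sqn (L x).2) @ F --> sqn l.1 + sqn l.2)%classic.
  exact: (cvgD n1 n2).
have nV : ((fun x => (sqn (L x).1 + sqn (L x).2)^-1) @ F --> (sqn l.1 + sqn l.2)^-1)%classic.
  exact: (cvgV (sqnD_neq0 l0) n).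
have c2 : ((fun=> 2 : R) @ F --> (2 : R))%classic by exact: cvg_cst.
have lim : ((fun x => hstereo (L x).1 (L x).2) @ F --> hstereo l.1 l.2)%classic.
  exact: (cvg_triple (cvgM (cvgM c2 (cvgD (cvgM a1 a2) (cvgM b1 b2))) nV)
    (cvgM (cvgM c2 (cvgB (cvgM b1 a2) (cvgM a1 b2))) nV) (cvgM (cvgB n1 n2) nV)).
apply: cvg_trans lim; apply: near_eq_cvg; near=> x.
have Lx : sqn (L x).1 + sqn (L x).2 != 0.
  by near: x; apply: cvgr_neq0 n (sqnD_neq0 l0).
rewrite -stereo_pt -?surjective_pairing //.
by apply: contraNneq Lx => ->; rewrite /sqn /= expr0n /= !addr0.
Unshelve. all: by end_near.
Qed.

End SphereTopology.

(** * Rational maps on the sphere *)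
Section RatmapBridge.
Variable R : realType.
Local Notation K := (Cplx R).

Definition polys (f : ratmap R) : {poly K} * {poly K} := (rnum f, rden f).

Lemma polys_coprime f : coprimep (polys f).1 (polys f).2.
Proof. exact: rat_coprime. Qed.

Lemma ldeg_polys (f : ratmap R) s : ldeg f s = pldeg (polys f) s. Proof. by []. Qed.
Lemma rdeg_polys (f : ratmap R) : rdeg f = pdegree (polys f). Proof. by []. Qed.

Lemma line_cvg (s t : sphere R) :
  ((fun e : K => pt (line s t e) : sphere R) @ (0 : K) --> s)%classic.
Proof.
exact: (pt_cvg (oner_neq0 (Cplx R)) (vtends_line s t)).
Qed.

(** A covering is injective on a neighbourhood of each point. *)
Lemma covering_unramified (f : ratmap R) (A B : set (sphere R)) s :
  covering A B f -> (0 < rdeg f)%N -> A s -> ldeg f s = 1%N.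
Proof.
move=> [fAB cov] d0 As; have [W [oW Wb WB [I [D [oD tD DE hD]]]]] := cov _ (fAB _ As).
have : (A `&` f @^-1` W)%classic s by [].
rewrite DE => -[i _ Dis].
apply: (@injective_unramified K (polys f) (D i) s (polys_coprime f) d0).
  move=> t _; apply: (@line_cvg s t); exact: open_nbhs_nbhs.
move=> r r' Dr Dr' e; have [[_ inj _] _ _] := hD i.
by apply: inj => //; rewrite inE.
Qed.

Lemma uniform_pointwise (A : set (sphere R)) g h s :
  cvg_locally_uniformly_outside A g h -> ~ A s ->
  ((fun n => g n s) @ \oo --> h s)%classic.
Proof.
move=> cu As; have [W nW cW] := cu s As.
have sub : ([set s] `<=` W)%classic by move=> _ ->; exact: nbhs_singleton.
have := uniform_subset_cvg _ sub cW; rewrite uniform_set1; exact.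
Qed.

(** The coordinates [loc] are those in which the multiplier is defined. *)
Lemma multiplier_germ (g : sphere R -> sphere R) p c :
  g p = p -> germ g p p c -> multiplier g p = c.
Proof.
case: p => [z|] gp [_ lim]; rewrite /multiplier /derive1; apply: cvg_lim => //.
  apply: cvg_trans lim; apply: near_eq_cvg; near=> h.
  rewrite loc_finite_div ins_finite; congr (_ *: (_ - _)).
  by rewrite gp.
apply: cvg_trans lim; apply: near_eq_cvg; near=> h.
rewrite loc_infinite_div ins_infinite addr0; congr (_ *: (_ - _)).
  rewrite /sphere_inv; case: (g _) => [w|] //=.
  by have [->|w0] := eqVneq w 0; rewrite //= invr0.
by rewrite /= eqxx gp.
Unshelve. all: by end_near.
Qed.
End RatmapBridge.

(** * Branches, paths and annuli of a tree *)
Section TreeWalks.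
Local Close Scope ring_scope.
Variables (R : realType) (V : finType) (X : {set V}) (T : sphere_tree R X).
Implicit Types (a b u v w x y : V) (p : seq V) (c : {set V}).
Local Notation e := (edge T).

(** Branches are sets of cells; on vertices, those at [v] are the classes of this
relation, see [in_branch]. *)
Definition con v := connect [rel a b | [&& e a b, a != v & b != v]].

Lemma con_sym v : symmetric (con v).
Proof.
apply: sym_connect_sym => a b /=; rewrite edge_sym.
by congr (_ && _); rewrite andbC.
Qed.

Lemma con_refl v x : con v x x. Proof. exact: connect0. Qed.

Lemma con_trans v : transitive (con v).
Proof. by move=> a b c'; apply: connect_trans. Qed.

Lemma con_edge v a b : e a b -> a != v -> b != v -> con v a b.
Proof. by move=> eab av bv; apply: connect1; rewrite /= eab av bv. Qed.

Lemma edge_neq a b : e a b -> a != b.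
Proof. by apply: contraTneq => ->; rewrite edge_irr. Qed.

Lemma edge_vertsR a b : e a b -> b \in verts T.
Proof. by rewrite edge_sym => /edge_verts. Qed.

Lemma con_path v x y : con v x y -> x != v ->
  exists p, [/\ path e x p, last x p = y, uniq (x :: p) & v \notin x :: p].
Proof.
case/connectP => p0 pth -> xv.
have [p pth' u _] := shortenP pth.
have sub a q : path [rel a b | [&& e a b, a != v & b != v]] a q ->
    path e a q /\ v \notin q.
  elim: q a => //= b q IH a /andP[/and3P[eab av bv] /IH[pq nq]].
  by rewrite eab pq inE negb_or eq_sym bv nq.
have [pe np] := sub _ _ pth'.
by exists p; split=> //; rewrite inE negb_or eq_sym xv.
Qed.

Lemma path_con v x p y : path e x p -> v \notin x :: p -> y \in x :: p -> con v x y.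
Proof.
elim: p x => [|b p IH] x /=; first by move=> _ _; rewrite mem_seq1 => /eqP ->; apply: con_refl.
move=> /andP[exb pb]; rewrite !inE !negb_or => /and3P[vx vb vp].
have xb : con v x b by apply: con_edge => //; rewrite eq_sym.
move=> /predU1P[->|yp]; first exact: con_refl.
apply: con_trans xb (IH _ pb _ _); last by rewrite inE.
by rewrite inE negb_or vb.
Qed.

Lemma con_edge_uniq v a b : e v a -> e v b -> con v a b -> a = b.
Proof.
move=> eva evb cab.
have av : a != v by rewrite eq_sym edge_neq.
have [p [pa lp up np]] := con_path cab av.
have := @tree_acyclic _ _ _ T (v :: a :: p).
rewrite [uniq _]cons_uniq np up => /(_ isT).
rewrite /= rcons_path pa lp eva edge_sym evb => /(_ isT).
by case: p lp {pa up np} => [|? ?] //=.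
Qed.

Lemma tree_uniq_path a b : a \in verts T -> b \in verts T ->
  exists p, [/\ path e a p, last a p = b & uniq (a :: p)].
Proof.
move=> aT bT; have /connectP[p0 pth ->] := tree_connected aT bT.
by have [p pth' u _] := shortenP pth; exists p.
Qed.

(** Follow a path from [x] to [v]: either it avoids [v'], or its part up to [v']
avoids [v]. *)
Lemma con_other v v' x : x \in verts T -> v \in verts T -> v != v' ->
  con v x v' || con v' x v.
Proof.
move=> xT vT vv'; have [p [px lp up]] := tree_uniq_path xT vT.
have [v'p|v'p] := boolP (v' \in x :: p); last first.
  by rewrite orbC (path_con px v'p) // -lp mem_last.
apply/orP; left; have [->|xv'] := eqVneq v' x; first exact: con_refl.
move: v'p; rewrite inE (negbTE xv') /= => v'p.
case/splitPr: v'p px lp up => p1 p2; rewrite cat_path /= => /and3P[px el pv'] lp up.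
have nv : v \notin x :: rcons p1 v'.
  have vp2 : v \in p2.
    move: lp; rewrite last_cat /=; case: p2 {pv' up} => [/=|b p2].
      by move=> E; rewrite E eqxx in vv'.
    by move=> /= <-; rewrite mem_last.
  have : uniq ((x :: rcons p1 v') ++ p2) by rewrite cat_cons cat_rcons.
  by rewrite cat_uniq => /and3P[_ /hasPn/(_ v vp2)].
apply: (path_con _ nv); first by rewrite rcons_path px.
by rewrite inE mem_rcons inE eqxx orbT.
Qed.

(** The default value [v] only occurs for [x] equal to [v] or off the tree. *)
Definition nxt v x := odflt v [pick u | e v u && con v u x].

Lemma nxt_eq v u x : e v u -> con v u x -> nxt v x = u.
Proof.
move=> evu cux; rewrite /nxt; case: pickP => [w /andP[evw cwx]|/(_ u)] /=.
  apply: con_edge_uniq evw evu _; rewrite con_sym in cux.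
  by apply: con_trans cwx _.
by rewrite evu cux.
Qed.

Lemma nxtP v x : v \in verts T -> x \in verts T -> x != v ->
  e v (nxt v x) /\ con v (nxt v x) x.
Proof.
move=> vT xT xv; have [[|u p] [pv lp up]] := tree_uniq_path vT xT.
  by rewrite -lp eqxx in xv.
move: pv up => /= /andP[evu pu] /andP[nv _].
have cux : con v u x by rewrite -lp; apply: path_con pu nv (mem_last _ _).
by rewrite (nxt_eq evu cux).
Qed.

Lemma nxt_con v x y : v \in verts T -> x \in verts T -> y \in verts T ->
  x != v -> y != v -> (nxt v x == nxt v y) = con v x y.
Proof.
move=> vT xT yT xv yv.
have [ex cx] := nxtP vT xT xv; have [ey cy] := nxtP vT yT yv.
apply/eqP/idP => [E|cxy].
  by apply: con_trans cy; rewrite con_sym -E.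
by apply/nxt_eq => //; rewrite con_sym in cxy; apply: con_trans cy _.
Qed.

Lemma nxt_edge v u : e v u -> nxt v u = u.
Proof. by move=> evu; apply: nxt_eq => //; apply: con_refl. Qed.

(** If [u] is not a leaf it has a further neighbour, and the branch beyond it is
strictly smaller. *)
Lemma branch_leaf v u : e v u -> exists2 x, x \in X & con v u x.
Proof.
move: {2}(#|[set w | con v u w]|) (leqnn #|[set w | con v u w]|) => n.
elim: n v u => [|n IH] v u le evu.
  by move: le; rewrite leqn0 cards_eq0 => /eqP/setP/(_ u); rewrite !inE con_refl.
have uT := edge_vertsR evu.
have [uX|uX] := boolP (u \in X); first by exists u => //; apply: con_refl.
have : u \in verts T :\: X by rewrite inE uX uT.
move=> /internal_valence val.
have /subsetPn[x] : ~~ ([set x | e u x] \subset [set v]).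
  by apply/negP => /subset_leq_card; rewrite cards1 leqNgt (leq_trans _ val).
rewrite !inE => eux xv.
have xu : x != u by rewrite eq_sym edge_neq.
have sub w : con u x w -> con v u w.
  move=> cxw; have [p [px lp up np]] := con_path cxw xu.
  have nv : v \notin x :: p.
    apply/negP => vp; have cxv : con u x v by apply: path_con px np vp.
    by have := con_edge_uniq eux _ cxv; rewrite edge_sym => /(_ evu) xv'; rewrite xv' eqxx in xv.
  apply: (con_trans (con_edge eux _ _)) => //; first by rewrite eq_sym edge_neq.
  by rewrite -lp; apply: path_con px nv (mem_last _ _).
have [] := IH u x _ eux; last by move=> y yX cy; exists y => //; apply: sub.
rewrite -ltnS (leq_trans _ le) // proper_card //; apply/properP; split.
  by apply/fintype.subsetP => w; rewrite !inE; apply: sub.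
exists u; rewrite !inE ?con_refl //; apply/negP => cxu.
have [p [px lp up np]] := con_path cxu xu.
by rewrite -lp mem_last in np.
Qed.

Lemma cellsP c : reflect ((exists2 w, w \in verts T & c = [set w]) \/
  exists a b, e a b /\ c = [set a; b]) (c \in cells T).
Proof.
rewrite inE; apply: (iffP orP) => -[].
- by case/imsetP => w wT ->; left; exists w.
- by case/imsetP => -[a b]; rewrite inE /= => eab ->; right; exists a, b.
- by case=> w wT ->; left; apply: imset_f.
- by case=> a [b [eab ->]]; right; apply/imsetP; exists (a, b); rewrite ?inE.
Qed.

Lemma vertex_cell w : ([set w] \in cells T) = (w \in verts T).
Proof.
apply/cellsP/idP => [[[w' wT /set1_inj -> //]|[a [b [eab E]]]]|wT].
  by have := cards2 a b; rewrite -E cards1 (edge_neq eab).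
by left; exists w.
Qed.

Lemma edge_cell a b : e a b -> [set a; b] \in cells T.
Proof. by move=> eab; apply/cellsP; right; exists a, b. Qed.

Let cell_rel v := [rel c1 c2 | [&& c1 \in cells T :\ [set v],
   c2 \in cells T :\ [set v] & (c1 \subset c2) || (c2 \subset c1)]].

Lemma cell_step v x c1 c2 : cell_rel v c1 c2 ->
  (exists2 w, w \in c1 & (w != v) && con v x w) ->
  exists2 w, w \in c2 & (w != v) && con v x w.
Proof.
rewrite /cell_rel /= => /and3P[]; rewrite !in_setD1 => /andP[n1 C1] /andP[n2 C2].
case/orP => sub [w w1 /andP[wv cw]].
  by exists w; [apply: (fintype.subsetP sub) | rewrite wv].
have [w2 w2c w2v] : exists2 w2, w2 \in c2 & w2 != v.
  case/cellsP: C2 n2 {sub} => [[u _ ->]|[a [b [eab ->]]]] n2.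
    by exists u; rewrite ?inE //; apply: contraNneq n2 => ->.
  have [av|av] := eqVneq a v; last by exists a; rewrite ?inE ?eqxx.
  by exists b; rewrite ?inE ?eqxx ?orbT // -av eq_sym edge_neq.
have w21 : w2 \in c1 by apply: (fintype.subsetP sub).
exists w2 => //; rewrite w2v /=; have [<- //|ww] := eqVneq w w2.
apply: con_trans cw _.
case/cellsP: C1 w1 w21 {sub n1} => [[u _ ->]|[a [b [eab ->]]]].
  by rewrite !inE => /eqP E /eqP E2; rewrite E E2 eqxx in ww.
rewrite !inE => /orP[]/eqP E /orP[]/eqP E2; subst; rewrite ?eqxx // in ww *.
  exact: con_edge.
by apply: con_edge; rewrite // edge_sym.
Qed.

Lemma con_cells v x w : x \in verts T -> x != v -> con v x w ->
  connect (cell_rel v) [set x] [set w].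
Proof.
have nset (a : V) : a != v -> [set a] != [set v].
  by move=> av; apply: contraNneq av => /set1_inj ->.
move=> xT xv /connectP[p pth ->]; elim: p x xT xv pth => [|b p IH] x xT xv /=.
  by move=> _; apply: connect0.
move=> /andP[/and3P[exb _ bv] pb]; have bT := edge_vertsR exb.
apply: connect_trans (IH b bT bv pb).
have ne : [set x; b] != [set v].
  by apply/eqP => E; have := cards2 x b; rewrite E cards1 (edge_neq exb).
apply: (@connect_trans _ _ [set x; b]); apply: connect1; rewrite /cell_rel /=
  !in_setD1 ne edge_cell // nset // vertex_cell ?xT ?bT /=.
  by rewrite finset.sub1set !inE eqxx.
by rewrite orbC finset.sub1set !inE eqxx orbT.
Qed.

(** Connected chains of cells correspond to walks; a cell that contains [v] is
reached through its other endpoint. *)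
Lemma in_branch v x c : x \in verts T -> x != v ->
  (c \in branch T v [set x]) =
  (c \in cells T) && [exists w in c, (w != v) && con v x w].
Proof.
move=> xT xv; rewrite inE in_setD1.
apply/andP/andP => [[/andP[cv cT] /connectP[p pth lp]]|[cT /exists_inP[w wc /andP[wv cw]]]].
  split=> //; apply/exists_inP; rewrite lp.
  have : exists2 w, w \in [set x] & (w != v) && con v x w.
    by exists x; rewrite ?inE ?xv ?con_refl.
  elim: p ([set x]) pth {lp} => //= c1 p IH c0 /andP[h pth] ex.
  by apply: IH pth _; apply: cell_step h ex.
have cv : c != [set v].
  by apply: contraNneq wv => E; move: wc; rewrite E inE.
split; first by rewrite cv.
apply: connect_trans (con_cells xT xv cw) _; apply: connect1.
rewrite /= !in_setD1 cv cT finset.sub1set wc vertex_cell.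
have -> : w \in verts T.
  case/cellsP: cT wc => [[u uT ->]|[a [b [eab ->]]]]; rewrite !inE.
    by move/eqP->.
  by case/orP => /eqP ->; [apply: edge_verts eab | apply: edge_vertsR eab].
have nw : [set w] != [set v] by apply: contraNneq wv => /set1_inj ->.
by rewrite nw.
Qed.

Lemma attachE v x : v \in verts T -> x \in verts T -> x != v ->
  attach T v x = sph_emb T v (nxt v x).
Proof.
move=> vT xT xv; have [ev cx] := nxtP vT xT xv.
have brE u : e v u -> ([set v; u] \in branch T v [set x]) = con v u x.
  move=> evu; rewrite in_branch // edge_cell //=.
  apply/exists_inP/idP => [[w]|cu].
    rewrite !inE => /orP[]/eqP -> /andP[]; first by rewrite eqxx.
    by rewrite con_sym.
  by exists u; rewrite ?inE ?eqxx ?orbT // con_sym cu eq_sym edge_neq.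
rewrite /attach; case: pickP => [u /andP[evu]|/(_ (nxt v x))].
  by rewrite brE // => cu; rewrite (nxt_eq evu cu).
by rewrite ev brE // cx.
Qed.

Lemma in_annulus_vertex v v' w : v \in verts T -> v' \in verts T -> v != v' ->
  ([set w] \in annulus T v v') =
  [&& w \in verts T, w != v, w != v', con v v' w & con v' v w].
Proof.
move=> vT vT' vv'; have v'v : v' != v by rewrite eq_sym.
rewrite inE !in_branch // vertex_cell.
have E (P : pred V) : [exists w0 in [set w], P w0] = P w.
  apply/exists_inP/idP => [[u]|Pw]; first by rewrite inE => /eqP ->.
  by exists w; rewrite ?inE.
rewrite !E; case: (w \in verts T); case: (w != v); case: (w != v');
  by rewrite /= ?andbF ?andbT.
Qed.

Lemma in_annulus_edge v v' a b : v \in verts T -> v' \in verts T -> v != v' ->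
  e a b -> ([set a; b] \in annulus T v v') =
  ((a != v) && con v v' a || (b != v) && con v v' b) &&
  ((a != v') && con v' v a || (b != v') && con v' v b).
Proof.
move=> vT vT' vv' eab; have v'v : v' != v by rewrite eq_sym.
rewrite inE !in_branch // edge_cell //=.
have E (P : pred V) : [exists w0 in [set a; b], P w0] = P a || P b.
  apply/exists_inP/orP => [[u]|[Pa|Pb]].
  - by rewrite !inE => /orP[]/eqP -> ?; [left|right].
  - by exists a; rewrite ?inE ?eqxx.
  - by exists b; rewrite ?inE ?eqxx ?orbT.
by rewrite !E.
Qed.

Lemma annulus_cells v v' c : c \in annulus T v v' -> c \in cells T.
Proof. by rewrite inE => /andP[+ _]; rewrite inE in_setD1 => /andP[/andP[_ ->]]. Qed.

Lemma attach_con v x y : v \in IV T -> x \in verts T -> y \in verts T ->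
  x != v -> y != v -> attach T v x = attach T v y <-> con v x y.
Proof.
move=> vI xT yT xv yv; have vT : v \in verts T by case/setDP: vI.
have [ex cx] := nxtP vT xT xv; have [ey cy] := nxtP vT yT yv.
rewrite !attachE // -(nxt_con vT xT yT xv yv); split=> [/(sph_emb_inj vI)->|/eqP -> //].
- exact: eqxx.
- exact: ex.
- exact: ey.
Qed.

Lemma IV_vert v : v \in IV T -> v \in verts T.
Proof. by case/setDP. Qed.

Lemma leaf_vert x : x \in X -> x \in verts T.
Proof. exact: (fintype.subsetP (leaf_verts T)). Qed.

Lemma leaf_neq v x : v \in IV T -> x \in X -> x != v.
Proof. by case/setDP => _ vX xX; apply: contraNneq vX => <-. Qed.

(** At least three directions leave [v], and each one leads to a leaf. *)
Lemma leaf_avoiding v (s1 s2 : sphere R) : v \in IV T ->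
  exists2 x, x \in X & attach T v x <> s1 /\ attach T v x <> s2.
Proof.
move=> vI; have vT := IV_vert vI; have := internal_valence vI.
pose B := [set u | e v u & (sph_emb T v u == s1) || (sph_emb T v u == s2)].
have cB : (#|B| <= 2)%N.
  have inj : {in B &, injective (sph_emb T v)}.
    by move=> a b; rewrite !inE => /andP[ea _] /andP[eb _]; apply: (sph_emb_inj vI).
  pose ss := [seq sph_emb T v a | a <- enum B].
  have u : uniq ss.
    by rewrite map_inj_in_uniq ?enum_uniq // => a b; rewrite !mem_enum; apply: inj.
  have sub : {subset ss <= [:: s1; s2]}.
    move=> z /mapP[a]; rewrite mem_enum !inE => /andP[_ /orP[]/eqP -> ->];
    by rewrite eqxx ?orbT.
  by have := uniq_leq_size u sub; rewrite size_map -cardE.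
move=> val; have /subsetPn[u] : ~~ ([set u | e v u] \subset B).
  by apply/negP => /subset_leq_card le; have := leq_trans val (leq_trans le cB).
rewrite !inE => evu; rewrite evu negb_or => /andP[/eqP n1 /eqP n2].
have [x xX cux] := branch_leaf evu; exists x => //.
have -> : attach T v x = sph_emb T v u.
  by rewrite attachE ?(nxt_eq evu cux) ?(leaf_vert xX) ?(leaf_neq vI xX).
by [].
Qed.

Fixpoint nobacktrack a p :=
  if p is b :: p' then (if p' is c :: _ then a != c else true) && nobacktrack b p'
  else true.

(** A walk that closes up without returning at once would be a cycle. *)
Lemma nobacktrack_uniq a p : path e a p -> nobacktrack a p -> uniq (a :: p).
Proof.
elim: p a => [//|b p IH] a /andP[eab pb] /andP[ab nb].
have ub := IH b pb nb; rewrite cons_uniq ub andbT inE negb_or edge_neq //=.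
case: p ab pb ub {IH nb} => [//|c p] ac /andP[ebc pc] /andP[nbp _].
apply/negP => ain; have cca := path_con pc nbp ain.
have eba : e b a by rewrite edge_sym.
by rewrite -(con_edge_uniq ebc eba cca) eqxx in ac.
Qed.

Lemma path_separates v v' w : tree_path T v v' w -> w != v -> w != v' ->
  ~~ con w v v'.
Proof.
move=> [p [pv up lp]]; rewrite inE => /predU1P[->|wp]; first by rewrite eqxx.
case/splitPr: wp pv up lp => p1 p2; rewrite cat_path last_cat.
move=> /and3P[p1v ew pw] up lp wv wv'.
have nw : w \notin v :: p1.
  move: up; rewrite -cat_cons cat_uniq => /and3P[_ /hasPn/(_ w) + _].
  by rewrite inE eqxx => /(_ isT).
case: p2 pw up lp => [_ _ /= E|b p2 /andP[ewb pb] up lp]; first by rewrite E eqxx in wv'.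
have nwb : w \notin b :: p2.
  by move: up; rewrite -cat_cons cat_uniq => /and3P[_ _ /andP[]].
have c1 : con w v (last v p1) by apply: path_con p1v nw (mem_last _ _).
have c2 : con w b v' by rewrite -lp; apply: path_con pb nwb (mem_last _ _).
apply/negP => cvv'; have cb : con w (last v p1) b.
  rewrite con_sym in c1; apply: con_trans c1 _; apply: con_trans cvv' _.
  by rewrite con_sym.
have ewl : e w (last v p1) by rewrite edge_sym.
have E := con_edge_uniq ewl ewb cb.
move: up; rewrite -cat_cons cat_uniq => /and3P[_ /hasPn/(_ b) + _].
by rewrite !inE eqxx orbT -E => /(_ isT); rewrite -in_cons mem_last.
Qed.

(** The vertices of the path from [v] to [v'] are its ends and the vertices that
separate them. *)
Definition between v v' w := [|| w == v, w == v' | ~~ con w v v'].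

Lemma between_sym v v' w : between v v' w = between v' v w.
Proof. by rewrite /between orbCA con_sym. Qed.

Lemma path_between v v' w : tree_path T v v' w -> between v v' w.
Proof.
move=> pw; rewrite /between; have [//|wv] := eqVneq w v.
by have [//|wv'] := eqVneq w v'; rewrite (path_separates pw).
Qed.

Lemma tree_path_ends v v' : v \in verts T -> v' \in verts T ->
  tree_path T v v' v /\ tree_path T v v' v'.
Proof.
move=> vT v'T; have [p [pv lp up]] := tree_uniq_path vT v'T.
split; exists p; split=> //; first by rewrite inE eqxx.
by rewrite -lp mem_last.
Qed.

(** For [w] and [w'] on a path that starts at [v]: the path meets [w] before
[w']. *)
Definition behind v w w' := (v == w) || ~~ con w v w'.

Lemma between_order v v' w w' : v \in verts T -> v' \in verts T ->
  w \in verts T -> w' \in verts T -> v != v' -> w != w' ->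
  between v v' w -> between v v' w' ->
  behind v w w' && behind v' w' w || behind v w' w && behind v' w w'.
Proof.
move=> vT v'T wT w'T vv' ww'; rewrite /between => bw bw'.
have w'w : w' != w by rewrite eq_sym.
have [E|wv] := eqVneq w v.
  subst w; rewrite /behind eqxx /= con_sym.
  by case/or3P: bw' => [E|/eqP ->|->]; rewrite ?eqxx ?orbT // E in w'w *.
have [E|wv'] := eqVneq w v'.
  subst w; rewrite {3 4}/behind eqxx /= andbT.
  case/or3P: bw' => [/eqP ->|E|nc]; rewrite /behind ?eqxx ?orbT //.
    by rewrite E in w'w.
  by rewrite nc !orbT.
rewrite (negbTE wv) (negbTE wv') /= in bw.
have bw2 : ~~ con w v' v by rewrite con_sym.
case/or3P: bw' => [/eqP E|/eqP E|nc'].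
- by subst w'; rewrite /behind eqxx bw2 !orbT.
- by subst w'; rewrite /behind eqxx bw !orbT.
have step u a b y : ~~ con u a b -> con u a y -> ~~ con u b y.
  by move=> nc ca; apply: contraNN nc => cb; apply: con_trans ca _; rewrite con_sym.
have [c1|c1] := boolP (con w v w').
  have n1 := step _ _ _ _ bw c1.
  suff n2 : ~~ con w' v w by rewrite /behind n1 n2 !orbT.
  apply/negP => c2; have n3 := step _ _ _ _ nc' c2.
  by have := con_other v'T wT ww'; rewrite (negbTE n1) (negbTE n3).
have c2 : con w' v w by have := con_other vT wT ww'; rewrite (negbTE c1).
by rewrite /behind c1 (step _ _ _ _ nc' c2) !orbT.
Qed.

(** What lies beyond [v] lies beyond [w]; and if [w] is not [v], all of it is on
the same side of [w], namely the side of [v]. *)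
Lemma behind_leaf v v' w w' s : v \in verts T -> v' \in verts T ->
  w \in verts T -> w' \in verts T -> s \in verts T -> v != v' -> w != w' ->
  between v v' w -> between v v' w' -> behind v w w' ->
  ~~ con v s v' -> ~~ con w s w' /\ (v != w -> con w s v).
Proof.
move=> vT v'T wT w'T sT vv' ww' bw bw' b ns.
have [E|vw] := eqVneq v w.
  subst w; split=> //; apply: contraNN ns => c; apply: con_trans c _.
  case/or3P: bw' => [/eqP E|/eqP ->|nc]; [by rewrite E eqxx in ww'|exact: con_refl|].
  have w'v : w' != v by rewrite eq_sym.
  by have := con_other v'T w'T w'v; rewrite con_sym (negbTE nc) /= con_sym.
move: b; rewrite /behind (negbTE vw) /= => nb.
have cs : con w s v.
  have := con_other sT vT vw; rewrite orbC => /orP[//|c].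
  case/negP: ns; apply: con_trans c _.
  case/or3P: bw => [E|/eqP ->|nc]; [by rewrite eq_sym E in vw|exact: con_refl|].
  have := con_other v'T vT vw; rewrite orbC con_sym (negbTE nc) /=.
  by rewrite con_sym.
split=> //; apply: contraNN nb => c; apply: con_trans c.
by rewrite con_sym.
Qed.

End TreeWalks.

(** * A cover on an annulus without critical leaf *)
Section CoverCombinatorics.
Local Close Scope ring_scope.
Variables (R : realType) (V : finType) (Y Z : {set V}).
Variables (TY : sphere_tree R Y) (TZ : sphere_tree R Z) (F : Defs.cover TY TZ).
Implicit Types (a b u v w x y : V) (p : seq V).
Local Notation F' := (cov_map F).
Local Notation f := (cov_sph F).
Local Notation eY := (edge TY).
Local Notation conY := (con TY).

Lemma unmarked_ldeg v s : v \in IV TY -> ~ marked TY v s -> ldeg (f v) s = 1%N.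
Proof.
move=> vI ns; apply: (covering_unramified (cov_covering F vI)) => //.
exact: cov_nonconst.
Qed.

Lemma unmarked_image v s : v \in IV TY -> ~ marked TY v s ->
  ~ marked TZ (F' v) (f v s).
Proof. by move=> vI ns; have [h _] := cov_covering F vI; apply: h. Qed.

Lemma set2_inj a b c d : [set a; b] = [set c; d] :> {set V} ->
  a = c /\ b = d \/ a = d /\ b = c.
Proof.
move=> E; have := set21 a b; rewrite E !inE => /orP[]/eqP ac.
  subst c; left; split=> //.
  have := set22 a b; rewrite E !inE => /orP[]/eqP // ba.
  by have := set22 a d; rewrite -E !inE ba orbb => /eqP.
subst d; right; split=> //.
have := set22 a b; rewrite E !inE => /orP[]/eqP // ba.
by have := set21 c a; rewrite -E !inE ba orbb => /eqP.
Qed.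

Lemma edge_degreeE a b : eY a b -> a \in IV TY ->
  edge_degree F [set a; b] = ldeg (f a) (sph_emb TY a b).
Proof.
move=> eab aI; rewrite /edge_degree.
case: pickP => [[c d] /= /and3P[cI ecd /eqP E]|/(_ (a, b))].
  case: (set2_inj E) => -[? ?]; subst => //.
  by apply: cov_edge_deg.
by rewrite /= aI eab eqxx.
Qed.

Lemma leaf_degreeE y u : y \in Y -> eY y u -> leaf_degree F y = edge_degree F [set y; u].
Proof.
move=> yY eyu; have := leafP (leaf_vert TY yY); rewrite yY => /esym/cards1P[z zE].
have uz : u = z by apply/set1P; rewrite -zE inE.
rewrite /leaf_degree; case: pickP => [u' eyu'|/(_ u)]; last by rewrite eyu.
by have -> : u' = u by rewrite uz; apply/set1P; rewrite -zE inE.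
Qed.

Lemma vertex_IV x : x \in verts TY -> x \notin Y -> x \in IV TY.
Proof. by move=> xT xY; rewrite inE xY xT. Qed.

Lemma two_neighbours_IV x a b : eY x a -> eY x b -> a != b -> x \in IV TY.
Proof.
move=> ea eb ab; have xT := edge_verts ea.
apply: vertex_IV => //; apply/negP => xY.
have := leafP xT; rewrite xY => /esym/cards1P[z zE].
have az : a = z by apply/set1P; rewrite -zE inE.
have bz : b = z by apply/set1P; rewrite -zE inE.
by rewrite az bz eqxx in ab.
Qed.

Lemma side_incl v u x : eY v u -> eY u x -> x != v -> forall w, conY u x w ->
  conY v u w.
Proof.
move=> evu eux xv w cxw.
have xu : x != u by rewrite eq_sym (edge_neq eux).
have [p [px lp up np]] := con_path cxw xu.
have nv : v \notin x :: p.
  apply/negP => vp; have cxv : conY u x v by apply: path_con px np vp.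
  have euv : eY u v by rewrite edge_sym.
  by rewrite (con_edge_uniq eux euv cxv) eqxx in xv.
have uv : u != v by rewrite eq_sym (edge_neq evu).
apply: con_trans (con_edge eux uv xv) _.
by rewrite -lp; apply: path_con px nv (mem_last _ _).
Qed.

(** By induction on the branch, the critical points of [f u] can only be at the
edge that leads back to [v]; a single point cannot carry all the ramification
unless the degree is one. *)
Lemma noncritical_branch v u : v \in IV TY -> eY v u ->
  (forall y, y \in Y -> conY v u y -> ~ (2 <= leaf_degree F y)%N) ->
  ldeg (f v) (sph_emb TY v u) = 1%N.
Proof.
move: {2}(#|[set w | conY v u w]|) (leqnn #|[set w | conY v u w]|) => n.
elim: n v u => [|n IH] v u le vI evu nc.
  by move: le; rewrite leqn0 cards_eq0 => /eqP/setP/(_ u); rewrite !inE con_refl.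
have uT := edge_vertsR evu; have d0 := cov_nonconst F vI.
have euv : eY u v by rewrite edge_sym.
have [uY|uY] := boolP (u \in Y).
  have := nc u uY (con_refl _ _ _); rewrite (leaf_degreeE uY euv) finset.setUC edge_degreeE //.
  have : (0 < ldeg (f v) (sph_emb TY v u))%N.
    exact: (ldeg_gt0 (polys_coprime (f v)) (sph_emb TY v u) d0).
  by case: (ldeg _ _) => [|[]].
have uI := vertex_IV uT uY; have du := cov_nonconst F uI.
rewrite (cov_edge_deg F vI uI evu).
have [] := @two_critical_points _ (polys (f u)) (polys_coprime (f u))
  (sph_emb TY u v) (sph_emb TY u v) du; last first.
  by move=> l1 /(_ erefl) D1; rewrite ldeg_polys l1 D1.
move=> r; rewrite -ldeg_polys => r2; left.
have [[x eux rE]|nm] := pselect (marked TY u r); last first.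
  by move: r2; rewrite (unmarked_ldeg uI nm).
have [<- //|xv] := eqVneq x v.
have sub := side_incl evu eux xv.
suff l1 : ldeg (f u) r = 1%N by rewrite l1 in r2.
rewrite rE; apply: IH => // [|y yY cy]; last by apply: nc => //; apply: sub.
rewrite -ltnS (leq_trans _ le) // proper_card //; apply/properP; split.
  by apply/fintype.subsetP => w; rewrite !inE; apply: sub.
exists u; rewrite !inE ?con_refl //; apply/negP => cxu.
have xu : x != u by rewrite eq_sym (edge_neq eux).
have [p [px lp up np]] := con_path cxu xu.
by rewrite -lp mem_last in np.
Qed.

Section Annulus.
Variables v v' : V.
Hypotheses (vI : v \in IV TY) (v'I : v' \in IV TY) (vv' : v != v').
Local Notation A := (annulus TY v v').
Hypothesis ncl : no_critical_leaf F A.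

Let vT := IV_vert vI.
Let v'T := IV_vert v'I.
Let inA u := [&& u \in verts TY, u != v, u != v', conY v v' u & conY v' v u].

Lemma annulusE u : ([set u] \in A) = inA u.
Proof. exact: in_annulus_vertex. Qed.

(** The branches at [u] other than those of [v] and [v'] are in the annulus, so they
carry no ramification: the two points left are totally ramified. *)
Lemma annulus_critical u : u \in IV TY -> inA u ->
  ldeg (f u) (sph_emb TY u (nxt TY u v)) = rdeg (f u) /\
  (nxt TY u v = nxt TY u v' -> rdeg (f u) = 1%N).
Proof.
move=> uI /and5P[uT uv uv' cu cu']; have du := cov_nonconst F uI.
have vu : v != u by rewrite eq_sym.
have v'u : v' != u by rewrite eq_sym.
have [ev cv] := nxtP uT vT vu; have [ev' cv'] := nxtP uT v'T v'u.
have [] := @two_critical_points _ (polys (f u)) (polys_coprime (f u))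
  (sph_emb TY u (nxt TY u v)) (sph_emb TY u (nxt TY u v')) du; last first.
  by move=> h1 h2; split=> // E; apply: h2; rewrite E.
move=> r; rewrite -ldeg_polys => r2.
have [[x eux rE]|nm] := pselect (marked TY u r); last first.
  by move: r2; rewrite (unmarked_ldeg uI nm).
have [xv|xv] := eqVneq x (nxt TY u v); first by left; rewrite rE xv.
have [xv'|xv'] := eqVneq x (nxt TY u v'); first by right; rewrite rE xv'.
suff l1 : ldeg (f u) r = 1%N by rewrite l1 in r2.
rewrite rE; apply: noncritical_branch => // y yY cy; apply: ncl => //.
have yT := leaf_vert TY yY.
have far a : a \in verts TY -> a != u -> x != nxt TY u a -> ~~ conY u y a.
  move=> aT au xa; apply: contraNN xa => cya; apply/eqP/esym/nxt_eq => //.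
  exact: con_trans cy cya.
rewrite annulusE /inA yT (leaf_neq vI) // (leaf_neq v'I) //=.
have := con_other yT uT uv; rewrite (negbTE (far _ vT vu xv)) /= => c1.
have := con_other yT uT uv'; rewrite (negbTE (far _ v'T v'u xv')) /= => c2.
apply/andP; split; first by apply: con_trans cu _; rewrite con_sym.
by apply: con_trans cu' _; rewrite con_sym.
Qed.

(** At a totally ramified point the fibre is a single point. *)
Lemma annulus_no_fold u c : inA u -> eY u c -> c != nxt TY u v ->
  F' (nxt TY u v) != F' c.
Proof.
move=> uA euc cn; have /and5P[uT uv uv' _ _] := uA.
have vu : v != u by rewrite eq_sym.
have [ev cv] := nxtP uT vT vu.
have uI : u \in IV TY by apply: two_neighbours_IV ev euc _; rewrite eq_sym.
have du := cov_nonconst F uI.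
have [l1 _] := annulus_critical uI uA.
apply/eqP => E.
have neq : sph_emb TY u (nxt TY u v) != sph_emb TY u c.
  by apply: contraNneq cn => /(sph_emb_inj uI) -> //; apply/eqP.
have eqf : f u (sph_emb TY u (nxt TY u v)) = f u (sph_emb TY u c).
  by rewrite !cov_attach // E.
have h1 : (ldeg (f u) (sph_emb TY u (nxt TY u v)) + ldeg (f u) (sph_emb TY u c)
    <= rdeg (f u))%N.
  exact: (@ldeg_add _ _ (polys_coprime (f u)) _ _ du neq eqf).
have h2 : (0 < ldeg (f u) (sph_emb TY u c))%N.
  exact: (ldeg_gt0 (polys_coprime (f u)) (sph_emb TY u c) du).
by move: h1; rewrite l1 -{2}[rdeg _]addn0 leq_add2l leqNgt h2.
Qed.

Lemma nobacktrack_map a p :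
  (forall p1 b c p2, p = p1 ++ b :: c :: p2 -> F' (last a p1) != F' c) ->
  nobacktrack (F' a) [seq F' b | b <- p].
Proof.
elim: p a => [//|b p IH] a h /=; apply/andP; split.
  by case: p h {IH} => [//|c p] h /=; apply: (h [::] b c p).
by apply: IH => p1 b' c p2 E; apply: (h (b :: p1) b' c p2); rewrite E.
Qed.

Lemma path_map a p : path eY a p -> path (edge TZ) (F' a) [seq F' b | b <- p].
Proof.
by elim: p a => //= b p IH a /andP[eab pb]; rewrite (cov_edge F) //= IH.
Qed.

(** The image of a simple path across the annulus does not backtrack, hence is
simple. *)
Lemma annulus_path u : u = v' \/ inA u ->
  exists p, [/\ path eY v p, last v p = u, uniq (v :: p)
    & uniq [seq F' b | b <- v :: p]].
Proof.
move=> uA.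
have uT : u \in verts TY by case: uA => [->|/and5P[]].
have cu : conY v v' u by case: uA => [->|/and5P[]//]; apply: con_refl.
have [p [pv lp up]] := tree_uniq_path vT uT; exists p; split=> //.
rewrite map_cons; apply: nobacktrack_uniq (path_map pv) _.
apply: nobacktrack_map => p1 b c p2 pE.
have up' : uniq ((v :: p1) ++ b :: c :: p2) by rewrite cat_cons -pE.
have : path eY v (p1 ++ b :: c :: p2) by rewrite -pE.
rewrite cat_path /= => /and4P[pp1 eab ebc pc].
have ebl : eY b (last v p1) by rewrite edge_sym.
have nb : b \notin v :: p1.
  by move: up'; rewrite cat_uniq => /and3P[_ /hasPn/(_ b) + _]; rewrite inE eqxx; apply.
have bv : b != v by move: nb; rewrite inE negb_or => /andP[].
have nvb : v \notin b :: c :: p2.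
  move: up'; rewrite cat_uniq => /and3P[_ /hasPn h _].
  by apply/negP => vin; have := h _ vin; rewrite /= inE eqxx.
have cbl : conY b (last v p1) v.
  by rewrite con_sym; apply: path_con pp1 nb (mem_last _ _).
have -> : last v p1 = nxt TY b v by apply/esym/nxt_eq.
have cbu : conY v b u.
  have ul : u = last b (c :: p2) by rewrite -lp pE last_cat.
  by rewrite ul; apply: path_con nvb (mem_last _ _); rewrite /= ebc.
have nv' : v' \notin v :: rcons p1 b.
  apply/negP => v'in.
  have v'p : v' \in v :: p.
    move: v'in; rewrite pE -cat_rcons -!cat_cons mem_cat => ->; done.
  have [E|uv'] := eqVneq u v'.
    move: up'; rewrite cat_cons -cat_rcons -cat_cons cat_uniq => /and3P[_ /hasPn/(_ v')].
    have v'c : v' \in c :: p2 by rewrite -E -lp pE last_cat /= mem_last.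
    by move=> /(_ v'c) /=; rewrite v'in.
  case: uA => [E|/and5P[_ _ _ _ cvu]]; first by rewrite E eqxx in uv'.
  have pth : tree_path TY v u v' by exists p.
  have := path_separates pth; rewrite [v' == v]eq_sym vv' [v' == u]eq_sym uv'.
  by move=> /(_ isT isT); rewrite cvu.
apply: annulus_no_fold => //.
  rewrite /inA bv (edge_verts ebc) /=; apply/and3P; split.
  - by apply: contraNneq nv' => <-; rewrite inE mem_rcons inE eqxx orbT.
  - by apply: con_trans cu _; rewrite con_sym.
  - apply: (path_con (p := rcons p1 b)); rewrite ?rcons_path ?pp1 //.
    by rewrite inE mem_rcons inE eqxx orbT.
have -> : nxt TY b v = last v p1 by apply: nxt_eq.
apply: contraTneq up' => cE; rewrite cat_uniq; apply/negP => /and3P[_ /hasPn/(_ c) + _].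
by rewrite !inE eqxx orbT => /(_ isT); rewrite cE -in_cons mem_last.
Qed.

Lemma annulus_image u : u = v' \/ inA u ->
  F' u != F' v /\ con TZ (F' v) (F' (nxt TY v v')) (F' u).
Proof.
move=> uA; have [[|b p] [pv lp up uF]] := annulus_path uA.
  case: uA lp => [-> /= E|/and5P[_ uv _ _ _] /= E].
    by move: vv'; rewrite {1}E eqxx.
  by move: uv; rewrite -E eqxx.
move: pv => /= /andP[evb pb].
have cu : conY v v' u by case: uA => [->|/and5P[]//]; apply: con_refl.
have nvb : v \notin b :: p by move: up => /= /andP[].
have bE : nxt TY v v' = b.
  apply: nxt_eq => //; rewrite con_sym in cu; apply: con_trans cu.
  by rewrite -lp; apply: path_con pb nvb (mem_last _ _).
have pF := path_map pb; rewrite bE.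
move: uF; rewrite /= => /andP[nF _].
have cF : con TZ (F' v) (F' b) (F' u).
  by rewrite -lp -[last v _]/(last b p) -(last_map F' p b); apply: path_con pF nF (mem_last _ _).
split=> //; apply: contraNneq nF => <-.
by rewrite -lp -[last v _]/(last b p) -(last_map F' p b) mem_last.
Qed.

Lemma annulus_ends : F' v' != F' v. 
Proof. by have [] := annulus_image (or_introl erefl). Qed.

Lemma image_nxt : nxt TZ (F' v) (F' v') = F' (nxt TY v v').
Proof.
have [_ c] := annulus_image (or_introl erefl).
have v'v : v' != v by rewrite eq_sym.
have [ev _] := nxtP vT v'T v'v.
by apply: nxt_eq => //; apply: cov_edge.
Qed.

Lemma annulus_fixes_ends :
  f v (attach TY v v') = attach TZ (F' v) (F' v').
Proof.
have v'v : v' != v by rewrite eq_sym.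
have [ev _] := nxtP vT v'T v'v.
have Fv := IV_vert (cov_internal F vI); have Fv' := IV_vert (cov_internal F v'I).
by rewrite !attachE ?annulus_ends // cov_attach // image_nxt.
Qed.

Lemma annulus_leaf_con u : inA u -> con TZ (F' v) (F' u) (F' v').
Proof.
move=> uA; have [_ c] := annulus_image (or_intror uA).
have [_ c'] := annulus_image (or_introl erefl).
by rewrite con_sym in c; apply: con_trans c c'.
Qed.

End Annulus.

Section AnnulusDegree.
Variables v v' : V.
Hypotheses (vI : v \in IV TY) (v'I : v' \in IV TY) (vv' : v != v').
Local Notation A := (annulus TY v v').
Hypothesis ncl : no_critical_leaf F A.

Let vT := IV_vert vI.
Let v'T := IV_vert v'I.
Let inA u := [&& u \in verts TY, u != v, u != v', conY v v' u & conY v' v u].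

Let inAE u : ([set u] \in A) = inA u.
Proof. exact: in_annulus_vertex. Qed.

Lemma annulus_image2 u : inA u -> F' u != F' v /\ F' u != F' v'.
Proof.
move=> uA; split.
  by have [] := annulus_image vI v'I vv' ncl (or_intror uA).
have ncl' : no_critical_leaf F (annulus TY v' v) by rewrite /annulus finset.setIC.
have v'v : v' != v by rewrite eq_sym.
have uA' : [&& u \in verts TY, u != v', u != v, conY v' v u & conY v v' u].
  by case/and5P: uA => -> -> -> -> ->.
by have [] := annulus_image v'I vI v'v ncl' (or_intror uA').
Qed.

Lemma cell_degree_vertex u : cell_degree F [set u] = vertex_degree F u.
Proof.
rewrite /cell_degree; case: pickP => [w /eqP/set1_inj -> //|/(_ u)].
by rewrite eqxx.
Qed.

Lemma cell_degree_edge a b : a != b ->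
  cell_degree F [set a; b] = edge_degree F [set a; b].
Proof.
move=> ab; rewrite /cell_degree; case: pickP => [w /eqP E|//].
by have := cards2 a b; rewrite E cards1 ab.
Qed.

Lemma cell_map1 u : cell_map F [set u] = [set F' u].
Proof. by rewrite /cell_map imset_set1. Qed.

Lemma cell_map2 a b : cell_map F [set a; b] = [set F' a; F' b].
Proof. by rewrite /cell_map imsetU !imset_set1. Qed.

Lemma edge_endpoint a b : eY a b -> [set a; b] \in A -> a != v -> a != v' -> inA a.
Proof.
move=> eab; rewrite in_annulus_edge // => /andP[h h'] av av'.
rewrite /inA (edge_verts eab) av av' /=; apply/andP; split.
  case/orP: h => /andP[bv cb] //; apply: con_trans cb _.
  by apply: con_edge; rewrite // edge_sym.
case/orP: h' => /andP[bv cb] //; apply: con_trans cb _.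
by apply: con_edge; rewrite // edge_sym.
Qed.

Lemma annulus_edge u b : inA u -> eY u b -> [set u; b] \in A.
Proof.
move=> /and5P[uT uv uv' cu cu'] eub.
by rewrite in_annulus_edge // uv cu uv' cu'.
Qed.

(** The fibre sum of [degree_on], above an arbitrary cell. *)
Definition fibre_degree (c : {set V}) :=
  (\sum_(a in A | cell_map F a == c) cell_degree F a)%N.

Lemma fibre_degree_vertex x : fibre_degree [set x] =
  (\sum_(a | inA a && (F' a == x)) vertex_degree F a)%N.
Proof.
rewrite /fibre_degree.
pose B := [set a | inA a & F' a == x].
rewrite (eq_bigl (mem [set [set a] | a in B])) => [|c].
  rewrite big_imset /= => [|a b _ _ /set1_inj //].
  by apply: eq_big => [a|a _]; rewrite ?inE // cell_degree_vertex.
apply/andP/imsetP => [[cA cE]|[a aB ->]].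
  have cT := annulus_cells cA; case/cellsP: cT cA cE => [[w _ ->]|[a [b [eab ->]]]] cA.
    rewrite cell_map1 => /eqP/set1_inj E.
    by exists w; rewrite // inE E eqxx andbT -inAE.
  rewrite cell_map2 => /eqP E; have := cards2 (F' a) (F' b).
  by rewrite E cards1 (edge_neq (cov_edge F eab)).
move: aB; rewrite inE => /andP[aA /eqP <-].
by rewrite cell_map1 eqxx inAE.
Qed.

Lemma fibre_degree_edge x y : x != y -> x != F' v -> x != F' v' ->
  fibre_degree [set x; y] =
  (\sum_(a | inA a && (F' a == x))
     \sum_(b | eY a b && (F' b == y)) edge_degree F [set a; b])%N.
Proof.
move=> xy xv xv'; rewrite /fibre_degree pair_big_dep /=.
pose B := [set q : V * V | [&& inA q.1, F' q.1 == x, eY q.1 q.2 & F' q.2 == y]].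
rewrite (eq_bigl (mem [set [set q.1; q.2] | q : V * V in B])) => [|c].
  rewrite big_imset /= => [|[a b] [a' b']]; last first.
    rewrite !inE /= => /and4P[_ /eqP ax _ /eqP yb] /and4P[_ /eqP ax' _ /eqP yb'].
    case/set2_inj=> -[E1 E2]; first by rewrite E1 E2.
    by move: xy; rewrite -ax E1 yb' eqxx.
  apply: eq_big => [[a b]|[a b]]; first by rewrite inE /= -!andbA.
  by rewrite !inE /= => /and4P[_ _ eab _]; rewrite cell_degree_edge // (edge_neq eab).
have key a b : eY a b -> [set a; b] \in A -> F' a = x -> F' b = y ->
    exists2 q, q \in B & [set a; b] = [set q.1; q.2].
  move=> eab abA ax yb; exists (a, b) => //; rewrite inE /= ax yb eab !eqxx !andbT.
  by apply: (edge_endpoint eab abA); [apply: contraNneq xv => <-|apply: contraNneq xv' => <-];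
    rewrite ax.
apply/andP/imsetP => [[cA cE]|[[a b]]].
  have cT := annulus_cells cA; case/cellsP: cT cA cE => [[w _ ->]|[a [b [eab ->]]]] cA.
    rewrite cell_map1 => /eqP E; have := cards2 x y.
    by rewrite -E cards1 xy.
  rewrite cell_map2 => /eqP/set2_inj[[ax yb]|[ay bx]]; first exact: key.
  rewrite finset.setUC; apply: key => //; first by rewrite edge_sym.
  by rewrite finset.setUC.
rewrite inE /= => /and4P[aA /eqP <- eab /eqP <-] ->.
by rewrite cell_map2 eqxx annulus_edge.
Qed.

(** At an internal vertex this is the count of the preimages of the point
attached to the edge towards [y]; a leaf has a single edge. *)
Lemma vertex_degree_sum a y : a \in verts TY -> edge TZ (F' a) y ->
  (\sum_(b | eY a b && (F' b == y)) edge_degree F [set a; b])%N = vertex_degree F a.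
Proof.
move=> aT exy; rewrite /vertex_degree; have [aY|aY] := boolP (a \in Y).
  have := leafP aT; rewrite aY => /esym/cards1P[u uE].
  have eau : eY a u by have := set11 u; rewrite -uE inE.
  have FZ := cov_leaf F aY.
  have := leafP (leaf_vert TZ FZ); rewrite FZ => /esym/cards1P[w wE].
  have Fu : F' u = y.
    have : F' u \in [set w] by rewrite -wE inE; apply: cov_edge.
    have : y \in [set w] by rewrite -wE inE.
    by rewrite !inE => /eqP -> /eqP ->.
  rewrite (leaf_degreeE aY eau) (big_pred1 u) // => b /=.
  apply/andP/eqP => [[eab _]|->]; last by rewrite eau Fu.
  by apply/set1P; rewrite -uE inE.
have aI := vertex_IV aT aY; have FI := cov_internal F aI.
rewrite (eq_bigr (fun b => ldeg (f a) (sph_emb TY a b))) => [|b /andP[eab _]]; last first.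
  exact: edge_degreeE.
apply: (@fibre_sum _ (polys (f a)) (polys_coprime (f a)) V
  [pred b | eY a b && (F' b == y)] (sph_emb TY a) (sph_emb TZ (F' a) y)).
- exact: cov_nonconst.
- by move=> b b'; rewrite !inE => /andP[eb _] /andP[eb' _]; apply: (sph_emb_inj aI).
- move=> b; rewrite inE => /andP[eb /eqP <-]; exact: (cov_attach F aI eb).
move=> s fs.
have [[b eb sE]|nm] := pselect (marked TY a s); last first.
  case: (unmarked_image aI nm); exists y => //.
exists b => //; rewrite inE eb /=; apply/eqP.
apply: (sph_emb_inj FI) => //; first exact: cov_edge.
by rewrite -(cov_attach F aI eb) -sE.
Qed.

(** Each vertex of the fibre over [F' u] spreads its degree over its edges above
[F' b]. *)
Lemma fibre_degree_local u b : inA u -> eY u b ->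
  fibre_degree [set F' u] = fibre_degree [set F' u; F' b].
Proof.
move=> uA eub; have exy := cov_edge F eub; have [n1 n2] := annulus_image2 uA.
rewrite fibre_degree_vertex fibre_degree_edge ?(edge_neq exy) //.
apply: eq_bigr => a /andP[aA /eqP ax]; rewrite vertex_degree_sum //.
  by case/and5P: aA.
by rewrite ax.
Qed.

(** Above the edge of the image that leaves [F' v] there is only the edge that
leaves [v], as a vertex inside the annulus cannot be mapped to an end. *)
Lemma fibre_degree_base :
  fibre_degree [set F' v; F' (nxt TY v v')] = ldeg (f v) (attach TY v v').
Proof.
have v'v : v' != v by rewrite eq_sym.
have [ev cv] := nxtP vT v'T v'v; set u := nxt TY v v' in ev cv *.
have uv : u != v by rewrite eq_sym (edge_neq ev).
have Fvv : F' v' != F' v by exact: (annulus_ends vI v'I vv' ncl).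
have key a b : eY a b -> [set a; b] \in A -> F' a = F' v -> [set a; b] = [set v; u].
  move=> eab abA aE.
  have av' : a != v' by apply: contraNneq Fvv => <-; rewrite aE.
  have [av|av] := eqVneq a v; last first.
    by have [] := annulus_image2 (edge_endpoint eab abA av av'); rewrite aE eqxx.
  subst a; move: abA; rewrite in_annulus_edge // eqxx /= => /andP[/andP[bv cb] _].
  by rewrite /u (nxt_eq eab) // con_sym.
rewrite /fibre_degree (big_pred1 [set v; u]) => [|c /=].
  by rewrite cell_degree_edge ?(edge_neq ev) // edge_degreeE // attachE.
apply/andP/eqP => [[cA cE]|->]; last first.
  rewrite cell_map2 in_annulus_edge // eqxx uv vv' con_refl /= ?andbT.
  by rewrite con_sym cv.
have cT := annulus_cells cA; case/cellsP: cT cA cE => [[w _ ->]|[a [b [eab ->]]]] cA.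
  rewrite cell_map1 => /eqP E; have := cards2 (F' v) (F' u).
  by rewrite -E cards1 (edge_neq (cov_edge F ev)).
rewrite cell_map2 => /eqP/set2_inj[[av bu]|[au bv]]; first exact: key.
rewrite finset.setUC; apply: key => //; first by rewrite edge_sym.
by rewrite finset.setUC.
Qed.

(** Walk from [u] to [v], alternating vertices and edges. *)
Lemma fibre_degree_inA u : inA u ->
  fibre_degree [set F' u] = ldeg (f v) (attach TY v v').
Proof.
move=> uA; have uT : u \in verts TY by case/and5P: uA.
have [p] := tree_uniq_path uT vT; elim: p u uA {uT} => [|w p IH] u uA [pth lp up].
  by case/and5P: uA; rewrite -lp eqxx.
move: (uA) => /and5P[uT uv uv' cu cu'].
move: (pth) => /= /andP[euw pw].
rewrite (fibre_degree_local uA euw).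
have [wv|wv] := eqVneq w v.
  have evu : eY v u by rewrite edge_sym -wv.
  have -> : u = nxt TY v v' by apply/esym/nxt_eq => //; rewrite con_sym.
  by rewrite wv finset.setUC fibre_degree_base.
have wv' : w != v'.
  apply: contraTneq cu' => E; rewrite con_sym; apply: (@path_separates _ _ _ TY u v v').
  - by exists (w :: p); split=> //; rewrite E !inE eqxx orbT.
  - by rewrite eq_sym.
  - by rewrite eq_sym.
have wA : inA w.
  rewrite /inA (edge_vertsR euw) wv wv' /=; apply/andP; split.
    by apply: con_trans cu _; apply: con_edge.
  by apply: con_trans cu' _; apply: con_edge.
rewrite finset.setUC -(fibre_degree_local wA); last by rewrite edge_sym.
by apply: IH => //; split=> //; move: up => /= /andP[].
Qed.

Lemma degree_on_annulus : degree_on F A (ldeg (f v) (attach TY v v')).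
Proof.
move=> b /imsetP[c cA ->]; rewrite -/(fibre_degree _).
have cT := annulus_cells cA; case/cellsP: cT cA => [[w _ ->]|[a [b' [eab ->]]]] cA.
  by rewrite cell_map1 fibre_degree_inA // -inAE.
rewrite cell_map2.
have half x y : eY x y -> [set x; y] \in A -> x != v -> x != v' ->
    fibre_degree [set F' x; F' y] = ldeg (f v) (attach TY v v').
  move=> exy xyA xv xv'; have xA := edge_endpoint exy xyA xv xv'.
  by rewrite -(fibre_degree_local xA exy) fibre_degree_inA.
have eba : eY b' a by rewrite edge_sym.
have cA' : [set b'; a] \in A by rewrite finset.setUC.
have [aE|av] := eqVneq a v; last first.
  have [aE'|av'] := eqVneq a v'; last exact: half.
  have [bE|bv] := eqVneq b' v; last first.
    rewrite finset.setUC; apply: half => //.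
    by apply: contraTneq eab => ->; rewrite aE' edge_irr.
  subst a b'; rewrite finset.setUC -fibre_degree_base nxt_edge //.
have [bE|bv'] := eqVneq b' v'; last first.
  rewrite finset.setUC; apply: half => //.
  by apply: contraTneq eab => ->; rewrite aE edge_irr.
by subst a b'; rewrite -fibre_degree_base nxt_edge.
Qed.

Lemma degree_on_unique D : degree_on F A D -> D = ldeg (f v) (attach TY v v').
Proof.
move=> degD; have v'v : v' != v by rewrite eq_sym.
have [ev cv] := nxtP vT v'T v'v; set u := nxt TY v v' in ev cv *.
have uv : u != v by rewrite eq_sym (edge_neq ev).
have cA : [set v; u] \in A.
  by rewrite in_annulus_edge // eqxx uv vv' con_refl /= ?andbT con_sym cv.
rewrite -(degD (cell_map F [set v; u])); last exact: imset_f.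
by rewrite -/(fibre_degree _) cell_map2 fibre_degree_base.
Qed.

End AnnulusDegree.

End CoverCombinatorics.

(** * Cross-ratios of images and sizes of annuli *)
Section CrossRatioOfImages.
Variable K : numClosedFieldType.

Lemma cr_trans (s t a b c : option K) : br s c != 0 -> br t c != 0 ->
  cr s t a b = cr s t a c * cr s t c b.
Proof.
move=> sc tc; rewrite /cr !invfM.
have -> : br s a * br t c * ((br s c)^-1 * (br t a)^-1) *
    (br s c * br t b * ((br s b)^-1 * (br t c)^-1)) =
  (br s c / br s c) * (br t c / br t c) * (br s a * br t b * ((br s b)^-1 * (br t a)^-1)).
  ring.
by rewrite !divff // !mul1r.
Qed.

Lemma cr_trans12 (s t u a b : option K) : br u a != 0 -> br u b != 0 ->
  cr s t a b = cr s u a b * cr u t a b.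
Proof.
move=> ua ub; rewrite /cr !invfM.
have -> : br s a * br u b * ((br s b)^-1 * (br u a)^-1) *
    (br u a * br t b * ((br u b)^-1 * (br t a)^-1)) =
  (br u a / br u a) * (br u b / br u b) * (br s a * br t b * ((br s b)^-1 * (br t a)^-1)).
  ring.
by rewrite !divff // !mul1r.
Qed.

(** The two fibres are known as forms.  Their constants, the lift factors and the
auxiliary point [r] all cancel, because both fibres have the same degree. *)
Lemma cr_image (f : {poly K} * {poly K}) (J : finType) (y : J -> option K)
    (dg : J -> nat) (A B : pred J) (k l : K) (b c s t r : option K) :
  coprimep f.1 f.2 -> k != 0 -> l != 0 ->
  (forall S, wedge (hlift f S) (vec b) = k * \prod_(a | A a) wedge S (vec (y a)) ^+ dg a) ->
  (forall S, wedge (hlift f S) (vec c) = l * \prod_(a | B a) wedge S (vec (y a)) ^+ dg a) ->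
  (\sum_(a | A a) dg a = \sum_(a | B a) dg a)%N ->
  br s r != 0 -> br t r != 0 ->
  (forall a, A a || B a -> (br s (y a) != 0) && (br t (y a) != 0)) ->
  cr (peval f s) (peval f t) b c =
  (\prod_(a | A a) cr s t (y a) r ^+ dg a) / \prod_(a | B a) cr s t (y a) r ^+ dg a.
Proof.
move=> cop k0 l0 Hb Hc dAB sr tr nz.
have [ms ms0 Es] := hlift_vec cop s; have [mt mt0 Et] := hlift_vec cop t.
have brE (m : K) x u (e : option K) : m != 0 -> hlift f (vec x) = vscale m (vec (peval f x)) ->
    wedge (hlift f (vec x)) (vec e) = u -> br (peval f x) e = u / m.
  by move=> m0 -> <-; rewrite wedgeZl mulrAC divff // mul1r.
have prodE (Q : pred J) : (\prod_(a | Q a) cr s t (y a) r ^+ dg a) =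
    (\prod_(a | Q a) br s (y a) ^+ dg a) / (\prod_(a | Q a) br t (y a) ^+ dg a) *
    (br t r / br s r) ^+ (\sum_(a | Q a) dg a).
  rewrite expr_sum -prodf_div -big_split /=; apply: eq_bigr => a _.
  by rewrite -expr_div_n -exprMn; congr (_ ^+ _); rewrite /cr invfM; ring.
have pn (Q : pred J) x : (forall a, Q a -> br x (y a) != 0) ->
    \prod_(a | Q a) br x (y a) ^+ dg a != 0.
  by move=> h; rewrite prodf_seq_neq0; apply/allP => a _; apply/implyP => Qa; rewrite expf_neq0 ?h.
have nA : forall a, A a -> (br s (y a) != 0) && (br t (y a) != 0).
  by move=> a Aa; apply: nz; rewrite Aa.
have nB : forall a, B a -> (br s (y a) != 0) && (br t (y a) != 0).
  by move=> a Ba; apply: nz; rewrite Ba orbT.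
have h1 := pn A s (fun a h => proj1 (andP (nA a h))).
have h2 := pn A t (fun a h => proj2 (andP (nA a h))).
have h3 := pn B s (fun a h => proj1 (andP (nB a h))).
have h4 := pn B t (fun a h => proj2 (andP (nB a h))).
rewrite {1}/cr (brE _ _ _ _ ms0 Es (Hb _)) (brE _ _ _ _ mt0 Et (Hc _)).
rewrite (brE _ _ _ _ ms0 Es (Hc _)) (brE _ _ _ _ mt0 Et (Hb _)) !prodE dAB.
have : (br t r / br s r) ^+ (\sum_(a | B a) dg a) != 0.
  by rewrite expf_neq0 // mulf_neq0 // invr_eq0.
move: (_ ^+ (\sum_(a | B a) dg a)) => e e0.
rewrite -/(br _ _).
rewrite (_ : \prod_(a | A a) wedge (vec s) _ ^+ _ = \prod_(a | A a) br s (y a) ^+ dg a) //.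
rewrite (_ : \prod_(a | A a) wedge (vec t) _ ^+ _ = \prod_(a | A a) br t (y a) ^+ dg a) //.
rewrite (_ : \prod_(a | B a) wedge (vec s) _ ^+ _ = \prod_(a | B a) br s (y a) ^+ dg a) //.
rewrite (_ : \prod_(a | B a) wedge (vec t) _ ^+ _ = \prod_(a | B a) br t (y a) ^+ dg a) //.
move: (\prod_(a | A a) br s (y a) ^+ dg a) h1 (\prod_(a | A a) br t (y a) ^+ dg a) h2
  (\prod_(a | B a) br s (y a) ^+ dg a) h3 (\prod_(a | B a) br t (y a) ^+ dg a) h4.
move=> x1 h1 x2 h2 x3 h3 x4 h4.
by field; rewrite ms0 mt0 k0 l0 h2 h3 h4 e0.
Qed.

End CrossRatioOfImages.

(** Marked points [pts n] that degenerate to a tree: in the coordinates [A v] at the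
vertex [v], the point of a leaf [a] tends to the position [att v a] of [a] seen
from [v].  A leaf which [v'] sees away from [v] is seen by [v] in the direction
of [v']. *)
Section MarkedTree.
Variables (K : numClosedFieldType) (V : finType) (W I : {set V}).
Variables (att : V -> V -> option K) (pts : nat -> V -> option K).
Variable A : V -> nat -> K * K -> K * K.
Hypothesis pts_inj : forall n, {in W &, injective (pts n)}.
Hypothesis chA : forall v, v \in I -> chart (A v).
Hypothesis cvA : forall v a, v \in I -> a \in W ->
  conv \oo%classic (A v) (fun n => pts n a) (att v a).
Hypothesis att_far : forall v v' t, v \in I -> v' \in I -> v != v' -> t \in W ->
  att v' t != att v' v -> att v t = att v v'.
Local Notation tendsn := (tends (\oo : set_system nat)%classic).

(** Four leaves whose cross-ratio sees the annulus between [v] and [v']: [s], [q] lie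
beyond [v], and [t], [r] lie beyond [v']. *)
Definition quad v v' (Q : V * V * V * V) :=
  let: (s, q, t, r) := Q in
  [/\ [/\ s \in W, q \in W, t \in W & r \in W],
      [/\ att v s != att v v', att v q != att v v' & att v s != att v q]
    & [/\ att v' t != att v' v, att v' r != att v' v & att v' t != att v' r]].

Definition qrho (Q : V * V * V * V) n : K :=
  let: (s, q, t, r) := Q in rho (pts n s) (pts n q) (pts n t) (pts n r).

Definition qomega v v' (Q : V * V * V * V) : K :=
  let: (s, q, t, r) := Q in
  omega (att v v') (att v s) (att v q) * omega (att v' v) (att v' t) (att v' r).

(** Division by the two cotangent vectors removes the dependence on the leaves in
the limit, see [qsize_change]; what is left compares the scales of the
coordinates at [v] and at [v']. *)
Definition qsize v v' Q n : K := qrho Q n / qomega v v' Q.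

Definition qswap (Q : V * V * V * V) := let: (s, q, t, r) := Q in (t, r, s, q).

Lemma quad_swap v v' Q : quad v v' Q -> quad v' v (qswap Q).
Proof. by case: Q => [[[s q] t] r] [[? ? ? ?] h h']. Qed.

Lemma qrho_swap Q n : qrho (qswap Q) n = qrho Q n.
Proof. by case: Q => [[[s q] t] r]; rewrite /qrho /= rho_sym. Qed.

Lemma qsize_swap v v' Q n : qsize v' v (qswap Q) n = qsize v v' Q n.
Proof.
rewrite /qsize qrho_swap; case: Q => [[[s q] t] r]; rewrite /qomega /=.
by rewrite [X in _ / X = _]mulrC.
Qed.

Lemma tends_cvg_eq (u w : nat -> K) c : (forall n, u n = w n) -> tendsn u c -> tendsn w c.
Proof. by move=> /funext ->. Qed.

Lemma tends_rescale (u w : nat -> K) a c : tendsn (fun n => u n / w n) c ->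
  tendsn (fun n => u n / a / w n) (c / a).
Proof.
move=> l; have l' : tendsn (fun n => u n / w n / a) (c / a).
  by apply: tendsM => //; apply: tends_cst.
by apply: tends_cvg_eq l' => n; rewrite mulrAC.
Qed.

Lemma tends_two_steps (u w r : nat -> K) a b a' b' :
  (\forall n \near \oo, w n != 0)%classic -> tendsn (fun n => u n / w n) (a / b) ->
  tendsn (fun n => w n / r n) (a' / b') -> tendsn (fun n => u n / r n) (a * a' / (b * b')).
Proof.
move=> w0 l1 l2; rewrite invfM mulrACA.
have l3 : tendsn (fun n => u n / w n * (w n / r n)) (a / b * (a' / b')) by apply: tendsM.
by apply: tends_near l3; apply: filterS w0 => n wn; rewrite mulrA divfK.
Qed.

Section Pair.
Variables v v' : V.
Hypotheses (vI : v \in I) (v'I : v' \in I) (vv' : v != v').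
Let v'v : v' != v. Proof. by rewrite eq_sym. Qed.

Lemma att_neq u a b : att u a != att u b -> a != b.
Proof. by apply: contraNneq => ->. Qed.

Lemma pts_neq a b n : a \in W -> b \in W -> a != b -> pts n a != pts n b.
Proof. by move=> aW bW; apply: contraNneq => /pts_inj ->. Qed.

Lemma quad_neq s q t r : quad v v' (s, q, t, r) ->
  [/\ s != q, t != r, t != q & s != r].
Proof.
move=> [[sW qW tW rW] [sp qp sq] [tp rp tr]].
split; [exact: att_neq sq | exact: att_neq tr | |].
  by apply: (@att_neq v); rewrite (att_far vI v'I vv' tW tp) eq_sym.
by apply: (@att_neq v); rewrite (att_far vI v'I vv' rW rp).
Qed.

Lemma qrho_neq0 Q n : quad v v' Q -> qrho Q n != 0.
Proof.
case: Q => [[[s q] t] r] hQ; have [sq tr tq sr] := quad_neq hQ.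
have [[sW qW tW rW] _ _] := hQ.
by apply: rho_neq0; apply: pts_neq.
Qed.

Lemma qomega_neq0 Q : quad v v' Q -> qomega v v' Q != 0.
Proof.
case: Q => [[[s q] t] r] [[sW qW tW rW] [sp qp sq] [tp rp tr]].
by rewrite mulf_neq0 // omega_neq0.
Qed.

Lemma qsize_neq0 Q n : quad v v' Q -> qsize v v' Q n != 0.
Proof.
by move=> hQ; rewrite mulf_neq0 ?invr_eq0 ?(qrho_neq0 _ hQ) ?qomega_neq0.
Qed.

Lemma qsize_tends0 Q : quad v v' Q -> tendsn (qsize v v' Q) 0.
Proof.
case: Q => [[[s q] t] r] [[sW qW tW rW] [sp qp sq] [tp rp tr]].
have ct := cvA vI tW; rewrite (att_far vI v'I vv' tW tp) in ct.
have cr' := cvA vI rW; rewrite (att_far vI v'I vv' rW rp) in cr'.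
have lim : tendsn (fun n => rho (pts n s) (pts n q) (pts n t) (pts n r)) 0.
  exact: (rho_tends0 (chA vI) (cvA vI sW) (cvA vI qW) ct cr' sp qp).
rewrite -(mul0r (qomega v v' (s, q, t, r))^-1).
apply: (@tends_cvg_eq (fun n => rho (pts n s) (pts n q) (pts n t) (pts n r) *
  (qomega v v' (s, q, t, r))^-1)) => //.
by apply: tendsM => //; exact: tends_cst.
Qed.

Lemma tends_over_size (u : nat -> K) Q x : quad v v' Q ->
  tendsn (fun n => u n / qrho Q n) (x / qomega v v' Q) ->
  tendsn (fun n => u n / qsize v v' Q n) x.
Proof.
move=> hQ lim; rewrite -[x](divfK (qomega_neq0 hQ)).
have lim' : tendsn (fun n => u n / qrho Q n * qomega v v' Q)
    (x / qomega v v' Q * qomega v v' Q) by apply: tendsM => //; exact: tends_cst.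
by apply: tends_cvg_eq lim' => n; rewrite /qsize invfM invrK mulrA.
Qed.

(** A point that moves in the coordinates at [v], away from the annulus, may replace
the leaf [s], and likewise at [v'].  The two replacements are made in turn, each
seen from one end. *)
Lemma moving_points s q t r (sg tau : nat -> option K) S S' :
  quad v v' (s, q, t, r) -> conv \oo%classic (A v) sg S ->
  conv \oo%classic (A v') tau S' -> S != att v v' ->
  S' != att v' v -> S' != att v' r -> 
  tendsn (fun n => rho (sg n) (pts n q) (tau n) (pts n r) / qsize v v' (s, q, t, r) n)
    (omega (att v v') S (att v q) * omega (att v' v) S' (att v' r)).
Proof.
move=> hQ csg ctau Sp S'p S'r; have [_ tr tq sr] := quad_neq hQ.
have [[sW qW tW rW] [sp qp sq] [tp rp trp]] := hQ.
have cr' := cvA vI rW; rewrite (att_far vI v'I vv' rW rp) in cr'.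
have cq' := cvA v'I qW; rewrite (att_far v'I vI v'v qW qp) in cq'.
have taur : (\forall n \near \oo, tau n != pts n r)%classic.
  exact: (conv_neq (chA v'I) ctau (cvA v'I rW) S'r).
have tauq : (\forall n \near \oo, tau n != pts n q)%classic.
  exact: (conv_neq (chA v'I) ctau cq' S'p).
have e1 : tendsn (fun n => rho (sg n) (pts n q) (tau n) (pts n r) /
     rho (pts n s) (pts n q) (tau n) (pts n r))
   (omega (att v v') S (att v q) / omega (att v v') (att v s) (att v q)).
  exact: (rho_ratio1 (chA vI) csg (cvA vI sW) (cvA vI qW) cr' Sp sp qp sq taur tauq).
have near1 : (\forall n \near \oo, pts n s != pts n q)%classic.
  by near=> n; apply: pts_neq => //; exact: att_neq sq.
have near2 : (\forall n \near \oo, pts n s != pts n r)%classic.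
  by near=> n; apply: pts_neq => //; exact: att_neq sr.
have e2 : tendsn (fun n => rho (tau n) (pts n r) (pts n s) (pts n q) /
     rho (pts n t) (pts n r) (pts n s) (pts n q))
   (omega (att v' v) S' (att v' r) / omega (att v' v) (att v' t) (att v' r)).
  exact: (rho_ratio1 (chA v'I) ctau (cvA v'I tW) (cvA v'I rW) cq' S'p tp rp trp
    near1 near2).
apply: (tends_over_size hQ); apply: (tends_two_steps _ e1); first near=> n.
  have n1 : pts n s != pts n q by near: n.
  have n2 : pts n s != pts n r by near: n.
  have n3 : tau n != pts n r by near: n.
  have n4 : tau n != pts n q by near: n.
  exact: rho_neq0.
apply: tends_cvg_eq e2 => n.
by rewrite [rho (tau n) _ _ _]rho_sym [rho (pts n t) _ _ _]rho_sym.
Unshelve. all: by end_near.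
Qed.

End Pair.

(** Leaves at a common position are allowed for [s], [q] or for [t], [r]; the limit
is then zero. *)
Lemma leaves_compare w w' s q t r Q1 : w \in I -> w' \in I -> w != w' ->
  quad w w' Q1 -> [/\ s \in W, q \in W, t \in W & r \in W] -> t != r ->
  att w s != att w w' -> att w q != att w w' ->
  att w' t != att w' w -> att w' r != att w' w ->
  tendsn (fun n => qrho (s, q, t, r) n / qsize w w' Q1 n)
   (omega (att w w') (att w s) (att w q) * omega (att w' w) (att w' t) (att w' r)).
Proof.
case: Q1 => [[[s1 q1] t1] r1] wI w'I ww' hQ [sW qW tW rW] tr sw qw tw' rw'.
have w'w : w' != w by rewrite eq_sym.
have [s1q1 t1r1 t1q1 s1r1] := quad_neq wI w'I ww' hQ.
have [[s1W q1W t1W r1W] [s1p q1p sq1] [t1p r1p tr1]] := hQ.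
have ct := cvA wI tW; rewrite (att_far wI w'I ww' tW tw') in ct.
have cr' := cvA wI rW; rewrite (att_far wI w'I ww' rW rw') in cr'.
have cs1 := cvA w'I s1W; rewrite (att_far w'I wI w'w s1W s1p) in cs1.
have cq1 := cvA w'I q1W; rewrite (att_far w'I wI w'w q1W q1p) in cq1.
have e1 : tendsn (fun n => rho (pts n s) (pts n q) (pts n t) (pts n r) /
     rho (pts n s1) (pts n q1) (pts n t) (pts n r))
   (omega (att w w') (att w s) (att w q) / omega (att w w') (att w s1) (att w q1)).
  apply: (rho_ratio (chA wI) (cvA wI sW) (cvA wI qW) (cvA wI s1W) (cvA wI q1W) ct cr') => //.
  by move=> n; apply: pts_neq.
have e2 : tendsn (fun n => rho (pts n t) (pts n r) (pts n s1) (pts n q1) /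
     rho (pts n t1) (pts n r1) (pts n s1) (pts n q1))
   (omega (att w' w) (att w' t) (att w' r) / omega (att w' w) (att w' t1) (att w' r1)).
  apply: (rho_ratio (chA w'I) (cvA w'I tW) (cvA w'I rW) (cvA w'I t1W) (cvA w'I r1W) cs1 cq1) => //.
  by move=> n; apply: pts_neq.
have tq1 : t != q1.
  by apply: (@att_neq w); rewrite (att_far wI w'I ww' tW tw') eq_sym.
have s1r : s1 != r.
  by apply: (@att_neq w); rewrite (att_far wI w'I ww' rW rw').
apply: (tends_over_size hQ); apply: (tends_two_steps _ e1).
  by near=> n; apply: rho_neq0; apply: pts_neq.
apply: tends_cvg_eq e2 => n.
by rewrite [rho (pts n t) _ _ _]rho_sym [rho (pts n t1) _ _ _]rho_sym.
Unshelve. all: by end_near.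
Qed.

Lemma qsize_change w w' Q Q1 : w \in I -> w' \in I -> w != w' ->
  quad w w' Q -> quad w w' Q1 -> tendsn (fun n => qsize w w' Q n / qsize w w' Q1 n) 1.
Proof.
case: Q => [[[s q] t] r] wI w'I ww' hQ hQ1.
have [_ tr _ _] := quad_neq wI w'I ww' hQ.
have [WQ [sp qp _] [tp rp _]] := hQ.
have lim := leaves_compare wI w'I ww' hQ1 WQ tr sp qp tp rp.
rewrite -(divff (qomega_neq0 hQ)).
exact: tends_rescale lim.
Qed.

End MarkedTree.

(** * The size of the image of an annulus *)
Lemma near_fin (T : Type) (F : set_system T) {FF : Filter F} (J : finType)
    (P : J -> T -> Prop) :
  (forall a, \forall x \near F, P a x)%classic ->
  (\forall x \near F, forall a, P a x)%classic.
Proof.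
move=> h.
suff : (\forall x \near F, forall a, a \in enum J -> P a x)%classic.
  by apply: filterS => x hx a; apply: hx; rewrite mem_enum.
elim: (enum J) => [|b s IH]; first by near=> x.
apply: filterS2 (h b) IH => x h1 h2 a; rewrite inE => /predU1P[->//|]; exact: h2.
Unshelve. all: by end_near.
Qed.

(** The maps [f n] between two marked trees, with limit [g v] at each vertex [v].
The fibres over the leaves of the target tree are complete: they consist of
leaves of the source tree, with multiplicities [dg].  Away from the positions of
the leaves (predicate [unm]) the maps converge.  By the hypothesis [sides], a leaf
mapped beyond an end of the image annulus is itself beyond an end of the annulus.
The leaves [b0] and [bi] lie beyond [FV v'] and [FV v] respectively. *)
Section Step.
Variables (K : numClosedFieldType) (V : finType) (WY IY WZ IZ : {set V}).
Variables (attY attZ : V -> V -> option K) (ptsY ptsZ : nat -> V -> option K).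
Variables (AY AZ : V -> nat -> K * K -> K * K).
Hypothesis ptsY_inj : forall n, {in WY &, injective (ptsY n)}.
Hypothesis chAY : forall v, v \in IY -> chart (AY v).
Hypothesis cvAY : forall v a, v \in IY -> a \in WY ->
  conv \oo%classic (AY v) (fun n => ptsY n a) (attY v a).
Hypothesis attY_far : forall v v' t, v \in IY -> v' \in IY -> v != v' -> t \in WY ->
  attY v' t != attY v' v -> attY v t = attY v v'.
Hypothesis ptsZ_inj : forall n, {in WZ &, injective (ptsZ n)}.
Hypothesis chAZ : forall v, v \in IZ -> chart (AZ v).
Hypothesis cvAZ : forall v a, v \in IZ -> a \in WZ ->
  conv \oo%classic (AZ v) (fun n => ptsZ n a) (attZ v a).
Hypothesis attZ_far : forall v v' t, v \in IZ -> v' \in IZ -> v != v' -> t \in WZ ->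
  attZ v' t != attZ v' v -> attZ v t = attZ v v'.

Variables (f : nat -> {poly K} * {poly K}) (FV : V -> V) (dg : V -> nat) (d : nat).
Hypothesis fcop : forall n, coprimep (f n).1 (f n).2.
Hypothesis fibre : forall n b, b \in WZ -> exists2 k : K, k != 0 & forall S,
  wedge (hlift (f n) S) (vec (ptsZ n b)) =
  k * \prod_(a | (a \in WY) && (FV a == b)) wedge S (vec (ptsY n a)) ^+ dg a.
Hypothesis fibre_deg : forall b, b \in WZ ->
  (\sum_(a | (a \in WY) && (FV a == b)) dg a = d)%N.

Variables (g : V -> {poly K} * {poly K}) (unm : V -> option K -> Prop).
Hypothesis gcop : forall v, v \in IY -> coprimep (g v).1 (g v).2.
Hypothesis gdeg : forall v, v \in IY -> (0 < pdegree (g v))%N.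
Hypothesis unm_att : forall v S a, v \in IY -> a \in WY -> unm v S -> S != attY v a.
Hypothesis unm_img : forall v S b, v \in IY -> b \in WZ -> unm v S ->
  peval (g v) S != attZ (FV v) b.
Hypothesis unm_near : forall v p, v \in IY ->
  (\forall e \near (0 : K)^', unm v (ins p e))%classic.
Hypothesis unm_lim : forall v S, v \in IY -> unm v S ->
  exists2 sg : nat -> option K, conv \oo%classic (AY v) sg S &
    conv \oo%classic (AZ (FV v)) (fun n => peval (f n) (sg n)) (peval (g v) S).

Variables v v' : V.
Hypotheses (vI : v \in IY) (v'I : v' \in IY) (vv' : v != v').
Hypotheses (FvI : FV v \in IZ) (Fv'I : FV v' \in IZ) (FvFv' : FV v != FV v').
Let v'v : v' != v. Proof. by rewrite eq_sym. Qed.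
Let Fv'Fv : FV v' != FV v. Proof. by rewrite eq_sym. Qed.
Hypothesis gp : peval (g v) (attY v v') = attZ (FV v) (FV v').
Hypothesis gp' : peval (g v') (attY v' v) = attZ (FV v') (FV v).
Hypothesis sides : forall a, a \in WY -> FV a \in WZ ->
  attZ (FV v) (FV a) != attZ (FV v) (FV v') \/
  attZ (FV v') (FV a) != attZ (FV v') (FV v) ->
  attY v a != attY v v' \/ attY v' a != attY v' v.
Local Notation tendsn := (tends (\oo : set_system nat)%classic).
Local Notation F0 := ((0 : K)^'%classic).

Variables a1 ai t1 a0 b1 bi tb b0 : V.
Hypothesis QY : quad WY attY v v' (a1, ai, t1, a0).
Hypothesis QZ : quad WZ attZ (FV v) (FV v') (b1, bi, tb, b0).

Let p := attY v v'.
Let p' := attY v' v.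
Let q := attZ (FV v) (FV v').
Let q' := attZ (FV v') (FV v).
(** [inn a] says that [a] lies beyond [v'].  In the cross-ratio of the images each
point [a] of the two fibres is compared with [a0] or [ai], whichever lies beyond
the same end.  Then [KO] and [KI] are the contributions of the two moving points
[S] at [v] and [S'] at [v'] to the limit, [EO] and [EI] their products over the
fibres.  The exponents [A] and [B] count the points beyond [v'] over [b0] and over
[bi]; their difference will be the local degree. *)
Let inn a := attY v' a != p'.
Let fib b := [pred a | (a \in WY) && (FV a == b)].

Let KO S a : K := if inn a then 1 else cr S p (attY v a) (attY v ai).
Let KI S a : K := if inn a then cr p' S (attY v' a) (attY v' a0) else 1.
Let EO S := (\prod_(a | fib b0 a) KO S a ^+ dg a) / (\prod_(a | fib bi a) KO S a ^+ dg a).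
Let EI S := (\prod_(a | fib b0 a) KI S a ^+ dg a) / (\prod_(a | fib bi a) KI S a ^+ dg a).
Let A := (\sum_(a | fib b0 a && inn a) dg a)%N.
Let B := (\sum_(a | fib bi a && inn a) dg a)%N.
Let fibs a := fib b0 a || fib bi a.

Let aiW : ai \in WY. Proof. by case: QY => -[]. Qed.
Let a0W : a0 \in WY. Proof. by case: QY => -[]. Qed.
Let biW : bi \in WZ. Proof. by case: QZ => -[]. Qed.
Let b0W : b0 \in WZ. Proof. by case: QZ => -[]. Qed.
Let aip : attY v ai != p. Proof. by case: QY => _ []. Qed.
Let a0p : attY v' a0 != p'. Proof. by case: QY => _ _ []. Qed.
Let bip : attZ (FV v) bi != q. Proof. by case: QZ => _ []. Qed.
Let b0p : attZ (FV v') b0 != q'. Proof. by case: QZ => _ _ []. Qed.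
Let aip' : attY v' ai = p'. Proof. exact: (attY_far v'I vI v'v aiW aip). Qed.
Let a0p0 : attY v a0 = p. Proof. exact: (attY_far vI v'I vv' a0W a0p). Qed.

Let fibsW a : fibs a -> a \in WY. Proof. by case/orP => /andP[]. Qed.

Let out_att a : fibs a -> ~~ inn a -> attY v a != p.
Proof.
move=> fa; rewrite negbK => /eqP ia; have aW := fibsW fa.
have [] // : attY v a != attY v v' \/ attY v' a != attY v' v.
  apply: sides => //.
    by case/orP: fa => /andP[_ /eqP ->].
  by case/orP: fa => /andP[_ /eqP ->]; [right | left].
by rewrite ia eqxx.
Qed.

Let inn_att a : a \in WY -> inn a -> attY v a = p.
Proof. by move=> aW ia; apply: (attY_far vI v'I vv' aW ia). Qed.


Let unm_p S : unm v S -> S != p.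
Proof. by move=> u; rewrite -a0p0; apply: unm_att. Qed.
Let unm_p' S : unm v' S -> S != p'.
Proof. by move=> u; rewrite -aip'; apply: unm_att. Qed.

(** Beyond [v'], the point [a] and the reference [a0] have the same position seen
from [v], so only the moving point at [v'] contributes; symmetrically beyond
[v]. *)
Lemma factor_limit a S S' (sg tau : nat -> option K) : fibs a ->
  unm v S -> unm v' S' -> conv \oo%classic (AY v) sg S ->
  conv \oo%classic (AY v') tau S' ->
  tendsn (fun n => cr (sg n) (tau n) (ptsY n a) (ptsY n (if inn a then a0 else ai)))
    (KO S a * KI S' a).
Proof.
move=> fa uS uS' cs ct; have aW := fibsW fa.
have Sp := unm_p uS; have S'p := unm_p' uS'.
have crxx (x y z : option K) : x != z -> y != z -> cr x y z z = 1.
  by move=> xz yz; rewrite /cr divff // mulf_neq0 // br_neq0.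
have split u c : u \in WY -> c \in WY -> u != a -> u != c ->
    forall n, cr (sg n) (tau n) (ptsY n a) (ptsY n c) =
      cr (sg n) (ptsY n u) (ptsY n a) (ptsY n c) * cr (ptsY n u) (tau n) (ptsY n a) (ptsY n c).
  move=> uW cW ua uc n; rewrite -cr_trans12 // br_neq0 //.
    exact: (pts_neq ptsY_inj).
  exact: (pts_neq ptsY_inj).
have aia0 : ai != a0.
  by apply: (@att_neq _ _ attY v'); rewrite aip' eq_sym.
have ca := cvAY vI aW; have ca' := cvAY v'I aW.
have ci := cvAY vI aiW; have ci' := cvAY v'I aiW; rewrite aip' in ci'.
have c0 := cvAY vI a0W; have c0' := cvAY v'I a0W; rewrite a0p0 in c0.
rewrite /KO /KI; case: ifPn => ia.
  have aia : ai != a.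
    by apply: (@att_neq _ _ attY v'); rewrite aip' eq_sym.
  rewrite (inn_att aW ia) in ca.
  apply: (@tends_cvg_eq _ (fun n => cr (sg n) (ptsY n ai) (ptsY n a) (ptsY n a0) *
     cr (ptsY n ai) (tau n) (ptsY n a) (ptsY n a0))).
    by move=> n; rewrite -split.
  apply: tendsM; last first.
    by apply: (cr_tends (chAY v'I) ci' ct ca' c0'); [rewrite eq_sym|apply: unm_att].
  rewrite -[X in tends _ _ X](crxx S (attY v ai) p Sp aip).
  exact: (cr_tends (chAY vI) cs ci ca c0).
have a0a : a0 != a.
  by apply: contraNneq ia => <-.
have pa : p != attY v a by rewrite eq_sym; apply: out_att.
have ca2 := ca'; rewrite (_ : attY v' a = p') in ca2; last by apply/eqP; rewrite -[_ == _]negbK.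
apply: (@tends_cvg_eq _ (fun n => cr (sg n) (ptsY n a0) (ptsY n a) (ptsY n ai) *
     cr (ptsY n a0) (tau n) (ptsY n a) (ptsY n ai))).
  by move=> n; rewrite -split // eq_sym.
apply: tendsM.
  by apply: (cr_tends (chAY vI) cs c0 ca ci) => //; apply: unm_att.
rewrite -[X in tends _ _ X](crxx (attY v' a0) S' p' a0p S'p).
exact: (cr_tends (chAY v'I) c0' ct ca2 ci').
Qed.

Let E (sg tau : nat -> option K) n : K :=
  (\prod_(a | fib b0 a) cr (sg n) (tau n) (ptsY n a) (ptsY n (if inn a then a0 else ai)) ^+ dg a) /
  (\prod_(a | fib bi a) cr (sg n) (tau n) (ptsY n a) (ptsY n (if inn a then a0 else ai)) ^+ dg a).

Let KO_neq0 S a : fibs a -> unm v S -> KO S a != 0.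
Proof.
move=> fa uS; rewrite /KO; case: ifPn => [_|ia]; first exact: oner_neq0.
have aW := fibsW fa; have pa := out_att fa ia.
rewrite mulf_neq0 ?invr_eq0 ?mulf_neq0 // br_neq0 //.
- exact: unm_att.
- by rewrite eq_sym.
- exact: unm_att.
- by rewrite eq_sym.
Qed.

Let KI_neq0 S a : fibs a -> unm v' S -> KI S a != 0.
Proof.
move=> fa uS; rewrite /KI; case: ifPn => [ia|_]; last exact: oner_neq0.
have aW := fibsW fa.
rewrite mulf_neq0 ?invr_eq0 ?mulf_neq0 // br_neq0 //.
- by rewrite eq_sym.
- exact: unm_att.
- by rewrite eq_sym.
- exact: unm_att.
Qed.

Let prod_neq0 (b : V) (u : V -> K) : (forall a, fib b a -> u a != 0) ->
  \prod_(a | fib b a) u a ^+ dg a != 0.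
Proof.
move=> h; rewrite prodf_seq_neq0; apply/allP => a _; apply/implyP => fa.
by rewrite expf_neq0 // h.
Qed.

Let EO_neq0 S : unm v S -> EO S != 0.
Proof.
move=> uS; rewrite mulf_neq0 ?invr_eq0 //; apply: prod_neq0 => a fa;
  by apply: KO_neq0 => //; rewrite /fibs fa ?orbT.
Qed.

Let EI_neq0 S : unm v' S -> EI S != 0.
Proof.
move=> uS; rewrite mulf_neq0 ?invr_eq0 //; apply: prod_neq0 => a fa;
  by apply: KI_neq0 => //; rewrite /fibs fa ?orbT.
Qed.

Lemma product_limit S S' (sg tau : nat -> option K) : unm v S -> unm v' S' ->
  conv \oo%classic (AY v) sg S -> conv \oo%classic (AY v') tau S' ->
  tendsn (E sg tau) (EO S * EI S').
Proof.
move=> uS uS' cs ct.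
have split b : \prod_(a | fib b a) (KO S a * KI S' a) ^+ dg a =
   (\prod_(a | fib b a) KO S a ^+ dg a) * (\prod_(a | fib b a) KI S' a ^+ dg a).
  rewrite (eq_bigr (fun a => KO S a ^+ dg a * KI S' a ^+ dg a)).
    exact: big_split.
  by move=> a _; rewrite exprMn.
have -> : EO S * EI S' = (\prod_(a | fib b0 a) (KO S a * KI S' a) ^+ dg a) /
    (\prod_(a | fib bi a) (KO S a * KI S' a) ^+ dg a).
  by rewrite !split /EO /EI invfM mulrACA.
apply: tends_div.
- apply: prod_neq0 => a fa; rewrite mulf_neq0 ?KO_neq0 ?KI_neq0 //;
  by rewrite /fibs fa orbT.
- apply: tends_prod => a fa; apply: tendsX; apply: factor_limit => //.
  by rewrite /fibs; apply/orP; left.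
- apply: tends_prod => a fa; apply: tendsX; apply: factor_limit => //.
  by rewrite /fibs; apply/orP; right.
Qed.

(** In the product over the two fibres, each point beyond [v'] contributes the
cross-ratio of the annulus itself when it is compared with [ai] rather than [a0];
this occurs [A] times over [b0] and [B] times over [bi]. *)
Lemma image_rho S S' (sg tau : nat -> option K) : unm v S -> unm v' S' ->
  conv \oo%classic (AY v) sg S -> conv \oo%classic (AY v') tau S' ->
  (\forall n \near \oo, rho (peval (f n) (sg n)) (ptsZ n bi)
       (peval (f n) (tau n)) (ptsZ n b0) =
     rho (sg n) (ptsY n ai) (tau n) (ptsY n a0) ^+ A /
     rho (sg n) (ptsY n ai) (tau n) (ptsY n a0) ^+ B / E sg tau n)%classic.
Proof.
move=> uS uS' cs ct.
have ns : (\forall n \near \oo, forall a, a \in WY -> sg n != ptsY n a)%classic.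
  apply: near_fin => a; have [aW|aW] := boolP (a \in WY); last by near=> n.
  have := conv_neq (chAY vI) cs (cvAY vI aW) (unm_att vI aW uS).
  by move=> /(_ _); apply: filterS => n h _.
have nt : (\forall n \near \oo, forall a, a \in WY -> tau n != ptsY n a)%classic.
  apply: near_fin => a; have [aW|aW] := boolP (a \in WY); last by near=> n.
  have := conv_neq (chAY v'I) ct (cvAY v'I aW) (unm_att v'I aW uS').
  by move=> /(_ _); apply: filterS => n h _.
near=> n.
have nsn : forall a, a \in WY -> sg n != ptsY n a by near: n.
have ntn : forall a, a \in WY -> tau n != ptsY n a by near: n.
have bs a : a \in WY -> br (sg n) (ptsY n a) != 0 by move=> aW; rewrite br_neq0 ?nsn.
have bt a : a \in WY -> br (tau n) (ptsY n a) != 0 by move=> aW; rewrite br_neq0 ?ntn.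
have [k k0 Hk] := fibre n b0W; have [l l0 Hl] := fibre n biW.
have crE : cr (peval (f n) (sg n)) (peval (f n) (tau n)) (ptsZ n b0) (ptsZ n bi) =
    (\prod_(a | fib b0 a) cr (sg n) (tau n) (ptsY n a) (ptsY n ai) ^+ dg a) /
    \prod_(a | fib bi a) cr (sg n) (tau n) (ptsY n a) (ptsY n ai) ^+ dg a.
  apply: (cr_image (fcop n) k0 l0 Hk Hl); rewrite ?fibre_deg ?bs ?bt //.
  by move=> a fa; have aW : a \in WY := fibsW fa; rewrite bs ?bt.
set X := cr (sg n) (tau n) (ptsY n a0) (ptsY n ai).
have X0 : X != 0 by rewrite mulf_neq0 ?invr_eq0 ?mulf_neq0 ?bs ?bt.
(* each comparison with [a0] rather than [ai] costs a factor [X] *)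
have prodX b : \prod_(a | fib b a) cr (sg n) (tau n) (ptsY n a) (ptsY n ai) ^+ dg a =
  X ^+ (\sum_(a | fib b a && inn a) dg a) *
  \prod_(a | fib b a) cr (sg n) (tau n) (ptsY n a) (ptsY n (if inn a then a0 else ai)) ^+ dg a.
  have -> : X ^+ (\sum_(a | fib b a && inn a) dg a) =
      \prod_(a | fib b a) (if inn a then X ^+ dg a else 1).
    by rewrite expr_sum; apply: big_mkcondr.
  have bsp (u w : V -> K) : (\prod_(a | fib b a) u a) * (\prod_(a | fib b a) w a) =
      \prod_(a | fib b a) (u a * w a) by rewrite big_split.
  rewrite bsp; apply: eq_bigr => a fa.
  case: ifPn => [_|_]; last by rewrite mul1r.
  by rewrite (@cr_trans _ _ _ _ _ (ptsY n a0)) ?bs ?bt // mulrC exprMn.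
have crV (s t x y : option K) : cr t s x y = (cr s t x y)^-1.
  by rewrite /cr invf_div [X in X / _]mulrC [X in _ / X]mulrC.
rewrite /rho (crV (peval (f n) (sg n))) crE !prodX (crV (sg n) (tau n)) -/X -/A -/B /E.
have e1 : \prod_(a | fib b0 a) cr (sg n) (tau n) (ptsY n a)
    (ptsY n (if inn a then a0 else ai)) ^+ dg a != 0.
  apply: prod_neq0 => a fa; have aW : a \in WY by case/andP: fa.
  by rewrite mulf_neq0 ?invr_eq0 ?mulf_neq0 ?bs ?bt //; case: ifP.
have e2 : \prod_(a | fib bi a) cr (sg n) (tau n) (ptsY n a)
    (ptsY n (if inn a then a0 else ai)) ^+ dg a != 0.
  apply: prod_neq0 => a fa; have aW : a \in WY by case/andP: fa.
  by rewrite mulf_neq0 ?invr_eq0 ?mulf_neq0 ?bs ?bt //; case: ifP.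
have XA := expf_neq0 A X0; have XB := expf_neq0 B X0.
rewrite !exprVn.
move: (\prod_(a | fib b0 a) _) e1 (\prod_(a | fib bi a) _) e2 (X ^+ A) XA (X ^+ B) XB.
move=> x1 h1 x2 h2 x3 h3 x4 h4.
by field; rewrite h1 h2 h3 h4.
Unshelve. all: by end_near.
Qed.

(** The limit of the rescaled sizes is [GO S * GI S']; as the sizes involve neither
[S] nor [S'], both factors are constant. *)
Let GO S := omega p S (attY v ai) ^+ A / (omega p S (attY v ai) ^+ B *
  omega q (peval (g v) S) (attZ (FV v) bi) * EO S).
Let GI S := omega p' S (attY v' a0) ^+ A / (omega p' S (attY v' a0) ^+ B *
  omega q' (peval (g v') S) (attZ (FV v') b0) * EI S).

Let RY n := qsize attY ptsY v v' (a1, ai, t1, a0) n.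
Let RZ n := qsize attZ ptsZ (FV v) (FV v') (b1, bi, tb, b0) n.

Lemma size_limit S S' : unm v S -> unm v' S' ->
  tendsn (fun n => RZ n * RY n ^+ B / RY n ^+ A) (GO S * GI S').
Proof.
move=> uS uS'.
have [sg cs cfs] := unm_lim vI uS; have [tau ct cft] := unm_lim v'I uS'.
have gSq : peval (g v) S != q.
  have <- : attZ (FV v) b0 = q by apply: (attZ_far FvI Fv'I FvFv' b0W b0p).
  exact: unm_img.
have gS'q : peval (g v') S' != q'.
  have <- : attZ (FV v') bi = q' by apply: (attZ_far Fv'I FvI Fv'Fv biW bip).
  exact: unm_img.
have gSb : peval (g v) S != attZ (FV v) bi by exact: unm_img.
have gS'b : peval (g v') S' != attZ (FV v') b0 by exact: unm_img.
have Sp := unm_p uS; have S'p := unm_p' uS'.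
have Sai : S != attY v ai by exact: unm_att.
have S'a0 : S' != attY v' a0 by exact: unm_att.
pose y n := rho (sg n) (ptsY n ai) (tau n) (ptsY n a0) / RY n.
pose z n := rho (peval (f n) (sg n)) (ptsZ n bi) (peval (f n) (tau n)) (ptsZ n b0) / RZ n.
have limY : tendsn y (omega p S (attY v ai) * omega p' S' (attY v' a0)).
  exact: (moving_points ptsY_inj chAY cvAY attY_far vI v'I vv' QY cs ct).
have limZ : tendsn z (omega q (peval (g v) S) (attZ (FV v) bi) *
    omega q' (peval (g v') S') (attZ (FV v') b0)).
  exact: (moving_points ptsZ_inj chAZ cvAZ attZ_far FvI Fv'I FvFv' QZ cfs cft).
have limE := product_limit uS uS' cs ct.
have w1 : omega p S (attY v ai) != 0 by apply: omega_neq0.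
have w2 : omega p' S' (attY v' a0) != 0 by apply: omega_neq0.
have w3 : omega q (peval (g v) S) (attZ (FV v) bi) != 0 by apply: omega_neq0.
have w4 : omega q' (peval (g v') S') (attZ (FV v') b0) != 0 by apply: omega_neq0.
have eO := EO_neq0 uS; have eI := EI_neq0 uS'.
have RY0 n : RY n != 0 by exact: (qsize_neq0 ptsY_inj attY_far vI v'I vv' n QY).
have RZ0 n : RZ n != 0 by exact: (qsize_neq0 ptsZ_inj attZ_far FvI Fv'I FvFv' n QZ).
have lim : tendsn (fun n => y n ^+ A / (y n ^+ B * E sg tau n * z n))
  ((omega p S (attY v ai) * omega p' S' (attY v' a0)) ^+ A /
   ((omega p S (attY v ai) * omega p' S' (attY v' a0)) ^+ B * (EO S * EI S') *
    (omega q (peval (g v) S) (attZ (FV v) bi) *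
    omega q' (peval (g v') S') (attZ (FV v') b0)))).
  apply: tends_div.
  - by do ![apply: mulf_neq0 => // | apply: expf_neq0].
  - exact: tendsX.
  - by apply: tendsM => //; apply: tendsM => //; apply: tendsX.
have -> : GO S * GI S' = (omega p S (attY v ai) * omega p' S' (attY v' a0)) ^+ A /
   ((omega p S (attY v ai) * omega p' S' (attY v' a0)) ^+ B * (EO S * EI S') *
    (omega q (peval (g v) S) (attZ (FV v) bi) *
    omega q' (peval (g v') S') (attZ (FV v') b0))).
  by rewrite /GO /GI !(exprMn _ (omega p S _)) mulrACA -invfM; congr (_ / _); ring.
apply: tends_near lim; near=> n.
have E0 : E sg tau n != 0.
  near: n; exact: (tends_neq0 (mulf_neq0 eO eI) limE).
have y0 : y n != 0 by near: n; apply: (tends_neq0 _ limY); rewrite mulf_neq0.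
have x0 : rho (sg n) (ptsY n ai) (tau n) (ptsY n a0) != 0.
  by apply: contraNneq y0 => yE; rewrite /y yE mul0r.
rewrite /z (_ : rho _ (ptsZ n bi) _ _ = rho (sg n) (ptsY n ai) (tau n) (ptsY n a0) ^+ A /
     rho (sg n) (ptsY n ai) (tau n) (ptsY n a0) ^+ B / E sg tau n); last first.
  by near: n; exact: (image_rho uS uS' cs ct).
rewrite /y; move: (rho _ _ _ _) x0 (RY n) (RY0 n) (RZ n) (RZ0 n) (E _ _ _) E0.
move=> x x0 r r0 t t0 e e0; rewrite !expr_div_n.
have := (expf_neq0 A x0, expf_neq0 B x0, expf_neq0 A r0, expf_neq0 B r0).
move: (x ^+ A) (x ^+ B) (r ^+ A) (r ^+ B) => x1 x2 x3 x4 [[[h1 h2] h3] h4].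
by field; rewrite h1 h2 h3 h4 t0 e0.
Unshelve. all: by end_near.
Qed.

Let GO_neq0 S : unm v S -> GO S != 0.
Proof.
move=> uS; have gSq : peval (g v) S != q.
  have <- : attZ (FV v) b0 = q by apply: (attZ_far FvI Fv'I FvFv' b0W b0p).
  exact: unm_img.
have w1 : omega p S (attY v ai) != 0.
  by apply: omega_neq0 => //; [exact: unm_p | exact: unm_att].
have w3 : omega q (peval (g v) S) (attZ (FV v) bi) != 0.
  by apply: omega_neq0 => //; exact: unm_img.
apply: mulf_neq0; first exact: expf_neq0.
rewrite invr_neq0 //; apply: mulf_neq0; last exact: EO_neq0.
by apply: mulf_neq0 => //; exact: expf_neq0.
Qed.

Let GI_neq0 S : unm v' S -> GI S != 0.
Proof.
move=> uS; have gSq : peval (g v') S != q'.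
  have <- : attZ (FV v') bi = q' by apply: (attZ_far Fv'I FvI Fv'Fv biW bip).
  exact: unm_img.
have w1 : omega p' S (attY v' a0) != 0.
  by apply: omega_neq0 => //; [exact: unm_p' | exact: unm_att].
have w3 : omega q' (peval (g v') S) (attZ (FV v') b0) != 0.
  by apply: omega_neq0 => //; exact: unm_img.
apply: mulf_neq0; first exact: expf_neq0.
rewrite invr_neq0 //; apply: mulf_neq0; last exact: EI_neq0.
by apply: mulf_neq0 => //; exact: expf_neq0.
Qed.

Let ratio_tends1 (h : K -> V -> K) :
  (forall a, fibs a -> tends F0 (fun e => h e a) 1) ->
  tends F0 (fun e => (\prod_(a | fib b0 a) h e a ^+ dg a) /
    (\prod_(a | fib bi a) h e a ^+ dg a)) 1.
Proof.
move=> h1.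
have lim b : (forall a, fib b a -> fibs a) ->
    tends F0 (fun e => \prod_(a | fib b a) h e a ^+ dg a) 1.
  move=> sub; have e1 : \prod_(a | fib b a) 1 ^+ dg a = 1 :> K.
    by rewrite big1 // => a _; rewrite expr1n.
  rewrite -[X in tends _ _ X]e1.
  by apply: tends_prod => a fa; apply: tendsX; apply/h1/sub.
rewrite -[X in tends _ _ X](divr1 1); apply: tends_div; first exact: oner_neq0.
  by apply: lim => a fa; apply/orP; left.
by apply: lim => a fa; apply/orP; right.
Qed.

Let EO_tends : tends F0 (fun e => EO (ins p e)) 1.
Proof.
apply: (ratio_tends1 (h := fun e => KO (ins p e))) => a fa.
rewrite /KO; have [_|ia] := boolP (inn a); first exact: tends_cst.
have pa := out_att fa ia.
have e1 : cr p p (attY v a) (attY v ai) = 1.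
  by rewrite /cr [X in _ / X]mulrC divff // mulf_neq0 // br_neq0 // eq_sym.
have cst (x : option K) : conv F0 (fun _ S => S) (fun=> x) x by exact: conv_cst.
rewrite -[X in tends _ _ X]e1.
apply: (cr_tends (chart_id _ _) (conv_ins p) (cst _) (cst _) (cst _)).
  by rewrite eq_sym.
by rewrite eq_sym.
Qed.

Let EI_tends : tends F0 (fun e => EI (ins p' e)) 1.
Proof.
apply: (ratio_tends1 (h := fun e => KI (ins p' e))) => a fa.
rewrite /KI; have [ia|_] := boolP (inn a); last exact: tends_cst.
have e1 : cr p' p' (attY v' a) (attY v' a0) = 1.
  by rewrite /cr [X in _ / X]mulrC divff // mulf_neq0 // br_neq0 // eq_sym.
have cst (x : option K) : conv F0 (fun _ S => S) (fun=> x) x by exact: conv_cst.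
rewrite -[X in tends _ _ X]e1.
apply: (cr_tends (chart_id _ _) (cst _) (conv_ins p') (cst _) (cst _)).
  by rewrite eq_sym.
by rewrite eq_sym.
Qed.

(** [GO] does not depend on [S]; near the position of [v'] it is the quotient of
[leading_coefficient], which gives the exponent and the coefficient at [v].  The
same holds for [GI] at [v']. *)
Theorem size_step : exists c c' : K, [/\ c != 0, c' != 0,
  tends F0 (fun e => loc q (peval (g v) (ins p e)) / e ^+ pldeg (g v) p) c,
  tends F0 (fun e => loc q' (peval (g v') (ins p' e)) / e ^+ pldeg (g v') p') c' &
  pldeg (g v') p' = pldeg (g v) p /\
  tendsn (fun n => RZ n / RY n ^+ pldeg (g v) p) (c * c')].
Proof.
have [e0 u0] : exists e, unm v (ins p e) by exact: (@filter_ex K F0 _ _ (unm_near p vI)).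
have [e1 u1] : exists e, unm v' (ins p' e).
  by exact: (@filter_ex K F0 _ _ (unm_near p' v'I)).
set S0 := ins p e0 in u0; set T0 := ins p' e1 in u1.
have GO0 := GO_neq0 u0; have GI0 := GI_neq0 u1.
have GOc S : unm v S -> GO S = GO S0.
  move=> uS; apply: (mulIf GI0).
  exact: (tends_unique (size_limit uS u1) (size_limit u0 u1)).
have GIc S : unm v' S -> GI S = GI T0.
  move=> uS; apply: (mulfI GO0).
  exact: (tends_unique (size_limit u0 uS) (size_limit u0 u1)).
have [AB lim] : A = (B + pldeg (g v) p)%N /\
    tends F0 (fun e => loc q (peval (g v) (ins p e)) / e ^+ pldeg (g v) p) (GO S0).
  have := @leading_coefficient K (g v) p (attY v ai) (attZ (FV v) bi) A B (GO S0)
    (fun e => EO (ins p e)) (gcop vI) (gdeg vI) aip.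
  rewrite gp; apply => //.
  by apply: filterS (unm_near p vI) => e /GOc.
have [AB' lim'] : A = (B + pldeg (g v') p')%N /\
    tends F0 (fun e => loc q' (peval (g v') (ins p' e)) / e ^+ pldeg (g v') p') (GI T0).
  have := @leading_coefficient K (g v') p' (attY v' a0) (attZ (FV v') b0) A B (GI T0)
    (fun e => EI (ins p' e)) (gcop v'I) (gdeg v'I) a0p.
  rewrite gp'; apply => //.
  by apply: filterS (unm_near p' v'I) => e /GIc.
have mm : pldeg (g v') p' = pldeg (g v) p by apply: (@addnI B); rewrite -AB -AB'.
exists (GO S0), (GI T0); split => //; split=> //.
apply: tends_cvg_eq (size_limit u0 u1) => n.
have RY0 : RY n != 0 by exact: (qsize_neq0 ptsY_inj attY_far vI v'I vv' n QY).
have cancel (x y z : K) : x != 0 -> z * x / (x * y) = z / y.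
  by move=> x0; rewrite invfM [z * x]mulrC mulrACA divff // mul1r.
by rewrite AB exprD cancel // expf_neq0.
Qed.

End Step.

(** * The isomorphisms of the sphere as charts *)
Section Charts.
Variable R : realType.
Local Notation K := (Cplx R).

Definition chart_of (phi : nat -> sphere_iso R) (n : nat) : K * K -> K * K :=
  hlift (polys (iso_fwd (phi n))).

Lemma iso_degree1 (phi : sphere_iso R) : pdegree (polys (iso_fwd phi)) = 1%N.
Proof.
have inj : injective (peval (polys (iso_fwd phi))) by exact: can_inj (iso_fwdK phi).
apply: injective_degree1 => //; first exact: polys_coprime.
rewrite lt0n; apply/eqP => d0.
have /inj : peval (polys (iso_fwd phi)) None = peval (polys (iso_fwd phi)) (Some 0).
  by apply: degree0_const => //; exact: polys_coprime.
by [].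
Qed.

Lemma chart_iso phi : chart (chart_of phi).
Proof.
have /choice[k kE] n : exists k : K, k != 0 /\
    forall S S', wedge (chart_of phi n S) (chart_of phi n S') = k * wedge S S'.
  have [k k0 kE] := degree1_wedge (polys_coprime _) (iso_degree1 (phi n)).
  by exists k.
by exists k => n; case: (kE n).
Qed.

Lemma conv_iso phi (s : nat -> sphere R) (p : sphere R) :
  ((fun n => iso_fwd (phi n) (s n)) @ \oo --> p)%classic ->
  conv \oo%classic (chart_of phi) (s : nat -> option K) p.
Proof.
move=> /sphere_conv[m m0 lim].
have /choice[k kE] n : exists k : K, k != 0 /\
    chart_of phi n (vec (s n : option K)) = vscale k (vec (iso_fwd (phi n) (s n) : option K)).
  have [k k0 kE] := hlift_vec (polys_coprime (iso_fwd (phi n))) (s n).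
  by exists k.
exists (fun n => m n / k n) => [n|].
  by rewrite mulf_neq0 ?invr_eq0 //; case: (kE n).
suff -> : (fun n => vscale (m n / k n) (chart_of phi n (vec (s n : option K)))) =
  (fun n => vscale (m n) (vec (iso_fwd (phi n) (s n) : option K))) by [].
apply: funext => n; have [k0 ->] := kE n.
rewrite /vscale /=; case: (vec _) => a b /=.
by congr (_, _); rewrite mulrA divfK.
Qed.

End Charts.

(** * Comparing nested annuli *)
Section SequenceAlgebra.
Variable K : numClosedFieldType.
Local Notation tendsn := (tends (\oo : set_system nat)%classic).
Implicit Types (u w r : nat -> K).

Lemma tends_power_chain u w r (N m : nat) (c C : K) : (forall n, u n != 0) ->
  tendsn (fun n => w n / u n ^+ m) c -> tendsn (fun n => u n / r n ^+ N) C ->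
  tendsn (fun n => w n / r n ^+ (N * m)) (c * C ^+ m).
Proof.
move=> u0 l1 l2.
have l3 : tendsn (fun n => w n / u n ^+ m * (u n / r n ^+ N) ^+ m) (c * C ^+ m).
  by apply: tendsM => //; apply: tendsX.
apply: tends_cvg_eq l3 => n.
rewrite expr_div_n exprM mulrA divfK //; exact: expf_neq0.
Qed.

Lemma tends_ratio_inverse u w (c C : K) : (forall n, u n != 0) -> (forall n, w n != 0) ->
  tendsn (fun n => u n / w n) c -> tendsn (fun n => w n / u n) C -> c * C = 1.
Proof.
move=> u0 w0 l1 l2.
have l3 : tendsn (fun n => u n / w n * (w n / u n)) (c * C) by apply: tendsM.
have l4 : tendsn (fun n => u n / w n * (w n / u n)) 1.
  apply: (@tends_cvg_eq _ (fun=> 1)); last exact: tends_cst.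
  by move=> n; rewrite mulrA divfK // divff.
exact: (tends_unique l3 l4).
Qed.

Lemma tends_power_gap u w (N : nat) (c C : K) : (1 < N)%N ->
  (forall n, u n != 0) -> (forall n, w n != 0) -> tendsn u 0 ->
  tendsn (fun n => u n / w n) c -> ~ tendsn (fun n => w n / u n ^+ N) C.
Proof.
case: N => [|[|N]] // _ u0 w0 lu l1 l2.
have l3 : tendsn (fun n => u n / w n * (w n / u n ^+ N.+2) * u n ^+ N.+1) (c * C * 0 ^+ N.+1).
  by apply: tendsM; [apply: tendsM | apply: tendsX].
have l4 : tendsn (fun n => u n / w n * (w n / u n ^+ N.+2) * u n ^+ N.+1) 1.
  apply: (@tends_cvg_eq _ (fun=> 1)); last exact: tends_cst.
  move=> n; rewrite mulrA divfK // [u n ^+ N.+2]exprS -mulrA [_^-1 * _]mulrC mulrA.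
  by rewrite divff // mulf_neq0 // expf_neq0.
have := tends_unique l4 l3; rewrite expr0n mulr0 => E.
by have := oner_neq0 K; rewrite E eqxx.
Qed.

Lemma quad_transfer (V : finType) (W W' : {set V}) (att att' : V -> V -> option K) v v' Q :
  W \subset W' -> att' v v' = att v v' -> att' v' v = att v' v ->
  (forall x, x \in W -> att' v x = att v x /\ att' v' x = att v' x) ->
  quad W att v v' Q -> quad W' att' v v' Q.
Proof.
move=> /fintype.subsetP sub e1 e2 e3; case: Q => [[[s q] t] r] [[sW qW tW rW] h1 h2].
have [[s1 s2] [q1 q2]] := (e3 _ sW, e3 _ qW).
have [[t1 t2] [r1 r2]] := (e3 _ tW, e3 _ rW).
split; [by split; apply: sub | by rewrite e1 s1 q1 | by rewrite e2 t2 r2].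
Qed.

Lemma qsize_transfer (V : finType) (W : {set V}) (att att' : V -> V -> option K)
    (pts pts' : nat -> V -> option K) v v' Q n :
  att' v v' = att v v' -> att' v' v = att v' v ->
  (forall x, x \in W -> att' v x = att v x /\ att' v' x = att v' x) ->
  {in W, pts' n =1 pts n} -> quad W att v v' Q ->
  qsize att' pts' v v' Q n = qsize att pts v v' Q n.
Proof.
move=> e1 e2 e3 e4; case: Q => [[[s q] t] r] [[sW qW tW rW] _ _].
have [[s1 s2] [q1 q2]] := (e3 _ sW, e3 _ qW).
have [[t1 t2] [r1 r2]] := (e3 _ tW, e3 _ rW).
by rewrite /qsize /qrho /qomega !e4 // e1 e2 s1 q1 t2 r2.
Qed.

Lemma omega_quotient_neq0 (p s q p' t r : option K) (o : K) :
  omega p s q * omega p' t r / o != 0 -> s != q /\ t != r.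
Proof.
have omega_same (x y : option K) : omega x y y = 0 by rewrite /omega brxx mulr0 mul0r.
by move=> h; split; apply: contraNneq h => ->; rewrite omega_same ?(mulr0, mul0r).
Qed.

End SequenceAlgebra.

Section TreeQuads.
Variables (R : realType) (V : finType) (W : {set V}) (T : sphere_tree R W).
Local Notation K := (Cplx R).

(** [attach], with values in the type on which the cross-ratios are defined. *)
Definition att v x : option K := attach T v x.

Lemma att_con v x y : v \in IV T -> x \in verts T -> y \in verts T -> x != v -> y != v ->
  (att v x == att v y) = con T v x y.
Proof.
move=> vI xT yT xv yv; apply/eqP/idP => h; first exact/(attach_con vI xT yT xv yv).
exact/(attach_con vI xT yT xv yv).
Qed.

Lemma attach_far v v' t : v \in IV T -> v' \in IV T -> v != v' -> t \in W ->
  att v' t != att v' v -> att v t = att v v'.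
Proof.
move=> vI v'I vv' tW; have tT := leaf_vert T tW; have vT := IV_vert vI.
have v'T := IV_vert v'I; have tv := leaf_neq vI tW; have tv' := leaf_neq v'I tW.
have v'v : v' != v by rewrite eq_sym.
rewrite att_con // => nc; apply/eqP; rewrite att_con //.
by have := con_other tT vT vv'; rewrite (negbTE nc) orbF.
Qed.

Lemma two_leaves v (s : option K) : v \in IV T -> exists x1 x2, [/\ x1 \in W, x2 \in W,
  att v x1 != s, att v x2 != s & att v x1 != att v x2].
Proof.
move=> vI; have [x1 x1W [h1 _]] := leaf_avoiding s s vI.
have [x2 x2W [h2 h3]] := leaf_avoiding s (att v x1) vI.
exists x1, x2; split=> //; apply/eqP => //.
by move=> E; apply: h3; rewrite /att in E *.
Qed.

Lemma exists_quad v v' : v \in IV T -> v' \in IV T -> exists Q, quad W att v v' Q.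
Proof.
move=> vI v'I; have [s [q [sW qW s1 q1 sq]]] := two_leaves (att v v') vI.
have [t [r [tW rW t1 r1 tr]]] := two_leaves (att v' v) v'I.
by exists (s, q, t, r); split; split.
Qed.

Section Compare.
Variables (pts : nat -> V -> option K) (A : V -> nat -> K * K -> K * K).
Hypothesis pts_inj : forall n, {in W &, injective (pts n)}.
Hypothesis chA : forall v, v \in IV T -> chart (A v).
Hypothesis cvA : forall v a, v \in IV T -> a \in W ->
  conv \oo%classic (A v) (fun n => pts n a) (att v a).
Local Notation tendsn := (tends (\oo : set_system nat)%classic).
Variables v v' w w' : V.
Hypotheses (vI : v \in IV T) (v'I : v' \in IV T) (wI : w \in IV T) (w'I : w' \in IV T).
Hypotheses (vv' : v != v') (ww' : w != w').
Hypotheses (bw : between T v v' w) (bw' : between T v v' w').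

(** Leaves beyond [v] and [v'] are beyond [w] and [w'].  If [w] is not [v], then [w] sees
the two leaves beyond [v] at the same position and the quotient tends to zero. *)
Lemma nested_size_ordered Q Q1 : behind T v w w' -> behind T v' w' w ->
  quad W att v v' Q -> quad W att w w' Q1 -> exists2 c : K,
  tendsn (fun n => qsize att pts v v' Q n / qsize att pts w w' Q1 n) c &
  c != 0 -> w = v /\ w' = v'.
Proof.
move=> b b' hQ hQ1; have [vT v'T] := (IV_vert vI, IV_vert v'I).
have [wT w'T] := (IV_vert wI, IV_vert w'I).
have v'v : v' != v by rewrite eq_sym.
have w'w : w' != w by rewrite eq_sym.
have near_v s : s \in W -> att v s != att v v' ->
    att w s != att w w' /\ (v != w -> con T w s v).
  move=> sW; have sT := leaf_vert T sW; rewrite !att_con ?(leaf_neq vI sW) ?(leaf_neq wI sW) //.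
  exact: behind_leaf.
have near_v' s : s \in W -> att v' s != att v' v ->
    att w' s != att w' w /\ (v' != w' -> con T w' s v').
  move=> sW; have sT := leaf_vert T sW; rewrite !att_con ?(leaf_neq v'I sW) ?(leaf_neq w'I sW) //.
  by apply: behind_leaf => //; rewrite between_sym.
case: Q hQ => [[[s q] t] r] hQ.
have [_ tr _ _] := quad_neq attach_far vI v'I vv' hQ.
have [WQ [sp qp _] [tp rp _]] := hQ; have [sW qW tW rW] := WQ.
have [[sw cs] [qw cq]] := (near_v _ sW sp, near_v _ qW qp).
have [[tw ct] [rw cr]] := (near_v' _ tW tp, near_v' _ rW rp).
exists (omega (att w w') (att w s) (att w q) * omega (att w' w) (att w' t) (att w' r) /
    qomega att v v' (s, q, t, r)).
  apply: tends_rescale.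
  exact: (leaves_compare pts_inj chA cvA attach_far wI w'I ww' hQ1 WQ tr sw qw tw rw).
move=> /omega_quotient_neq0[c0 c0']; split.
  apply/eqP; rewrite eq_sym; apply: contraNT c0 => vw.
  rewrite att_con ?(leaf_neq wI) ?(leaf_vert T) //.
  by apply: con_trans (cs vw) _; rewrite con_sym; exact: cq.
apply/eqP; rewrite eq_sym; apply: contraNT c0' => vw.
rewrite att_con ?(leaf_neq w'I) ?(leaf_vert T) //.
by apply: con_trans (ct vw) _; rewrite con_sym; exact: cr.
Qed.

End Compare.
End TreeQuads.

Local Notation tendsn := (tends (\oo : set_system nat)%classic).

(** The ends [w], [w'] may be met in either order along the path. *)
Lemma nested_size (R : realType) (V : finType) (W : {set V}) (T : sphere_tree R W)
    (pts : nat -> V -> option (Cplx R))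
    (A : V -> nat -> Cplx R * Cplx R -> Cplx R * Cplx R) :
  (forall n, {in W &, injective (pts n)}) ->
  (forall v, v \in IV T -> chart (A v)) ->
  (forall v a, v \in IV T -> a \in W ->
    conv \oo%classic (A v) (fun n => pts n a) (att T v a)) ->
  forall v v' w w' Q, v \in IV T -> v' \in IV T -> w \in IV T -> w' \in IV T ->
  v != v' -> w != w' -> between T v v' w -> between T v v' w' ->
  quad W (att T) v v' Q -> exists Q1 c, [/\ quad W (att T) w w' Q1,
  tendsn (fun n => qsize (att T) pts v v' Q n / qsize (att T) pts w w' Q1 n) c &
  c != 0 -> w = v /\ w' = v' \/ w = v' /\ w' = v].
Proof.
move=> inj chA cvA v v' w w' Q vI v'I wI w'I vv' ww' bw bw' hQ.
have [wT w'T] := (IV_vert wI, IV_vert w'I).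
have w'w : w' != w by rewrite eq_sym.
have /orP[/andP[b b']|/andP[b b']] := between_order (IV_vert vI) (IV_vert v'I) wT w'T vv' ww' bw bw'.
  have [Q1 hQ1] := exists_quad wI w'I.
  have [c lim c0] := nested_size_ordered inj chA cvA vI v'I wI w'I vv' ww' bw bw' b b' hQ hQ1.
  by exists Q1, c; split=> // /c0; left.
have [Q1 hQ1] := exists_quad w'I wI.
have [c lim c0] := nested_size_ordered inj chA cvA vI v'I w'I wI vv' w'w bw' bw b b' hQ hQ1.
exists (qswap Q1), c; split=> [||/c0[-> ->]]; [exact: quad_swap | | by right].
by apply: tends_cvg_eq lim => n; rewrite qsize_swap.
Qed.

(** Two leaves of [X] beyond [v'] in distinct directions cannot both be in the
direction of [v] in [T]; one that is not has, seen from [v], the position of [v']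
in both trees. *)
Lemma attach_transfer (R : realType) (V : finType) (X W : {set V})
    (TX : sphere_tree R X) (T : sphere_tree R W) v v' :
  X \subset W -> v \in IV TX -> v' \in IV TX -> v \in IV T -> v' \in IV T -> v != v' ->
  (forall x, x \in X -> att TX v x = att T v x /\ att TX v' x = att T v' x) ->
  att T v v' = att TX v v'.
Proof.
move=> /fintype.subsetP sub vX v'X vI v'I vv' e.
have [x1 [x2 [x1X x2X h1 h2 h12]]] := two_leaves (att TX v' v) v'X.
suff [x xX [xv hx]] : exists2 x, x \in X & att TX v' x != att TX v' v /\ att T v' x != att T v' v.
  rewrite -(attach_far vX v'X vv' xX xv) -(attach_far vI v'I vv' (sub _ xX) hx).
  by have [-> _] := e _ xX.
have [E|] := eqVneq (att T v' x1) (att T v' v); last by exists x1.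
exists x2 => //; split=> //; rewrite -E; have [_ <-] := e _ x1X; have [_ <-] := e _ x2X.
by rewrite eq_sym.
Qed.

Lemma ins_avoid (K : numClosedFieldType) (p s : option K) :
  (\forall e \near (0 : K)^', ins p e != s)%classic.
Proof.
have [->|sp] := eqVneq s p; last first.
  have ps : p != s by rewrite eq_sym.
  exact: (conv_neq (chart_id _ _) (conv_ins p) (conv_cst s) ps).
apply: filterS (near_dnbhs0 K) => e e0; case: p => [z|].
  by rewrite ins_finite; apply: contraNneq e0 => -[E]; apply/eqP/(addIr z); rewrite add0r.
by rewrite ins_infinite (negbTE e0).
Qed.

Lemma sph_iterSr (R : realType) (V : finType) (Y Z : {set V})
    (TY : sphere_tree R Y) (TZ : sphere_tree R Z) (F : Defs.cover TY TZ) k v s :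
  sph_iter F k.+1 v s = cov_sph F (iter k (cov_map F) v) (sph_iter F k v s).
Proof. by elim: k v s => [|k IH] v s //; rewrite iterSr -IH. Qed.

Lemma size_quad_change (K : numClosedFieldType) (V : finType) (W I : {set V})
    (att : V -> V -> option K) (pts : nat -> V -> option K)
    (A : V -> nat -> K * K -> K * K) :
  (forall n, {in W &, injective (pts n)}) -> (forall v, v \in I -> chart (A v)) ->
  (forall v a, v \in I -> a \in W -> conv \oo%classic (A v) (fun n => pts n a) (att v a)) ->
  (forall v v' t, v \in I -> v' \in I -> v != v' -> t \in W ->
    att v' t != att v' v -> att v t = att v v') ->
  forall w w' Q Q1 (r : nat -> K) (C : K), w \in I -> w' \in I -> w != w' ->
  quad W att w w' Q -> quad W att w w' Q1 ->
  tendsn (fun n => qsize att pts w w' Q1 n / r n) C ->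
  tendsn (fun n => qsize att pts w w' Q n / r n) C.
Proof.
move=> inj chA cvA far w w' Q Q1 r C wI w'I ww' hQ hQ1 l1.
have l2 := qsize_change inj chA cvA far wI w'I ww' hQ hQ1.
have l3 : tendsn (fun n => qsize att pts w w' Q n / qsize att pts w w' Q1 n *
  (qsize att pts w w' Q1 n / r n)) (1 * C) by apply: tendsM.
rewrite mul1r in l3; apply: tends_cvg_eq l3 => n.
by rewrite mulrA divfK // (qsize_neq0 inj far).
Qed.

Lemma tends_inverse_neq0 (K : numClosedFieldType) (u w : nat -> K) (c C : K) :
  (forall n, u n != 0) -> (forall n, w n != 0) ->
  tendsn (fun n => u n / w n) c -> tendsn (fun n => w n / u n ^+ 1) C -> c != 0.
Proof.
move=> u0 w0 l1 l2; have := tends_ratio_inverse u0 w0 l1 l2; apply: contra_eq_neq => ->.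
by rewrite mul0r eq_sym oner_neq0.
Qed.

Lemma tends_quotient_unique (K : numClosedFieldType) (u w r : nat -> K) (c C : K) :
  (forall n, w n != 0) -> tendsn (fun n => u n / w n) c ->
  tendsn (fun n => w n / r n ^+ 1) 1 -> tendsn (fun n => u n / r n ^+ 1) C -> c = C.
Proof.
move=> w0 l1 l2 l3.
have l4 : tendsn (fun n => u n / w n * (w n / r n ^+ 1)) (c * 1) by apply: tendsM.
rewrite -[c]mulr1; apply: (tends_unique l4); apply: tends_cvg_eq l3 => n.
by rewrite mulrA divfK.
Qed.

Lemma tends_constant_ratio (K : numClosedFieldType) (r : nat -> K) (C : K) :
  (forall n, r n != 0) -> tendsn (fun n => r n / r n ^+ 1) C -> C = 1.
Proof.
move=> r0 l; apply: (tends_unique l); apply: (@tends_cvg_eq _ (fun=> 1)); last exact: tends_cst.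
by move=> n; rewrite expr1 divff.
Qed.

Lemma local_germ (K : numClosedFieldType) (g : {poly K} * {poly K}) (p : option K) (c : K) :
  coprimep g.1 g.2 ->
  tends ((0 : K)^')%classic (fun e => loc (peval g p) (peval g (ins p e)) / e ^+ 1) c ->
  germ (peval g) p (peval g p) c.
Proof.
move=> cop lim; split=> //.
have qo : peval g p != opp_pt (peval g p) by case: (peval g p).
exact: (conv_neq (chart_id _ _) (conv_peval cop p) (conv_cst _) qo).
Qed.

(** * Degenerating rational maps and the iteration *)
Section Boundary.
Variables (R : realType) (V : finType) (X Y Z : {set V}) (d : nat).
Variables (P : portrait Y Z d) (G : Dyn R X P).
Local Notation K := (Cplx R).
Local Notation TX := (treeX G).
Local Notation TY := (treeY G).
Local Notation TZ := (treeZ G).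
Local Notation FG := (dcov G).
Local Notation F := (cov_map (dcov G)).
Hypothesis d2 : (2 <= d)%N.
Hypothesis XYZ : X \subset Y :&: Z.
Variables (f : nat -> ratmap R) (y z : nat -> V -> option K).
Hypothesis rat : forall n, inRat X P (f n) (y n) (z n).
Variables phiY phiZ : nat -> V -> sphere_iso R.
Hypothesis cvgY : {in IV TY, forall v, {in Y, forall a,
  ((fun n => iso_fwd (phiY n v) (y n a)) @ \oo --> attach TY v a)%classic}}.
Hypothesis cvgZ : {in IV TZ, forall w, {in Z, forall b,
  ((fun n => iso_fwd (phiZ n w) (z n b)) @ \oo --> attach TZ w b)%classic}}.
Hypothesis cvgf : {in IV TY, forall v, cvg_locally_uniformly_outside (marked TY v)
  (fun n => iso_fwd (phiZ n (F v)) \o f n \o iso_bwd (phiY n v)) (cov_sph FG v)}.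

Let XY : X \subset Y. Proof. by apply: fintype.subset_trans XYZ (subsetIl _ _). Qed.
Let XZ : X \subset Z. Proof. by apply: fintype.subset_trans XYZ (subsetIr _ _). Qed.

Let AY v := chart_of (fun n => phiY n v).
Let AZ v := chart_of (fun n => phiZ n v).

Lemma ptsY_inj n : {in Y &, injective (y n)}. Proof. by case: (rat n) => _ []. Qed.
Lemma ptsZ_inj n : {in Z &, injective (z n)}. Proof. by case: (rat n) => _ []. Qed.

Lemma chartY v : v \in IV TY -> chart (AY v). Proof. by move=> _; exact: chart_iso. Qed.
Lemma chartZ v : v \in IV TZ -> chart (AZ v). Proof. by move=> _; exact: chart_iso. Qed.

Lemma convY v a : v \in IV TY -> a \in Y ->
  conv \oo%classic (AY v) (fun n => y n a) (att TY v a).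
Proof. by move=> vI aY; apply: conv_iso; exact: cvgY. Qed.

Lemma convZ v a : v \in IV TZ -> a \in Z ->
  conv \oo%classic (AZ v) (fun n => z n a) (att TZ v a).
Proof. by move=> vI aY; apply: conv_iso; exact: cvgZ. Qed.

Lemma fibre_form n b : b \in Z -> exists2 k : K, k != 0 & forall S,
  wedge (hlift (polys (f n)) S) (vec (z n b)) =
  k * \prod_(a | (a \in Y) && (F a == b)) wedge S (vec (y n a)) ^+ pdeg P a.
Proof.
move=> bZ; have [fd _ fy fdeg _] := rat n.
pose A := [pred a | (a \in Y) && (F a == b)].
have FP a : a \in Y -> F a = Defs.pmap P a by move=> aY; case: (dyn_portrait G aY).
have d0 : (0 < pdegree (polys (f n)))%N by rewrite -rdeg_polys fd; apply: leq_trans d2.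
have injA : {in A &, injective (y n)}.
  by move=> a a' /andP[aY _] /andP[a'Y _]; apply: ptsY_inj.
have imA a : a \in A -> peval (polys (f n)) (y n a) = z n b.
  by move=> /andP[aY /eqP <-]; rewrite FP // -fy.
have degA : (\sum_(a in A) pldeg (polys (f n)) (y n a) = pdegree (polys (f n)))%N.
  rewrite -rdeg_polys fd -[RHS](portrait_fib P bZ); apply: eq_big => [a|a /andP[aY _]].
    by rewrite !inE; case: (boolP (a \in Y)) => //= aY; rewrite FP.
  exact: fdeg.
have [_ [k k0 E]] := fibre_family (polys_coprime (f n)) d0 injA imA degA.
exists k => // S; rewrite E; congr (_ * _); apply: eq_bigr => a /andP[aY _].
by congr (_ ^+ _); exact: fdeg.
Qed.

Lemma fibre_degrees b : b \in Z -> (\sum_(a | (a \in Y) && (F a == b)) pdeg P a = d)%N.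
Proof.
move=> bZ; rewrite -[RHS](portrait_fib P bZ); apply: eq_bigl => a.
by case: (boolP (a \in Y)) => //= aY; case: (dyn_portrait G aY) => ->.
Qed.

Definition unmarked v (S : option K) := ~ marked TY v S.

Lemma att_marked (W : {set V}) (T : sphere_tree R W) v a : v \in IV T -> a \in W ->
  marked T v (att T v a).
Proof.
move=> vI aW; have [vT aT] := (IV_vert vI, leaf_vert T aW); have av := leaf_neq vI aW.
have [ev _] := nxtP vT aT av; exists (nxt T v a) => //; exact: attachE.
Qed.

Lemma unmarked_att v S a : v \in IV TY -> a \in Y -> unmarked v S -> S != att TY v a.
Proof. by move=> vI aY uS; apply/eqP => E; apply: uS; rewrite E; exact: att_marked. Qed.

Lemma unmarked_img v S b : v \in IV TY -> b \in Z -> unmarked v S ->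
  peval (polys (cov_sph FG v)) S != att TZ (F v) b.
Proof.
move=> vI bZ uS; apply/eqP => E; apply: (unmarked_image vI uS).
have m : marked TZ (F v) (att TZ (F v) b).
  by apply: att_marked => //; exact: cov_internal.
exact: (eq_ind_r (marked TZ (F v)) m E).
Qed.

Lemma unmarked_near v p : v \in IV TY ->
  (\forall e \near (0 : K)^', unmarked v (ins p e))%classic.
Proof.
move=> vI; have h : (\forall e \near (0 : K)^', forall u, ins p e != (sph_emb TY v u : option K))%classic.
  by apply: near_fin => u; exact: ins_avoid.
by apply: filterS h => e h [u _ E]; have := h u; rewrite E eqxx.
Qed.

Lemma unmarked_lim v S : v \in IV TY -> unmarked v S ->
  exists2 sg : nat -> option K, conv \oo%classic (AY v) sg S &
    conv \oo%classic (AZ (F v)) (fun n => peval (polys (f n)) (sg n))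
      (peval (polys (cov_sph FG v)) S).
Proof.
move=> vI uS; exists (fun n => iso_bwd (phiY n v) S); apply: conv_iso.
  have -> : (fun n => iso_fwd (phiY n v) (iso_bwd (phiY n v) S)) = fun=> S.
    by apply: funext => n; exact: iso_bwdK.
  exact: cvg_cst.
exact: (uniform_pointwise (cvgf vI) uS).
Qed.

Section Annulus.
Variables v v' : V.
Hypotheses (vI : v \in IV TY) (v'I : v' \in IV TY) (vv' : v != v').
Hypothesis ncl : no_critical_leaf FG (annulus TY v v').

(** A leaf inside the annulus is mapped inside the image annulus, which gives by
contraposition the hypothesis [sides] of [size_step]. *)
Lemma annulus_size_step QY QZ :
  quad Y (att TY) v v' QY -> quad Z (att TZ) (F v) (F v') QZ ->
  exists c c' : K, [/\ c != 0, c' != 0,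
    tendsn (fun n => qsize (att TZ) z (F v) (F v') QZ n /
      qsize (att TY) y v v' QY n ^+ ldeg (cov_sph FG v) (attach TY v v')) (c * c') &
    ldeg (cov_sph FG v) (attach TY v v') = 1%N ->
    germ (cov_sph FG v) (att TY v v') (att TZ (F v) (F v')) c /\
    germ (cov_sph FG v') (att TY v' v) (att TZ (F v') (F v)) c'].
Proof.
have v'v : v' != v by rewrite eq_sym.
have ncl' : no_critical_leaf FG (annulus TY v' v) by rewrite /annulus finset.setIC.
have [vT v'T] := (IV_vert vI, IV_vert v'I).
have [FvI Fv'I] := (cov_internal FG vI, cov_internal FG v'I).
have FvFv' : F v != F v' by rewrite eq_sym; exact: (annulus_ends vI v'I vv' ncl).
case: QY => [[[a1 ai] t1] a0]; case: QZ => [[[b1 bi] tb] b0] hY hZ.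
have gp : peval (polys (cov_sph FG v)) (att TY v v') = att TZ (F v) (F v').
  exact: (annulus_fixes_ends vI v'I vv' ncl).
have gp' : peval (polys (cov_sph FG v')) (att TY v' v) = att TZ (F v') (F v).
  exact: (annulus_fixes_ends v'I vI v'v ncl').
have sides a : a \in Y -> F a \in Z ->
  att TZ (F v) (F a) != att TZ (F v) (F v') \/
  att TZ (F v') (F a) != att TZ (F v') (F v) ->
  att TY v a != att TY v v' \/ att TY v' a != att TY v' v.
  move=> aY FaZ h; have aT := leaf_vert TY aY; have FaT := leaf_vert TZ FaZ.
  have [FvT Fv'T] := (IV_vert FvI, IV_vert Fv'I).
  have [av av'] := (leaf_neq vI aY, leaf_neq v'I aY).
  have [Fav Fav'] := (leaf_neq FvI FaZ, leaf_neq Fv'I FaZ).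
  have [E|] := eqVneq (att TY v a) (att TY v v'); last by left.
  have [E'|] := eqVneq (att TY v' a) (att TY v' v); last by right.
  move/eqP: E; rewrite att_con // => c; move/eqP: E'; rewrite att_con // => c'.
  have F'v' : F v' != F v by rewrite eq_sym.
  case: h; rewrite att_con // => /negP[].
    by apply: (annulus_leaf_con vI v'I vv' ncl); rewrite aT av av' con_sym c con_sym c'.
  by apply: (annulus_leaf_con v'I vI v'v ncl'); rewrite aT av av' con_sym c' con_sym c.
have [c [c' [c0 c'0 lc lc' [mm lim]]]] := size_step ptsY_inj chartY convY (@attach_far _ _ _ TY) ptsZ_inj chartZ convZ
  (@attach_far _ _ _ TZ) (fun n => polys_coprime (f n)) fibre_form fibre_degrees
  (fun v _ => polys_coprime (cov_sph FG v)) (@cov_nonconst _ _ _ _ _ _ FG)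
  unmarked_att unmarked_img unmarked_near unmarked_lim vI v'I vv' FvI Fv'I FvFv' gp gp' sides hY hZ.
exists c, c'; split; [exact: c0|exact: c'0|exact: lim|move=> m1].
rewrite mm in lc'; have m1' : pldeg (polys (cov_sph FG v)) (att TY v v') = 1%N := m1.
rewrite m1' in lc lc'; rewrite -gp in lc; rewrite -gp' in lc'; rewrite -gp -gp'.
split.
  exact: (local_germ (polys_coprime _) lc).
exact: (local_germ (polys_coprime _) lc').
Qed.

End Annulus.

Lemma same_marking v x : v \in IV TX -> x \in X ->
  att TX v x = att TY v x /\ att TX v x = att TZ v x.
Proof. by move=> vI xX; exact: dyn_attach. Qed.

Lemma same_direction v v' : v \in IV TX -> v' \in IV TX -> v != v' ->
  att TY v v' = att TX v v' /\ att TZ v v' = att TX v v'.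
Proof.
move=> vI v'I vv'; have [[vY vZ] [v'Y v'Z]] := (dyn_internal vI, dyn_internal v'I).
split; apply: attach_transfer => // x xX;
  by have [[h1 h2] [h3 h4]] := (same_marking vI xX, same_marking v'I xX).
Qed.

(** On leaves of [X] the two markings of the sphere agree, so the size of an annulus
is the same in the source tree and in the target tree: this is what allows
iteration. *)
Lemma marked_quad v v' : v \in IV TX -> v' \in IV TX -> v != v' ->
  exists Q, [/\ quad Y (att TY) v v' Q, quad Z (att TZ) v v' Q &
    forall n, qsize (att TZ) z v v' Q n = qsize (att TY) y v v' Q n].
Proof.
move=> vI v'I vv'; have [Q hQ] := exists_quad vI v'I.
have v'v : v' != v by rewrite eq_sym.
have [[eY eZ] [eY' eZ']] := (same_direction vI v'I vv', same_direction v'I vI v'v).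
have mY x : x \in X -> att TY v x = att TX v x /\ att TY v' x = att TX v' x.
  by move=> xX; have [[h1 h2] [h3 h4]] := (same_marking vI xX, same_marking v'I xX).
have mZ x : x \in X -> att TZ v x = att TX v x /\ att TZ v' x = att TX v' x.
  by move=> xX; have [[h1 h2] [h3 h4]] := (same_marking vI xX, same_marking v'I xX).
exists Q; split; [exact: (quad_transfer XY) hQ|exact: (quad_transfer XZ) hQ|] => n.
have -> : qsize (att TY) y v v' Q n = qsize (att TX) y v v' Q n.
  exact: (qsize_transfer eY eY' mY).
apply: (qsize_transfer eZ eZ' mZ) => // x xX.
by have [_ _ _ _ ->] := rat n.
Qed.

Section Chain.
Variables (k0 : nat) (v v' : V).
Hypotheses (vX : v \in IV TX) (v'X : v' \in IV TX) (vv' : v != v').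
Local Notation vk k := (iter k F v).
Local Notation vk' k := (iter k F v').
Hypothesis hk : forall k, (k < k0)%N -> [/\ vk k \in IV TX, vk' k \in IV TX,
  vk k <> vk' k & no_critical_leaf FG (annulus TY (vk k) (vk' k))].
Variable Q0 : V * V * V * V.
Hypothesis Q0Z : quad Z (att TZ) v v' Q0.

Let p k : option K := att TZ (vk k) (vk' k).
Let p' k : option K := att TZ (vk' k) (vk k).
Let r0 n := qsize (att TZ) z v v' Q0 n.
Let m k := ldeg (cov_sph FG (vk k)) (attach TY (vk k) (vk' k)).

Lemma chain_vertices k : (k <= k0)%N ->
  [/\ vk k \in IV TZ, vk' k \in IV TZ & vk k != vk' k].
Proof.
case: k => [_|k kk]; first by split=> //; [have [] := dyn_internal vX | have [] := dyn_internal v'X].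
have [uX u'X /eqP uu' ncl] := hk kk.
have [[uY uZ] [u'Y u'Z]] := (dyn_internal uX, dyn_internal u'X).
split; [exact: (cov_internal FG uY)|exact: (cov_internal FG u'Y)|].
by rewrite eq_sym; exact: (annulus_ends uY u'Y uu' ncl).
Qed.

Lemma chain_points k : (k <= k0)%N ->
  sph_iter FG k v (p 0) = p k /\ sph_iter FG k v' (p' 0) = p' k.
Proof.
elim: k => [//|k IH] kk; have [e e'] := IH (ltnW kk).
have [uX u'X /eqP uu' ncl] := hk kk.
have u'u : vk' k != vk k by rewrite eq_sym.
have [[uY uZ] [u'Y u'Z]] := (dyn_internal uX, dyn_internal u'X).
have [eY eZ] := same_direction uX u'X uu'; have [eY' eZ'] := same_direction u'X uX u'u.
have ncl' : no_critical_leaf FG (annulus TY (vk' k) (vk k)) by rewrite /annulus finset.setIC.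
rewrite !sph_iterSr e e' /p /p' eZ -eY eZ' -eY'.
by split; exact: annulus_fixes_ends.
Qed.

(** The exponent [N] is the product of the local degrees along the orbit of the
annulus.  When it is one, every step is unramified at both ends and [C] collects
the derivatives. *)
Lemma chain k : (k <= k0)%N -> exists N (C : K),
  [/\ (0 < N)%N, C != 0, (1 < N)%N <-> exists2 j, (j < k)%N & (1 < m j)%N,
   forall Q, quad Z (att TZ) (vk k) (vk' k) Q ->
     tendsn (fun n => qsize (att TZ) z (vk k) (vk' k) Q n / r0 n ^+ N) C &
   N = 1%N -> exists c c' : K, [/\ c != 0, c' != 0, C = c * c',
     germ (sph_iter FG k v) (p 0) (p k) c & germ (sph_iter FG k v') (p' 0) (p' k) c']].
Proof.
elim: k => [_|k IH kk].
  exists 1%N, 1; split=> //; first exact: oner_neq0.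
  - by split=> // -[j].
  - move=> Q hQ; have [vZ v'Z vv0] := chain_vertices (leq0n k0).
    exact: (qsize_change ptsZ_inj chartZ convZ (@attach_far _ _ _ TZ) vZ v'Z vv0 hQ Q0Z).
  move=> _; exists 1, 1; split; try exact: oner_neq0; try exact: germ_id.
  by rewrite mul1r.
have [N [C [N0 C0 Nm lim mult]]] := IH (ltnW kk).
have [uX u'X /eqP uu' ncl] := hk kk.
have [[uY uZ] [u'Y u'Z]] := (dyn_internal uX, dyn_internal u'X).
have [Q [QY QZ QYZ]] := marked_quad uX u'X uu'.
have [wZ w'Z ww'] := chain_vertices kk.
have [Q1 hQ1] := exists_quad wZ w'Z.
have [c [c' [c0 c'0 limQ gk]]] := annulus_size_step uY u'Y uu' ncl QY hQ1.
have u'u : vk' k != vk k by rewrite eq_sym.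
have [eY eZ] := same_direction uX u'X uu'; have [eY' eZ'] := same_direction u'X uX u'u.
have m0 : (0 < m k)%N.
  by apply: (ldeg_gt0 (polys_coprime (cov_sph FG (vk k)))); exact: cov_nonconst.
have size0 n : qsize (att TY) y (vk k) (vk' k) Q n != 0.
  exact: (qsize_neq0 ptsY_inj (@attach_far _ _ _ TY)).
(* the size in the source tree is the one in the target tree of the last step *)
have lim1 : tendsn (fun n => qsize (att TZ) z (vk k.+1) (vk' k.+1) Q1 n / r0 n ^+ (N * m k))
    (c * c' * C ^+ m k).
  apply: (tends_power_chain size0 limQ); apply: tends_cvg_eq (lim _ QZ) => n.
  by rewrite QYZ.
exists (N * m k)%N, (c * c' * C ^+ m k); split.
- by rewrite muln_gt0 N0.
- exact: mulf_neq0 (mulf_neq0 c0 c'0) (expf_neq0 _ C0).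
- split=> [h|[j]].
    have [m1|m1] := ltnP 1 (m k); first by exists k.
    have m1' : m k = 1%N by apply/eqP; rewrite eqn_leq m1.
    have [j jk mj] : exists2 j, (j < k)%N & (1 < m j)%N by apply/Nm; rewrite m1' muln1 in h.
    by exists j => //; apply: ltnW.
  rewrite ltnS leq_eqVlt => /predU1P[->|jk] mj; first by apply: leq_trans mj _; rewrite leq_pmull.
  have h : (1 < N)%N by apply/Nm; exists j.
  by apply: leq_trans h _; rewrite leq_pmulr.
- move=> Q2 hQ2.
  exact: (size_quad_change ptsZ_inj chartZ convZ (@attach_far _ _ _ TZ) wZ w'Z ww' hQ2 hQ1 lim1).
move=> /eqP; rewrite muln_eq1 => /andP[/eqP /mult[d1 [d1' [d0 d'0 CE g1 g1']]] /eqP m1].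
exists (d1 * c), (d1' * c'); split; try exact: mulf_neq0.
- by rewrite m1 CE expr1 [RHS]mulrACA [RHS]mulrC.
- have [g2 _] := gk m1; rewrite eY -eZ in g2.
  rewrite (_ : sph_iter FG k.+1 v = cov_sph FG (vk k) \o sph_iter FG k v); last first.
    by apply: funext => s; exact: sph_iterSr.
  exact: (germ_comp d0 g1 g2).
have [_ g2'] := gk m1; rewrite eY' -eZ' in g2'.
rewrite (_ : sph_iter FG k.+1 v' = cov_sph FG (vk' k) \o sph_iter FG k v'); last first.
  by apply: funext => s; exact: sph_iterSr.
exact: (germ_comp d'0 g1' g2').
Qed.

Let vZ : v \in IV TZ. Proof. by have [] := dyn_internal vX. Qed.
Let v'Z : v' \in IV TZ. Proof. by have [] := dyn_internal v'X. Qed.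

Let size0 u u' Q n : u \in IV TZ -> u' \in IV TZ -> u != u' -> quad Z (att TZ) u u' Q ->
  qsize (att TZ) z u u' Q n != 0.
Proof. by move=> uI u'I uu'; apply: (qsize_neq0 ptsZ_inj (@attach_far _ _ _ TZ)). Qed.

(** Otherwise the first size [r0] would be at most of the order of the last one,
itself of the order of [r0 ^+ N] with [r0] tending to zero. *)
Lemma critical_not_nested : (exists2 j, (j < k0)%N & (1 < m j)%N) ->
  between TZ v v' (vk k0) -> between TZ v v' (vk' k0) -> False.
Proof.
have [wZ w'Z ww'] := chain_vertices (leqnn k0).
have [N [C [_ _ Nm lim _]]] := chain (leqnn k0).
move=> /Nm N1 b b'.
have [Q1 [c [hQ1 limQ _]]] :=
  nested_size ptsZ_inj chartZ convZ vZ v'Z wZ w'Z vv' ww' b b' Q0Z.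
apply: (tends_power_gap N1 _ _ _ limQ (lim _ hQ1)) => [n|n|]; try exact: size0.
exact: (qsize_tends0 chartZ convZ (@attach_far _ _ _ TZ) vZ v'Z vv' Q0Z).
Qed.

(** The two sizes are comparable, so that neither annulus can be strictly inside
the other; once the ends agree the sizes are equal, and [C = 1]. *)
Lemma noncritical_nested : ~ (exists2 j, (j < k0)%N & (1 < m j)%N) ->
  (between TZ v v' (vk k0) /\ between TZ v v' (vk' k0)) \/
  (between TZ (vk k0) (vk' k0) v /\ between TZ (vk k0) (vk' k0) v') ->
  exists c c' : K, [/\ c * c' = 1, germ (sph_iter FG k0 v) (p 0) (p k0) c,
     germ (sph_iter FG k0 v') (p' 0) (p' k0) c', c != 0 &
     vk k0 = v /\ vk' k0 = v' \/ vk k0 = v' /\ vk' k0 = v].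
Proof.
have [wZ w'Z ww'] := chain_vertices (leqnn k0).
have [N [C [N0 C0 Nm lim mult]]] := chain (leqnn k0).
move=> nc nest; have N1 : N = 1%N.
  by apply/eqP; rewrite eqn_leq N0 andbT leqNgt; apply/negP => /Nm.
have [c [c' [c0 c'0 CE g g']]] := mult N1; exists c, c'.
rewrite N1 in lim.
have ends : vk k0 = v /\ vk' k0 = v' \/ vk k0 = v' /\ vk' k0 = v.
  case: nest => [[b b']|[b b']].
    have [Q1 [c1 [hQ1 limQ]]] :=
      nested_size ptsZ_inj chartZ convZ vZ v'Z wZ w'Z vv' ww' b b' Q0Z.
    apply; apply: (tends_inverse_neq0 _ _ limQ (lim _ hQ1)) => n; exact: size0.
  have [Q hQ] := exists_quad wZ w'Z.
  have [Q1 [c1 [hQ1 limQ]]] :=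
    nested_size ptsZ_inj chartZ convZ wZ w'Z vZ v'Z ww' vv' b b' hQ.
  have same : tendsn (fun n => qsize (att TZ) z v v' Q1 n / r0 n ^+ 1) 1.
    exact: (qsize_change ptsZ_inj chartZ convZ (@attach_far _ _ _ TZ) vZ v'Z vv' hQ1 Q0Z).
  have -> : c1 = C.
    apply: (tends_quotient_unique _ limQ same (lim _ hQ)) => n; exact: size0.
  by move=> /(_ C0) [[e e']|[e e']]; [left | right]; split; apply: esym.
have limC : tendsn (fun n => r0 n / r0 n ^+ 1) C.
  case: ends => -[e e'].
    by have := lim Q0; rewrite e e'; apply; exact: Q0Z.
  (* the ends are exchanged: read the same annulus from its other side *)
  have := lim (qswap Q0); rewrite e e' => /(_ (quad_swap Q0Z)).
  by apply: tends_cvg_eq => n; rewrite qsize_swap.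
have C1 : C = 1 by apply: tends_constant_ratio limC => n; exact: size0.
by split => //; rewrite -CE.
Qed.
End Chain.
End Boundary.

Theorem lemma3p3 (R : realType) (V : finType) (X Y Z : {set V}) (d : nat)
    (P : portrait Y Z d) (G : Dyn R X P) (k0 : nat) (v v' : V) :
  (2 <= d)%N ->
  (3 <= #|X|)%N -> (3 <= #|Y|)%N -> (3 <= #|Z|)%N ->
  X \subset Y :&: Z ->
  in_boundary G ->
  (1 <= k0)%N ->
  v \in IV (treeX G) -> v' \in IV (treeX G) -> v <> v' ->
  let F := cov_map (dcov G) in
  let A k := annulus (treeY G) (iter k F v) (iter k F v') in
  (forall k, (k < k0)%N ->
     [/\ iter k F v \in IV (treeX G), iter k F v' \in IV (treeX G),
         iter k F v <> iter k F v' & no_critical_leaf (dcov G) (A k)]) ->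
  let w := iter k0 F v in
  let w' := iter k0 F v' in
  let path0 := tree_path (treeZ G) v v' in
  let path1 := tree_path (treeZ G) w w' in
  let critical := exists k D,
    [/\ (k < k0)%N, degree_on (dcov G) (A k) D & (1 < D)%N] in
  let p := attach (treeX G) v v' in
  let p' := attach (treeX G) v' v in
  let g := sph_iter (dcov G) k0 v in
  let g' := sph_iter (dcov G) k0 v' in
  (critical -> ~ (path1 `<=` path0)%classic) /\
  (~ critical -> (path1 `<=` path0)%classic \/ (path0 `<=` path1)%classic ->
     [/\ w = v, w' = v', g p = p, g' p' = p'
       & multiplier g p * multiplier g' p' = 1]
     \/
     [/\ w = v', w' = v, g p = p', g' p' = p
       & multiplier (g' \o g) p = 1]).
Proof.
move=> d2 _ _ _ XYZ [f [y [z [rat [phiY [phiZ [cvY cvZ cvf _]]]]]]] k01 vX v'X /eqP vv' F A hk.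
move=> w w' path0 path1 critical p p' g g'.
have v'v : v' != v by rewrite eq_sym.
have [Q0 [_ Q0Z _]] := marked_quad XYZ rat vX v'X vv'.
have crit_iff : critical <-> exists2 j, (j < k0)%N &
    (1 < ldeg (cov_sph (dcov G) (iter j F v)) (attach (treeY G) (iter j F v) (iter j F v')))%N.
  split=> [[k [D [kk degD D1]]]|[k kk m1]].
    have [uX u'X /eqP uu' ncl] := hk _ kk; exists k => //.
    have [[uY _] [u'Y _]] := (dyn_internal uX, dyn_internal u'X).
    by rewrite -(degree_on_unique uY u'Y uu' ncl degD).
  have [uX u'X /eqP uu' ncl] := hk _ kk.
  have [[uY _] [u'Y _]] := (dyn_internal uX, dyn_internal u'X).
  exists k, (ldeg (cov_sph (dcov G) (iter k F v)) (attach (treeY G) (iter k F v) (iter k F v'))).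
  by split=> //; exact: degree_on_annulus.
have [wZ w'Z ww'] := chain_vertices vX v'X vv' hk (leqnn k0).
have [[_ vZ] [_ v'Z]] := (dyn_internal vX, dyn_internal v'X).
have sub_between (a b c c' : V) : c \in IV (treeZ G) -> c' \in IV (treeZ G) ->
    (tree_path (treeZ G) c c' `<=` tree_path (treeZ G) a b)%classic ->
    between (treeZ G) a b c /\ between (treeZ G) a b c'.
  move=> cI c'I sub; have [h h'] := tree_path_ends (IV_vert cI) (IV_vert c'I).
  by split; apply/path_between/sub.
split=> [/crit_iff cr /(sub_between _ _ _ _ wZ w'Z)[b b']|nc nest].
  exact: (critical_not_nested d2 XYZ rat cvY cvZ cvf vX v'X vv' hk Q0Z cr b b').
have nest' : (between (treeZ G) v v' w /\ between (treeZ G) v v' w') \/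
    (between (treeZ G) w w' v /\ between (treeZ G) w w' v').
  by case: nest => [/(sub_between _ _ _ _ wZ w'Z)|/(sub_between _ _ _ _ vZ v'Z)] h;
    [left | right].
have nc' : ~ exists2 j, (j < k0)%N &
    (1 < ldeg (cov_sph (dcov G) (iter j F v)) (attach (treeY G) (iter j F v) (iter j F v')))%N.
  by move=> /crit_iff.
have [c [c' [cc gc gc' c0 ends]]] :=
  noncritical_nested d2 XYZ rat cvY cvZ cvf vX v'X vv' hk Q0Z nc' nest'.
have [gp gp'] := chain_points XYZ hk (leqnn k0).
have [_ pE] := same_direction XYZ vX v'X vv'.
have [_ pE'] := same_direction XYZ v'X vX v'v.
rewrite /= in gp gp' gc gc'.
rewrite -/F -/w -/w' in gp gp' gc gc' ends.
case: ends => -[e e']; [left | right]; rewrite e e' pE pE' in gp gp' gc gc'.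
  split=> //.
  by rewrite (multiplier_germ gp gc) (multiplier_germ gp' gc').
split=> //; rewrite -cc; apply: multiplier_germ.
  exact: (etrans (congr1 g' gp) gp').
exact: germ_comp c0 gc gc'.
Qed.
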